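(* Let $S\subset C(\mathbf{k})$ be finite and let $F_1,F_2\in K[x_1,\dots,x_n]$ be coprime polynomials of the same degree $d>0$, such that for each $i\in\{1,2\}$ one of the coefficients of $F_i$ equals $1$. For every integer $m\ge2d$ put $M:=M_m:=2\binom{m+n-d}{n}-\binom{m+n-2d}{n}$ and $M':=M'_m:=\binom{m+n}{n}-M$. Then $M'_m=O(m^{n-2})$ as $m\to\infty$. Moreover, suppose that for some $\mathbf g=(g_1,\dots,g_n)\in(\mathcal{O}_S^* )^n$, some integer $m\ge2d$ and some positive integer $r$, the elements $\mathbf g^{\mathbf i}$ with $\mathbf i\in\mathbb{Z}_{\ge0}^n$, $|\mathbf i|\le m$, are linearly nondegenerate over $V_{F_1,F_2}(Mr+1)$. Then $$M\,N_{S,\gcd}(F_1(\mathbf g),F_2(\mathbf g))\le\Bigl(M'+\tfrac{d_{Mr}}{d_{M(r-1)}}M-M\Bigr)mn\max_{1\le i\le n}h(g_i)+cM\bigl(h(F_1)+h(F_2)\bigr)+c'M\max\{0,2\mathfrak g-2+|S|\},$$ where $c:=\frac{d_{Mr}}{d_{M(r-1)}}(1+M(r+1))$ and $c':=\frac{d_{Mr}^2M}{2d_{M(r-1)}}$.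
   Context: $\mathbf{k}$ is an algebraically closed field of characteristic zero, $C$ a smooth projective curve over $\mathbf{k}$ of genus $\mathfrak g$, $K=\mathbf{k}(C)$; $v_{\mathfrak p}$ is the order-of-vanishing valuation at $\mathfrak p\in C(\mathbf{k})$. $\mathcal{O}_S^*=\{f\in K^*: v_{\mathfrak p}(f)=0\ \forall\mathfrak p\notin S\}$. For $f\in K^*$, $h(f)=\sum_{\mathfrak p}\max\{0,-v_{\mathfrak p}(f)\}$; $N_{S,\gcd}(f,g)=\sum_{\mathfrak p\notin S}\min\{\max\{0,v_{\mathfrak p}(f)\},\max\{0,v_{\mathfrak p}(g)\}\}$. For nonzero $F=\sum a_{\mathbf i}\mathbf x^{\mathbf i}$, $h(F)=-\sum_{\mathfrak p}\min_{a_{\mathbf i}\ne0}v_{\mathfrak p}(a_{\mathbf i})$. $\mathbf g^{\mathbf i}=g_1^{i_1}\cdots g_n^{i_n}$, $|\mathbf i|=i_1+\cdots+i_n$. For an integer $s\ge0$, $V_{F_1,F_2}(s)$ is the $\mathbf{k}$-vector subspace of $K$ spanned by all products $\prod_\alpha\alpha^{n_\alpha}$, where $\alpha$ runs over the nonzero coefficients of $F_1$ and $F_2$, $n_\alpha\ge0$, $\sum n_\alpha=s$ (so $V_{F_1,F_2}(0)=\mathbf{k}$); $d_s:=\dim_{\mathbf{k}}V_{F_1,F_2}(s)$. For a $\mathbf{k}$-subspace $E\subset K$, elements $y_1,\dots,y_N\in K$ are linearly nondegenerate over $E$ if $\sum a_iy_i=0$ with all $a_i\in E$ implies all $a_i=0$.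 *)

(* Defs.v *)
From HB Require Import structures.
From mathcomp Require Import all_boot all_order all_algebra.
From mathcomp Require Import mpoly.
From Stdlib Require Import ClassicalEpsilon.
Set Implicit Arguments. Unset Strict Implicit. Unset Printing Implicit Defensive.
Import Order.TTheory GRing.Theory Num.Theory.
Local Open Scope ring_scope.

(* Model of a smooth projective curve C over k through its function field    *)
(* K = k(C) (k embedded in K by iota) and its set of points P = C(k), each    *)
(* point p carrying its order-of-vanishing valuation v p : K -> int.          *)
(* (The value of v p at 0 is irrelevant and never used.)                      *)
Section CurveModel.
Variables (k K : fieldType) (iota : {rmorphism k -> K}) (P : choiceType)
          (v : P -> K -> int).

Definition klin_indep (N : nat) (y : 'I_N -> K) : Prop :=
  forall c : 'I_N -> k, \sum_(i < N) iota (c i) * y i = 0 -> forall i, c i = 0.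

Definition is_dvaluation (w : K -> int) : Prop :=
  [/\ (forall x y, x != 0 -> y != 0 -> w (x * y) = w x + w y),
      (forall x y, x != 0 -> y != 0 -> x + y != 0 ->
                   Num.min (w x) (w y) <= w (x + y)),
      (forall c, c != 0 -> w (iota c) = 0)
    & (exists x, x != 0 /\ w x = 1)].

Definition finsupp (a : P -> int) : Prop :=
  exists s : seq P, forall p, a p != 0 -> p \in s.

Definition fsum (a : P -> int) : int :=
  match excluded_middle_informative (finsupp a) with
  | left H => \sum_(p <- undup (proj1_sig (constructive_indefinite_description _ H))) a p
  | right _ => 0
  end.

Definition ktranscendental (t : K) : Prop :=
  forall p : {poly k}, (map_poly iota p).[t] = 0 -> p = 0.

Definition in_kt (t x : K) : Prop :=
  exists p q : {poly k}, q != 0 /\ x = (map_poly iota p).[t] / (map_poly iota q).[t].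

Definition function_field_one_var : Prop :=
  exists t, ktranscendental t /\
    exists b : seq K, forall x, exists r : 'I_(size b) -> K,
      (forall j, in_kt t (r j)) /\ x = \sum_(j < size b) r j * b`_j.

(* The points of C are exactly the places of K/k, with their valuations. *)
Record curve_model : Prop := CurveModel {
  cm_val : forall p, is_dvaluation (v p);
  cm_fin : forall x, x != 0 -> finsupp (fun p => v p x);
  cm_all : forall w, is_dvaluation w -> exists p, forall x, x != 0 -> w x = v p x;
  cm_inj : forall p q, (forall x, x != 0 -> v p x = v q x) -> p = q;
  cm_ff  : function_field_one_var }.

Definition deg_div (D : P -> int) : int := fsum D.

Definition in_LD (D : P -> int) (x : K) : Prop :=
  x = 0 \/ forall p, - D p <= v p x.

Definition ell_ge (D : P -> int) (N : nat) : Prop :=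
  exists y : 'I_N -> K, klin_indep y /\ forall i, in_LD D (y i).

(* g = max over divisors D of (deg D - ell(D) + 1) *)
Definition is_genus (g : nat) : Prop :=
  (forall D, finsupp D -> forall N : nat,
       N%:Z <= deg_div D + 1 - g%:Z -> ell_ge D N) /\
  (exists D, finsupp D /\ forall N : nat, ell_ge D N -> N%:Z <= deg_div D + 1 - g%:Z).

Definition S_unit (S : seq P) (f : K) : Prop :=
  f != 0 /\ forall p, p \notin S -> v p f = 0.

Definition hK (f : K) : int := fsum (fun p => Num.max 0 (- v p f)).

Definition Ngcd (S : seq P) (f g : K) : int :=
  fsum (fun p => if p \in S then 0
                 else Num.min (Num.max 0 (v p f)) (Num.max 0 (v p g))).

End CurveModel.

Section Polys.
Variables (k K : fieldType) (iota : {rmorphism k -> K}) (P : choiceType)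
          (v : P -> K -> int) (n : nat).

Definition hpoly (F : {mpoly K[n]}) : int :=
  fsum (fun p => - \big[Num.min/ v p (mleadc F)]_(m <- msupp F) v p F@_m).

Definition mcoprime (F1 F2 : {mpoly K[n]}) : Prop :=
  forall G H1 H2 : {mpoly K[n]}, F1 = G * H1 -> F2 = G * H2 -> (msize G <= 1)%N.

Definition coefs (F1 F2 : {mpoly K[n]}) : seq K :=
  [seq F1@_m | m <- msupp F1] ++ [seq F2@_m | m <- msupp F2].

Definition coef_prod (F1 F2 : {mpoly K[n]}) (s : nat)
    (f : {ffun 'I_s -> 'I_(size (coefs F1 F2))}) : K :=
  \prod_(i < s) (coefs F1 F2)`_(f i).

Definition inV (F1 F2 : {mpoly K[n]}) (s : nat) (x : K) : Prop :=
  exists (N : nat) (c : 'I_N -> k) (f : 'I_N -> {ffun 'I_s -> 'I_(size (coefs F1 F2))}),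
    x = \sum_(j < N) iota (c j) * coef_prod (f j).

(* d_s = dim_k V_{F1,F2}(s): the rank (maximal size of a k-linearly independent
   subfamily) of the spanning family of products *)
Definition dimV (F1 F2 : {mpoly K[n]}) (s : nat) : nat :=
  \max_(A : {set {ffun 'I_s -> 'I_(size (coefs F1 F2))}})
     (if excluded_middle_informative
           (klin_indep iota (fun i : 'I_#|A| => coef_prod (enum_val i)))
      then #|A| else 0)%N.

Definition gpow (g : 'I_n -> K) (i : 'X_{1..n}) : K := \prod_(j < n) g j ^+ i j.

Definition nondeg_over (F1 F2 : {mpoly K[n]}) (s : nat) (g : 'I_n -> K) (m : nat) : Prop :=
  forall a : 'X_{1..n < m.+1} -> K, (forall i, inV F1 F2 s (a i)) ->
    \sum_(i : 'X_{1..n < m.+1}) a i * gpow g i = 0 -> forall i, a i = 0.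

End Polys.

Definition Mcoef (n d m : nat) : nat := (2 * 'C(m + n - d, n) - 'C(m + n - 2 * d, n))%N.
Definition Mprime (n d m : nat) : int := ('C(m + n, n))%:Z - (Mcoef n d m)%:Z.

(* Main.v *)
(** The Wronskian of linearly independent f_1, ..., f_N in K, taken for a derivation D = d/dt,
    is a nonzero element w of K. Its order at p is at least the sum of the orders of any
    basis of the k-span of the f_i plus 'C(N, 2) h(p), where h(p) is -1 minus the order at p of
    the differential dt. As the degree of dt is at most 2 g - 2 and principal
    divisors have degree 0, lower bounds for the orders of well-chosen bases add up to a
    global inequality.

    The f_i are the products of a basis of V(M r) with M linearly independent polynomials of
    the form x^i F1 or x^i F2 of degree at most m, evaluated at g; coprimality of F1 and F2
    gives this Sylvester system rank at least M, and the nondegeneracy of the monomials g^i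
    makes the f_i independent. Outside S every f_i is divisible by the gcd of F1(g) and F2(g),
    and a basis with distinct orders gains 'C(N, 2). Inside S, choose M of the monomials such
    that the corresponding minor is nonzero and the sum of the orders of the g^i is least:
    multiplying by the adjugate of that minor replaces the M polynomials by combinations with
    coefficients in V(M - 1) whose orders are, up to the orders of the coefficients of F1 and
    F2, at least those of the chosen monomials. Multiplied by a
    basis of V(M (r - 1)), they provide part of a basis of the span, and the sum over S of
    the orders of all monomials is 0 since the g_i are S-units.

    The bound on the degree of dt comes from the definition of the genus: for a minimal system
    of generators w_i in L(m_i B) of K over k(t), B being the poles of t, L(r B) is
    described by polynomials of degree r - m_i, while L(r B + R), R being the ramification
    divisor, embeds by traces into polynomials of degree r + m_i. *)
Require Import Defs.
From HB Require Import structures.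
From mathcomp Require Import all_boot all_order all_algebra all_field.
From mathcomp Require Import perm mpoly.
From mathcomp Require Import zify ring.
From Stdlib Require Import ClassicalEpsilon FunctionalExtensionality.
Set Implicit Arguments. Unset Strict Implicit. Unset Printing Implicit Defensive.
Import Order.TTheory GRing.Theory Num.Theory.
Local Open Scope ring_scope.

(** The constants come from bookkeeping in the spaces V(s). The entries of the Sylvester system lie
    in V(1), so a relation between the M polynomials with coefficients in V(M r) is one between
    monomials over V(M r + 1). The adjugate has entries in V(M - 1), and V(M (r - 1)) V(M - 1) lies
    in V(M r) because 1 is a coefficient. Inside S, only M d_{M(r-1)} of the M d_{Mr} basis elements
    therefore receive the good bound; the others receive the crude one from the poles of the g_i,
    and dividing by d_{M(r-1)} turns this defect into the term (d_{Mr} / d_{M(r-1)} - 1) M. The M'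
    monomials outside the minor give the term M', and c' comes from 'C(N, 2) <= N^2 / 2 with N = M
    d_{Mr}.

    The obstacle is that the curve is known only through its valuations and its genus only through
    dimensions of the spaces L(D): there are no completions, differentials or canonical divisor to
    start from. Even local facts, such as the residue field being k or the ramification indices over
    a point having sum n = [K : k(t)], are drawn from linear algebra over k(t) and the two halves of
    the definition of the genus. *)

(** * Divisors and valuations *)

Section FiniteSums.
Variable P : choiceType.
Implicit Types (a b : P -> int) (T : seq P).

(** The list inside [fsum] is an arbitrary choice; both sums agree with the sum over the union of
    the two lists. *)
Lemma fsumE a T : uniq T -> (forall p, a p != 0 -> p \in T) ->
  fsum a = \sum_(p <- T) a p.
Proof.
move=> uT aT; rewrite /fsum; case: excluded_middle_informative; last first.
  by case; exists T.
move=> H; case: constructive_indefinite_description => s /= sP.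
have E (r : seq P) : uniq r -> (forall p, a p != 0 -> p \in r) ->
  \sum_(p <- r) a p = \sum_(p <- undup (s ++ T)) a p.
  move=> ur ar; rewrite [RHS](bigID (mem r)) /= [X in _ + X]big1 ?addr0; last first.
    by move=> p /negP pr; apply/eqP; apply/negPn/negP => /ar.
  rewrite -[RHS]big_filter [LHS](bigID (mem (s ++ T))) /= [X in _ + X]big1 ?addr0.
    rewrite -big_filter; apply: perm_big; apply: uniq_perm; rewrite ?filter_uniq ?undup_uniq //.
    by move=> p; rewrite !mem_filter mem_undup andbC.
  move=> p; rewrite mem_cat negb_or => /andP[ps _]; apply/eqP/negPn/negP => /sP.
  by rewrite (negPf ps).
rewrite (E T) // (E (undup s)) ?undup_uniq // => p /sP; by rewrite mem_undup.
Qed.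

Lemma finsuppD a b : finsupp a -> finsupp b -> finsupp (fun p => a p + b p).
Proof.
move=> [s sP] [r rP]; exists (s ++ r) => p; rewrite mem_cat.
have [/sP->//|/negPn/eqP->] := boolP (a p != 0); rewrite add0r => /rP ->; exact: orbT.
Qed.

Lemma finsuppM (c : int) a : finsupp a -> finsupp (fun p => c * a p).
Proof. by move=> [s sP]; exists s => p; rewrite mulf_eq0 negb_or => /andP[_ /sP]. Qed.

Lemma finsupp_le a b : finsupp a -> (forall p, a p = 0 -> b p = 0) -> finsupp b.
Proof.
move=> [s sP] h; exists s => p bp; apply: sP; apply: contraNneq bp => /h ->//.
Qed.

Lemma finsupp_common a b : finsupp a -> finsupp b -> exists T, [/\ uniq T,
  (forall p, a p != 0 -> p \in T) & (forall p, b p != 0 -> p \in T)].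
Proof.
move=> [s sP] [r rP]; exists (undup (s ++ r)); split; first exact: undup_uniq.
  by move=> p /sP ps; rewrite mem_undup mem_cat ps.
by move=> p /rP ps; rewrite mem_undup mem_cat ps orbT.
Qed.

Lemma fsumD a b : finsupp a -> finsupp b ->
  fsum (fun p => a p + b p) = fsum a + fsum b.
Proof.
move=> fa fb; have [T [uT aT bT]] := finsupp_common fa fb.
rewrite !(@fsumE _ T) // ?big_split // => p.
by have [/aT->//|/negPn/eqP->] := boolP (a p != 0); rewrite add0r => /bT.
Qed.

Lemma fsumM (c : int) a : finsupp a -> fsum (fun p => c * a p) = c * fsum a.
Proof.
move=> fa; have [T [uT aT _]] := finsupp_common fa fa.
rewrite !(@fsumE _ T) // ?mulr_sumr // => p.
by rewrite mulf_eq0 negb_or => /andP[_ /aT].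
Qed.

Lemma fsum_ge0 a : (forall p, 0 <= a p) -> 0 <= fsum a.
Proof.
move=> h; rewrite /fsum; case: excluded_middle_informative => // H.
by apply: sumr_ge0.
Qed.

Lemma fsum_le a b : finsupp a -> finsupp b -> (forall p, a p <= b p) -> fsum a <= fsum b.
Proof.
move=> fa fb h; have [T [uT aT bT]] := finsupp_common fa fb.
by rewrite !(@fsumE _ T) //; apply: ler_sum.
Qed.

End FiniteSums.

Section Valuations.
Variables (k K : fieldType) (iota : {rmorphism k -> K}) (P : choiceType)
          (v : P -> K -> int).
Hypothesis Hv : forall p, is_dvaluation iota (v p).
Implicit Types (p : P) (x y z : K) (a b : int) (c : k).

Lemma vM p x y : x != 0 -> y != 0 -> v p (x * y) = v p x + v p y.
Proof. by case: (Hv p) => h _ _ _; exact: h. Qed.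

Lemma vC p c : c != 0 -> v p (iota c) = 0.
Proof. by case: (Hv p) => _ _ h _; exact: h. Qed.

Lemma v1 p : v p 1 = 0.
Proof. by rewrite -(rmorph1 iota) vC ?oner_neq0. Qed.

Lemma vV p x : x != 0 -> v p x^-1 = - v p x.
Proof.
move=> x0; apply/eqP; rewrite -addr_eq0 -vM ?invr_eq0 // mulVf //; apply/eqP; exact: v1.
Qed.

Lemma vN p x : v p (- x) = v p x.
Proof.
have [->|x0] := eqVneq x 0; first by rewrite oppr0.
by rewrite -mulN1r vM ?oppr_eq0 ?oner_neq0 // -(rmorphN1 iota) vC ?add0r // oppr_eq0 oner_neq0.
Qed.

Lemma vX p x (m : nat) : x != 0 -> v p (x ^+ m) = m%:Z * v p x.
Proof.
move=> x0; elim: m => [|m IH]; first by rewrite expr0 v1 mul0r.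
by rewrite exprS vM ?expf_neq0 // IH -addn1 PoszD mulrDl mul1r addrC.
Qed.

Lemma vZ p x (m : int) : x != 0 -> v p (x ^ m) = m * v p x.
Proof.
move=> x0; case: m => m; first exact: vX.
by rewrite NegzE -exprnN vV ?expf_neq0 // vX // mulNr.
Qed.

(* [v p 0] is unspecified, so [vge p a x] says that x is 0 or vanishes to order at
   least a at p. *)
Definition vge p a x := (x == 0) || (a <= v p x).

Lemma vgeI p a x : a <= v p x -> vge p a x.
Proof. by rewrite /vge => ->; rewrite orbT. Qed.
Lemma vge0 p a : vge p a 0. Proof. by rewrite /vge eqxx. Qed.
Lemma vgeE p a x : x != 0 -> vge p a x = (a <= v p x).
Proof. by rewrite /vge => /negPf->. Qed.
Lemma vge_refl p x : vge p (v p x) x. Proof. by rewrite /vge lexx orbT. Qed.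
Lemma vge_le p a b x : b <= a -> vge p a x -> vge p b x.
Proof. by move=> ba /orP[/eqP->|h]; [exact: vge0|rewrite /vge (le_trans ba h) orbT]. Qed.
Lemma vge_w p a b x : vge p a x -> b <= a -> vge p b x.
Proof. by move=> h ba; exact: vge_le ba h. Qed.
Lemma vgeD p a x y : vge p a x -> vge p a y -> vge p a (x + y).
Proof.
have [->|x0] := eqVneq x 0; first by rewrite add0r.
have [->|y0] := eqVneq y 0; first by rewrite addr0.
rewrite [vge p a x]vgeE // [vge p a y]vgeE // => ax ay; rewrite /vge; case: eqVneq => //= xy.
case: (Hv p) => _ h _ _; apply: le_trans (h _ _ x0 y0 xy); by rewrite le_min ax.
Qed.
Lemma vgeN p a x : vge p a (- x) = vge p a x.
Proof. by rewrite /vge oppr_eq0 vN. Qed.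
Lemma vgeB p a x y : vge p a x -> vge p a y -> vge p a (x - y).
Proof. by move=> ax ay; apply: vgeD => //; rewrite vgeN. Qed.
Lemma vgeM p a b x y : vge p a x -> vge p b y -> vge p (a + b) (x * y).
Proof.
have [->|x0] := eqVneq x 0; first by rewrite mul0r !vge0.
have [->|y0] := eqVneq y 0; first by rewrite mulr0 !vge0.
by rewrite !vgeE ?mulf_neq0 // vM //; apply: lerD.
Qed.
Lemma vgeMl p a x y : x != 0 -> vge p (a - v p x) y -> vge p a (x * y).
Proof. by move=> x0 h; rewrite -(subrK (v p x) a) addrC; apply: vgeM => //; exact: vge_refl. Qed.
Lemma vgeC p c : vge p 0 (iota c).
Proof.
by have [->|c0] := eqVneq c 0; rewrite ?rmorph0 ?vge0 // /vge vC // lexx orbT.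
Qed.
Lemma vgeZ p a c x : vge p a x -> vge p a (iota c * x).
Proof. by move=> h; rewrite -[a]add0r; apply: vgeM => //; exact: vgeC. Qed.
Lemma vge_sum (I : Type) (r : seq I) (Q : pred I) (F : I -> K) p a :
  (forall i, Q i -> vge p a (F i)) -> vge p a (\sum_(i <- r | Q i) F i).
Proof. by move=> h; elim/big_ind: _ => //; [exact: vge0|move=> ? ?; exact: vgeD]. Qed.
Lemma vge_prod (I : Type) (r : seq I) (Q : pred I) (a : I -> int) (F : I -> K) p :
  (forall i, Q i -> vge p (a i) (F i)) ->
  vge p (\sum_(i <- r | Q i) a i) (\prod_(i <- r | Q i) F i).
Proof.
move=> h; elim/big_ind2: _ => //; first by rewrite /vge v1 lexx orbT.
by move=> ? ? ? ?; exact: vgeM.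
Qed.
Lemma v_prod (I : Type) (r : seq I) (Q : pred I) (F : I -> K) p :
  (forall i, Q i -> F i != 0) ->
  v p (\prod_(i <- r | Q i) F i) = \sum_(i <- r | Q i) v p (F i).
Proof.
move=> h; suff: (\prod_(i <- r | Q i) F i != 0) &&
  (v p (\prod_(i <- r | Q i) F i) == \sum_(i <- r | Q i) v p (F i)).
  by case/andP => _ /eqP.
elim/big_ind2: _ => //; first by rewrite oner_neq0 v1 eqxx.
  move=> x a y b /andP[x0 /eqP<-] /andP[y0 /eqP<-]; by rewrite mulf_neq0 // vM // eqxx.
by move=> i /h ->; rewrite eqxx.
Qed.

(** Strict ultrametric inequality: if x + y vanished to higher order than x, so would x = (x + y) -
    y. *)
Lemma vge_eq p a x y : x != 0 -> v p x < a -> vge p a y ->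
  (x + y != 0) /\ v p (x + y) = v p x.
Proof.
move=> x0 xa ya.
have [E|xy0] := eqVneq (x + y) 0.
  move: ya; have -> : y = - x by apply/eqP; rewrite -addr_eq0 addrC E.
  by rewrite vgeN vgeE // leNgt xa.
split=> //; apply/eqP; rewrite eq_le; apply/andP; split; last first.
  rewrite -vgeE //; apply: vgeD; first exact: vge_refl.
  by apply: vge_le ya; exact: ltW.
rewrite leNgt; apply/negP => lt.
have : vge p (Num.min (v p (x + y)) a) (x + y - y).
  apply: vgeB; first by apply: vge_le (vge_refl _ _); rewrite ge_min lexx.
  by apply: vge_le ya; rewrite ge_min lexx orbT.
rewrite addrK vgeE // ge_min !leNgt lt xa //.
Qed.

Lemma vge_inf p x : (forall a, vge p a x) -> x = 0.
Proof.
move=> h; apply/eqP; case/orP: (h (v p x + 1)) => //; lia.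
Qed.

End Valuations.

(** * Coordinates over a subfield *)

Section FieldBasis.
Variables (F K : fieldType) (phi : {rmorphism F -> K}).

(** Families in K are columns on which matrices over F act from the left, so that changes of basis
    become matrix products. *)
Definition lcomb m N (A : 'M[F]_(m, N)) (y : 'I_N -> K) : 'I_m -> K :=
  fun i => \sum_j phi (A i j) * y j.

Lemma lcombM m N q (A : 'M[F]_(m, N)) (B : 'M[F]_(N, q)) y :
  lcomb (A *m B) y =1 lcomb A (lcomb B y).
Proof.
move=> i; rewrite /lcomb; under eq_bigr do rewrite mxE rmorph_sum mulr_suml.
rewrite exchange_big; apply: eq_bigr => j _ /=; rewrite mulr_sumr.
by apply: eq_bigr => l _; rewrite rmorphM mulrA.
Qed.

Lemma lcomb_ext m N (A : 'M[F]_(m, N)) y z : y =1 z -> lcomb A y =1 lcomb A z.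
Proof. by move=> h i; apply: eq_bigr => j _; rewrite h. Qed.

Lemma klin_indepP N (y : 'I_N -> K) :
  klin_indep phi y <-> (forall c : 'rV[F]_N, lcomb c y 0 = 0 -> c = 0).
Proof.
split=> h c.
  by move=> /h hc; apply/rowP => i; rewrite hc mxE.
move=> c0 i; have -> : c i = (\row_j c j) 0 i by rewrite mxE.
rewrite (h (\row_j c j)) ?mxE //.
by rewrite -[RHS]c0; apply: eq_bigr => j _; rewrite mxE.
Qed.

Lemma klin_indep_ext N (y z : 'I_N -> K) : y =1 z ->
  klin_indep phi y -> klin_indep phi z.
Proof.
move=> h Hy c cz; apply: Hy; rewrite -[RHS]cz.
by apply: eq_bigr => j _; rewrite h.
Qed.

Lemma klin_lcomb m N (A : 'M[F]_(m, N)) y : row_free A ->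
  klin_indep phi y -> klin_indep phi (lcomb A y).
Proof.
move=> fA /klin_indepP Hy; apply/klin_indepP => c.
rewrite -lcombM => /Hy /eqP; rewrite mulmx_free_eq0 //; exact/eqP.
Qed.

(** A row vector killed by A is a relation between the y, so A has full row rank. *)
Lemma klin_bound N H (y : 'I_N -> K) (A : 'M[F]_(N, H)) (z : 'I_H -> K) :
  klin_indep phi y -> y =1 lcomb A z -> (N <= H)%N.
Proof.
move=> /klin_indepP Hy E.
suff /eqP <- : row_free A by exact: rank_leq_col.
apply/row_freeP; apply/row_freeP; rewrite -kermx_eq0; apply/eqP/row_matrixP => i.
rewrite row0; apply: Hy; rewrite (lcomb_ext _ E) -lcombM.
have -> : row i (kermx A) *m A = 0 by rewrite -row_mul mulmx_ker row0.
by apply: big1 => j _; rewrite mxE rmorph0 mul0r.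
Qed.

Lemma klin_inj N M (y : 'I_N -> K) (f : 'I_M -> 'I_N) : injective f ->
  klin_indep phi y -> klin_indep phi (y \o f).
Proof.
move=> fi Hy; apply: (@klin_indep_ext _ (lcomb (\matrix_(i, j) (j == f i)%:R) y)).
  move=> i; rewrite /lcomb (bigD1 (f i)) //= mxE eqxx rmorph1 mul1r big1 ?addr0 //.
  by move=> j /negPf ji; rewrite mxE ji rmorph0 mul0r.
apply: klin_lcomb => //; apply/row_freeP; exists (\matrix_(i, j) (i == f j)%:R).
apply/matrixP => i j; rewrite !mxE (bigD1 (f i)) //= !mxE eqxx mul1r big1 ?addr0.
  by rewrite (inj_eq fi).
by move=> l /negPf li; rewrite !mxE li mul0r.
Qed.

Lemma klin_neq0 N (y : 'I_N -> K) i : klin_indep phi y -> y i != 0.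
Proof.
move=> Hy; apply/eqP => y0.
have /(_ i) : forall j, (j == i)%:R = 0 :> F.
  apply: Hy; apply: big1 => j _; case: eqP => [->|_]; first by rewrite y0 mulr0.
  by rewrite rmorph0 mul0r.
by rewrite eqxx => /eqP; rewrite oner_eq0.
Qed.

(** K carries no structure of vector space over F; a basis together with its coordinate function
    stands for it, and n for the degree [K : F]. *)
Definition coords n (e : 'I_n -> K) (co : K -> 'rV[F]_n) : Prop :=
  klin_indep phi e /\ forall x, x = \sum_i phi (co x 0 i) * e i.

Lemma coords_exist N (b : 'I_N -> K) :
  (forall x, exists r : 'I_N -> F, x = \sum_i phi (r i) * b i) ->
  exists n (e : 'I_n -> K) co, coords e co.
Proof.
elim: N b => [|N IH] b span.
  exists 0%N, b, (fun _ => 0); split; first by move=> c _ [].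
  by move=> x; have [r] := span x; rewrite !big_ord0.
have [Hb|/not_all_ex_not[c Hc]] := classic (klin_indep phi b).
  exists N.+1, b, (fun x => \row_i (proj1_sig (constructive_indefinite_description _ (span x))) i).
  split=> // x; case: constructive_indefinite_description => r /= {1}->.
  by apply: eq_bigr => i _; rewrite mxE.
have [c0 {Hc}] := imply_to_and _ _ Hc; move=> /not_all_ex_not[i /eqP ci].
apply: (IH (b \o lift i)) => x; have [r ->] := span x.
exists (fun j => r (lift i j) - r i * c (lift i j) / c i).
have E : b i = - \sum_(j < N) phi (c (lift i j) / c i) * b (lift i j).
  apply/eqP; rewrite -addr_eq0; apply/eqP.
  have : phi (c i) != 0 by rewrite fmorph_eq0.
  move/mulfI; apply; rewrite mulr0 -[RHS]c0 [RHS](bigD1_ord i) //= mulrDr; congr (_ + _).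
  rewrite mulr_sumr; apply: eq_bigr => j _; rewrite mulrA -rmorphM; congr (phi _ * _).
  by rewrite mulrC divfK.
rewrite (bigD1_ord i) //= E mulrN mulr_sumr addrC -sumrB; apply: eq_bigr => j _ /=.
by rewrite rmorphB mulrBl mulrA -rmorphM mulrA.
Qed.

Section Coordinates.
Variables (n : nat) (e : 'I_n -> K) (co : K -> 'rV[F]_n).
Hypothesis Hco : coords e co.

Lemma coE x : lcomb (co x) e 0 = x.
Proof. by rewrite {2}(Hco.2 x). Qed.

Lemma co_uniq (c : 'rV[F]_n) : co (lcomb c e 0) = c.
Proof.
apply/eqP; rewrite -subr_eq0; apply/eqP; move/klin_indepP: (Hco.1); apply.
have -> : lcomb (co (lcomb c e 0) - c) e 0 =
    lcomb (co (lcomb c e 0)) e 0 - lcomb c e 0.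
  rewrite -sumrB; apply: eq_bigr => i _; by rewrite !mxE rmorphB mulrBl.
by rewrite coE subrr.
Qed.

Lemma coD x y : co (x + y) = co x + co y.
Proof.
rewrite -[RHS]co_uniq; congr (co _); rewrite -[in LHS](coE x) -[in LHS](coE y).
by rewrite -big_split; apply: eq_bigr => i _; rewrite !mxE rmorphD mulrDl.
Qed.

Lemma coZ a x : co (phi a * x) = a *: co x.
Proof.
rewrite -[RHS]co_uniq; congr (co _); rewrite -[in LHS](coE x) mulr_sumr.
by apply: eq_bigr => i _; rewrite !mxE rmorphM mulrA.
Qed.

Lemma co0 : co 0 = 0.
Proof. by rewrite -(mul0r 0) -{1}(rmorph0 phi) coZ scale0r. Qed.

Lemma co_sum (I : Type) (r : seq I) Q (f : I -> K) :
  co (\sum_(i <- r | Q i) f i) = \sum_(i <- r | Q i) co (f i).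
Proof. exact: (big_morph co coD co0). Qed.

Definition comx m (y : 'I_m -> K) : 'M[F]_(m, n) := \matrix_i co (y i).

Lemma comxE m (y : 'I_m -> K) : lcomb (comx y) e =1 y.
Proof.
move=> i; rewrite -[RHS]coE; apply: eq_bigr => j _; by rewrite mxE.
Qed.

Lemma comx_lcomb q m (A : 'M_(q, m)) y : comx (lcomb A y) = A *m comx y.
Proof.
apply/row_matrixP => i; rewrite rowK row_mul mulmx_sum_row co_sum.
by apply: eq_bigr => j _; rewrite coZ rowK mxE.
Qed.

Lemma klin_comx m (y : 'I_m -> K) : klin_indep phi y -> row_free (comx y).
Proof.
move=> /klin_indepP Hy; rewrite -kermx_eq0; apply/eqP/row_matrixP => i.
rewrite row0; apply: Hy.
rewrite -(lcomb_ext _ (comxE y)) -lcombM -row_mul mulmx_ker row0.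
by apply: big1 => j _; rewrite mxE rmorph0 mul0r.
Qed.

Lemma klin_le m (y : 'I_m -> K) : klin_indep phi y -> (m <= n)%N.
Proof. by move=> /klin_comx /eqP <-; exact: rank_leq_col. Qed.

Lemma klin_unit (y : 'I_n -> K) : klin_indep phi y -> comx y \in unitmx.
Proof. by move=> /klin_comx; rewrite row_free_unit. Qed.

Lemma klin_coords (y : 'I_n -> K) : klin_indep phi y ->
  coords y (fun x => co x *m invmx (comx y)).
Proof.
move=> Hy; split=> // x; have uy := klin_unit Hy.
rewrite -[LHS]coE -[co x in LHS](mulmxKV uy) lcombM.
by rewrite (lcomb_ext _ (comxE y)).
Qed.

(** The trace of K over F, as the trace of multiplication by z. *)
Definition trF (z : K) : F := \tr (comx (fun i => z * e i)).

Lemma trFD x y : trF (x + y) = trF x + trF y.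
Proof.
rewrite /trF -mxtraceD; congr (\tr _); apply/row_matrixP => i.
by rewrite !(rowK, raddfD) /= mulrDl coD !rowK.
Qed.

Lemma trFZ a x : trF (phi a * x) = a * trF x.
Proof.
rewrite /trF -mxtraceZ; congr (\tr _); apply/matrixP => i j.
by rewrite !mxE -mulrA coZ mxE.
Qed.

Lemma trF_sum (I : Type) (r : seq I) Q (f : I -> K) :
  trF (\sum_(i <- r | Q i) f i) = \sum_(i <- r | Q i) trF (f i).
Proof.
apply: (big_morph trF trFD); apply: (addrI (trF 0)); by rewrite -trFD !addr0.
Qed.

Lemma trF1 : trF 1 = n%:R.
Proof.
rewrite /trF -(mxtrace1 F n); congr (\tr _); apply/row_matrixP => i.
rewrite rowK mul1r -[LHS]co_uniq coE; apply: (etrans _ (co_uniq _)); congr (co _).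
rewrite /lcomb (bigD1 i) //= !mxE eqxx rmorph1 mul1r big1 ?addr0 // => j ji.
by rewrite !mxE eq_sym (negPf ji) rmorph0 mul0r.
Qed.

(** The matrices of multiplication by z in the two bases are conjugate under [comx y]. *)
Lemma trF_basis (y : 'I_n -> K) (A : 'M_n) z : klin_indep phi y ->
  (forall i, z * y i = lcomb A y i) -> trF z = \tr A.
Proof.
move=> Hy E; have uy := klin_unit Hy.
have: comx (fun i => z * y i) = A *m comx y by rewrite -comx_lcomb; apply/row_matrixP => i;
  rewrite !rowK E.
have -> : comx (fun i => z * y i) = comx y *m comx (fun i => z * e i).
  rewrite -comx_lcomb; apply/row_matrixP => i; rewrite !rowK; congr (co _).
  by rewrite -{1}(comxE y i) mulr_sumr; apply: eq_bigr => j _; rewrite mulrCA.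
move=> h; rewrite /trF -[comx (fun i => z * e i)](mulKmx uy) h mxtrace_mulC mulmxK //.
Qed.

End Coordinates.
End FieldBasis.

(** * The rational subfield k(t) and residues *)

Section RationalSubfield.
Variables (k K : fieldType) (iota : {rmorphism k -> K}).
Implicit Types (t : K) (p q : {poly k}).

Definition ev t p : K := (map_poly iota p).[t].

Lemma evD t p q : ev t (p + q) = ev t p + ev t q.
Proof. by rewrite /ev rmorphD hornerD. Qed.
Lemma evN t p : ev t (- p) = - ev t p.
Proof. by rewrite /ev rmorphN hornerN. Qed.
Lemma evB t p q : ev t (p - q) = ev t p - ev t q.
Proof. by rewrite evD evN. Qed.
Lemma evM t p q : ev t (p * q) = ev t p * ev t q.
Proof. by rewrite /ev rmorphM hornerM. Qed.
Lemma evC t c : ev t c%:P = iota c.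
Proof. by rewrite /ev map_polyC hornerC. Qed.
Lemma evX t : ev t 'X = t.
Proof. by rewrite /ev map_polyX hornerX. Qed.
Lemma evXn t p m : ev t (p ^+ m) = ev t p ^+ m.
Proof. by rewrite /ev rmorphXn horner_exp. Qed.
Lemma ev0 t : ev t 0 = 0. Proof. by rewrite /ev rmorph0 horner0. Qed.
Lemma ev1 t : ev t 1 = 1. Proof. by rewrite -polyC1 evC rmorph1. Qed.
Lemma evZ t c p : ev t (c *: p) = iota c * ev t p.
Proof. by rewrite -mul_polyC evM evC. Qed.
Lemma ev_coef t p : ev t p = \sum_(i < size p) iota p`_i * t ^+ i.
Proof.
rewrite /ev horner_coef size_map_poly; apply: eq_bigr => i _; by rewrite coef_map.
Qed.
Lemma ev_wide t p m : (size p <= m)%N -> ev t p = \sum_(i < m) iota p`_i * t ^+ i.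
Proof.
move=> h; rewrite ev_coef (big_ord_widen _ (fun i => iota p`_i * t ^+ i) h) big_mkcond.
apply: eq_bigr => i _; case: ifPn => //; rewrite -leqNgt => h'.
by rewrite nth_default ?rmorph0 ?mul0r.
Qed.
Lemma ev_prod t (I : Type) (r : seq I) Q (f : I -> {poly k}) :
  ev t (\prod_(i <- r | Q i) f i) = \prod_(i <- r | Q i) ev t (f i).
Proof. exact: (big_morph (ev t) (evM t) (ev1 t)). Qed.

(** Membership in k(t), decided classically so that k(t) can be made a subfield type. Requiring only
    that the denominator not vanish at t gives a field without assuming t transcendental. *)
Definition in_rat t : {pred K} := fun x =>
  if excluded_middle_informative (exists p q, ev t q != 0 /\ x = ev t p / ev t q)
  then true else false.

Lemma in_ratP t x : reflect (exists p q, ev t q != 0 /\ x = ev t p / ev t q) (x \in in_rat t).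
Proof. by rewrite unfold_in; case: excluded_middle_informative => h; constructor. Qed.

Lemma in_rat_divring t : divring_closed (in_rat t).
Proof.
split.
- by apply/in_ratP; exists 1, 1; rewrite ev1 oner_neq0 divr1.
- move=> x y /in_ratP[p [q [q0 ->]]] /in_ratP[p' [q' [q'0 ->]]].
  apply/in_ratP; exists (p * q' - p' * q), (q * q').
  by rewrite evB !evM mulf_neq0 // -mulNr addf_div // mulNr.
- move=> x y /in_ratP[p [q [q0 ->]]] /in_ratP[p' [q' [q'0 ->]]].
  have [->|p'0] := eqVneq (ev t p') 0.
    by rewrite mul0r invr0 mulr0; apply/in_ratP; exists 0, 1; rewrite ev0 ev1 oner_neq0 mul0r.
  apply/in_ratP; exists (p * q'), (q * p'); rewrite !evM mulf_neq0 //; split=> //.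
  by rewrite invf_div mulf_div.
Qed.

HB.instance Definition _ t := GRing.isDivringClosed.Build K (in_rat t) (in_rat_divring t).

Record ktfield t := Kt { ktval :> K; _ : ktval \in in_rat t }.
HB.instance Definition _ t := [isSub for @ktval t].
HB.instance Definition _ t := [Choice of ktfield t by <:].
HB.instance Definition _ t := [SubChoice_isSubIntegralDomain of ktfield t by <:].
HB.instance Definition _ t := [SubIntegralDomain_isSubField of ktfield t by <:].

Definition ktinc t : {rmorphism ktfield t -> K} := val.

Lemma ktincP t x : x \in in_rat t -> exists c : ktfield t, ktinc t c = x.
Proof. by move=> h; exists (Kt h). Qed.
Lemma ktinc_rat t (c : ktfield t) : ktinc t c \in in_rat t.
Proof. exact: (valP c). Qed.

Lemma ev_rat t p : ev t p \in in_rat t.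
Proof. by apply/in_ratP; exists p, 1; rewrite ev1 oner_neq0 divr1. Qed.

Lemma in_rat_trans t s x : t \in in_rat s -> x \in in_rat t -> x \in in_rat s.
Proof.
move=> ts /in_ratP[p [q [_ ->]]].
suff h r : ev t r \in in_rat s by exact: rpred_div.
rewrite ev_coef; apply: rpred_sum => i _; apply: rpredM; last exact: rpredX.
by rewrite -(evC s); exact: ev_rat.
Qed.

End RationalSubfield.

Section Residue.
Variables (k : closedFieldType) (K : fieldType) (iota : {rmorphism k -> K}).
Variables (P : choiceType) (v : P -> K -> int).
Hypothesis Hv : forall p, is_dvaluation iota (v p).

Notation ev := (ev iota). Notation in_rat := (in_rat iota). Notation vge := (vge v).

Lemma ev_factor (q : {poly k}) x :
  exists r : seq k, ev x q = iota (lead_coef q) * \prod_(c <- r) (x - iota c).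
Proof.
have [r {1}->] := closed_field_poly_normal q; exists r.
rewrite evZ ev_prod; congr (_ * _); apply: eq_bigr => c _; by rewrite evB evX evC.
Qed.

(** Over an algebraically closed field a polynomial splits, so its roots in K all lie in k. *)
Lemma transP x : (forall c, x != iota c) -> ktranscendental iota x.
Proof.
move=> h q; rewrite -/(ev x q); have [r ->] := ev_factor q x.
move/eqP; rewrite mulf_eq0 fmorph_eq0 lead_coef_eq0 => /orP[/eqP->//|].
by rewrite prodf_seq_eq0 => /hasP[c _]; rewrite /= subr_eq0 (negPf (h c)).
Qed.

Lemma trans_neq x c : ktranscendental iota x -> x != iota c.
Proof.
move=> h; apply/eqP => E; have := h ('X - c%:P).
rewrite -/(ev _ _) evB evX evC E subrr => /(_ erefl) /eqP.
by rewrite polyXsubC_eq0.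
Qed.

Lemma trans_neq0 x : ktranscendental iota x -> x != 0.
Proof. by move/(@trans_neq x 0); rewrite rmorph0. Qed.

Lemma ev_neq0 x q : ktranscendental iota x -> q != 0 -> ev x q != 0.
Proof. by move=> h; apply: contra_neq => /h. Qed.

Lemma trans_subC t c : ktranscendental iota t -> ktranscendental iota (t - iota c).
Proof. by move=> h; apply: transP => d; rewrite subr_eq -rmorphD; exact: trans_neq. Qed.

Lemma trans_inv t : ktranscendental iota t -> ktranscendental iota t^-1.
Proof.
by move=> h; apply: transP => d; rewrite (can2_eq (@invrK _) (@invrK _)) -fmorphV; exact: trans_neq.
Qed.

Lemma subC_rat t c : t \in in_rat (t - iota c).
Proof.
have h1 := ev_rat iota (t - iota c) 'X; have h2 := ev_rat iota (t - iota c) c%:P.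
by rewrite evX in h1; rewrite evC in h2; have := rpredD h1 h2; rewrite subrK.
Qed.

Lemma inv_rat t : t \in in_rat t^-1.
Proof. by have := ev_rat iota t^-1 'X; rewrite evX -rpredV invrK. Qed.

Lemma vge_ev p x q : vge p 0 x -> vge p 0 (ev x q).
Proof.
move=> h; rewrite ev_coef; apply: (vge_sum Hv) => i _; apply: (vgeZ Hv).
elim: (i : nat) => [|j IH]; first by rewrite expr0 -(rmorph1 iota); exact: (vgeC Hv).
by rewrite exprS -[0]addr0; apply: (vgeM Hv).
Qed.

Lemma ev_at0 p s q : 0 < v p s -> vge p (v p s) (ev s q - iota q.[0]).
Proof.
move=> s0; have /factor_theorem[q1 E] : root (q - q.[0]%:P) 0.
  by rewrite rootE !hornerE subrr.
rewrite -(evC iota s) -evB E evM subr0 evX -[v p s]add0r; apply: (vgeM Hv); last exact: vge_refl.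
by apply: vge_ev; apply: vgeI; exact: ltW.
Qed.

Lemma v_ev0 p s q : 0 < v p s -> q.[0] != 0 -> ev s q != 0 /\ v p (ev s q) = 0.
Proof.
move=> s0 q0; rewrite -(subrK (iota q.[0]) (ev s q)) addrC.
have i0 : iota q.[0] != 0 by rewrite fmorph_eq0.
have [|h1 h2] := vge_eq Hv i0 _ (ev_at0 q s0); first by rewrite (vC Hv).
by rewrite h1 h2 (vC Hv).
Qed.

Lemma poly_ord0 (q : {poly k}) : q != 0 -> exists q0 a, q = q0 * 'X^a /\ q0.[0] != 0.
Proof.
move=> q0; have [a [r]] := multiplicity_XsubC q 0; rewrite q0 /= subr0 => r0 E.
by exists r, a.
Qed.

Lemma rat_local s c : c \in in_rat s -> ktranscendental iota s -> c != 0 ->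
  exists (a : int) (A B : {poly k}), [/\ A.[0] != 0, B.[0] != 0 & c = s ^ a * (ev s A / ev s B)].
Proof.
move=> /in_ratP[p [q [q0 ->]]] Hs c0.
have p0 : p != 0 by apply: contraNneq c0 => ->; rewrite ev0 mul0r.
have q0' : q != 0 by apply: contraNneq q0 => ->; rewrite ev0.
have [A [a [-> hA]]] := poly_ord0 p0; have [B [b [-> hB]]] := poly_ord0 q0'.
exists (a%:Z - b%:Z), A, B; split=> //; have s0 := trans_neq0 Hs.
rewrite !evM !evXn evX expfzDr // -exprz_inv -!exprnP exprVn invfM; ring.
Qed.

(** After division by the lowest power of s that occurs, the functions are regular at s = 0, and the
    [al i] are their values there, not all zero. The same a and [al] serve all the zeros of s at
    once. *)
Lemma rat_reduce s N (c : 'I_N -> K) : ktranscendental iota s ->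
  (forall i, c i \in in_rat s) -> (exists i, c i != 0) ->
  exists (a : int) (al : 'I_N -> k), (exists i, al i != 0) /\
    forall p, 0 < v p s -> forall i, vge p (v p s) (c i * s ^ (- a) - iota (al i)).
Proof.
move=> Hs cs [i0 ci0]; have s0 := trans_neq0 Hs.
have : forall i, exists (a : int) (A B : {poly k}), c i != 0 ->
    [/\ A.[0] != 0, B.[0] != 0 & c i = s ^ a * (ev s A / ev s B)].
  move=> i; have [->|ci] := eqVneq (c i) 0; first by exists 0, 0, 0.
  by have [a [A [B h]]] := rat_local (cs i) Hs ci; exists a, A, B.
move=> /(@choice _ _)[a] /(@choice _ _)[A] /(@choice _ _)[B] h.
pose j := [arg min_(j < i0 | c j != 0) a j]%O.
have [cj jmin] : c j != 0 /\ forall i, c i != 0 -> a j <= a i.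
  by rewrite /j; case: arg_minP => // j' cj h'; split=> // i /h'.
exists (a j), (fun i => if (c i != 0) && (a i == a j) then (A i).[0] / (B i).[0] else 0).
split.
  by exists j; rewrite cj eqxx /=; have [? ? _] := h _ cj; rewrite mulf_neq0 ?invr_eq0.
move=> p sp i; have [->|ci] /= := eqVneq (c i) 0.
  by rewrite mul0r rmorph0 subr0 vge0.
have [A0 B0 ->] := h _ ci; have [eB vB] := v_ev0 sp B0; have [eA vA] := v_ev0 sp A0.
rewrite mulrAC -expfzDr //; case: eqVneq => [->|ne].
  rewrite subrr expr0z mul1r rmorphM fmorphV.
  have iB : iota (B i).[0] != 0 by rewrite fmorph_eq0.
  have -> : ev s (A i) / ev s (B i) - iota (A i).[0] / iota (B i).[0] =
    (ev s (A i) - iota (A i).[0]) * (ev s (B i))^-1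
    + (- iota (A i).[0] / iota (B i).[0] / ev s (B i)) * (ev s (B i) - iota (B i).[0]).
    by field; rewrite eB iB.
  have vB' : vge p 0 (ev s (B i))^-1 by rewrite vgeE ?invr_eq0 // (vV Hv) // vB.
  apply: (vgeD Hv).
    by rewrite -[v p s]addr0; apply: (vgeM Hv) => //; exact: ev_at0.
  rewrite -[v p s]add0r; apply: (vgeM Hv) => //; last exact: ev_at0.
  by rewrite -fmorphV -rmorphN -rmorphM; apply: (vgeZ Hv).
rewrite rmorph0 subr0 vgeE ?mulf_neq0 ?invr_eq0 ?expfz_neq0 //.
rewrite (vM Hv) ?mulf_neq0 ?invr_eq0 ?expfz_neq0 // (vM Hv) ?invr_eq0 // (vV Hv) // vA vB subrr
  addr0.
rewrite (vZ Hv) // -[leLHS]mul1r ler_pM2r // -gtz0_ge1 subr_gt0 lt_neqAle jmin // andbT.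
by rewrite eq_sym.
Qed.

Lemma poly_root_near p y (q : {poly k}) : q != 0 -> vge p 0 y -> vge p 1 (ev y q) ->
  exists c, vge p 1 (y - iota c).
Proof.
move=> q0 y0; have [r ->] := ev_factor q y.
have l0 : iota (lead_coef q) != 0 by rewrite fmorph_eq0 lead_coef_eq0.
elim: r => [|c r IH] h.
  by move: h; rewrite big_nil mulr1 vgeE // (vC Hv) // lead_coef_eq0.
have [|nc] := boolP (vge p 1 (y - iota c)); first by exists c.
apply: IH; have yc0 : y - iota c != 0 by apply: contraNneq nc => ->; rewrite vge0.
have vc : v p (y - iota c) = 0.
  apply/eqP; rewrite eq_le; apply/andP; split.
    by move: nc; rewrite vgeE // -ltNge; lia.
  by rewrite -vgeE //; apply: (vgeB Hv) => //; exact: (vgeC Hv).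
have [->|n0] := eqVneq (iota (lead_coef q) * \prod_(j <- r) (y - iota j)) 0; first exact: vge0.
by move: h; rewrite big_cons mulrCA vgeE ?(mulf_neq0 yc0 n0) // (vM Hv) // vc add0r vgeE.
Qed.

Lemma vsum_distinct p N (f : 'I_N -> K) (a : int) (i0 : 'I_N) :
  f i0 != 0 -> v p (f i0) < a -> (forall i, i != i0 -> vge p a (f i)) ->
  \sum_i f i != 0 /\ v p (\sum_i f i) = v p (f i0).
Proof.
move=> f0 lt h; rewrite (bigD1 i0) //=; apply: (vge_eq Hv f0 lt).
exact: (vge_sum Hv).
Qed.

Section FiniteExtension.
Variable t : K.
Hypothesis Ht : ktranscendental iota t.
Variables (n : nat) (e : 'I_n -> K) (co : K -> 'rV[ktfield iota t]_n).
Hypothesis Hco : coords (ktinc iota t) e co.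

Lemma power_relation y : exists c : 'I_n.+1 -> K,
  [/\ forall i, c i \in in_rat t, exists i, c i != 0 & \sum_i c i * y ^+ i = 0].
Proof.
have /not_all_ex_not[c] : ~ klin_indep (ktinc iota t) (fun i : 'I_n.+1 => y ^+ i).
  by move=> /(klin_le Hco); rewrite ltnn.
move=> H; have [c0 /not_all_ex_not[i /eqP ci]] := imply_to_and _ _ H.
exists (fun i => ktinc iota t (c i)); split=> //; first by move=> j; exact: ktinc_rat.
by exists i; rewrite fmorph_eq0.
Qed.

(** Another generator of k(t) over k. Those in use are t - c and 1 / t, whose zeros are the places
    above one point of the projective line. *)
Definition local_par (s : K) := [/\ ktranscendental iota s, t \in in_rat s & s \in in_rat t].

(** If t is regular at p and no t - c vanishes there, every nonzero element of k(t) has order 0 at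
    p. An element y of order 1 satisfies a relation over k(t) between 1, y, ..., y^n; its nonzero
    terms would have distinct orders and could not cancel. *)
Lemma local_par_ex p : exists s, [/\ local_par s, 0 < v p s &
  (exists c, s = t - iota c) \/ (s = t^-1 /\ v p t < 0)].
Proof.
have t0 := trans_neq0 Ht.
have [tneg|tpos] := ltrP (v p t) 0.
  exists t^-1; split; [|by rewrite (vV Hv) // oppr_gt0|by right].
  split; [exact: trans_inv|exact: inv_rat|].
  by have := ev_rat iota t 'X; rewrite evX rpredV.
suff [c hc] : exists c, 0 < v p (t - iota c).
  exists (t - iota c); split=> //; last by left; exists c.
  split; [exact: trans_subC|exact: subC_rat|].
  by have := ev_rat iota t ('X - c%:P); rewrite evB evX evC.
apply: NNPP => /not_ex_all_not h.
have vt c : v p (t - iota c) = 0.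
  apply/eqP; rewrite eq_le; have /negP := h c; rewrite -leNgt => -> /=.
  rewrite -vgeE ?subr_eq0 ?trans_neq //; apply: (vgeB Hv); last exact: (vgeC Hv).
  by rewrite vgeE.
have vev q : q != 0 -> v p (ev t q) = 0.
  move=> q0; have [r ->] := ev_factor q t.
  have l0 : iota (lead_coef q) != 0 by rewrite fmorph_eq0 lead_coef_eq0.
  rewrite (vM Hv) //; last first.
    by rewrite prodf_seq_neq0; apply/allP => c _ /=; rewrite subr_eq0 trans_neq.
  rewrite (vC Hv) ?lead_coef_eq0 // (v_prod Hv) ?big1 ?addr0 // => c _.
  by rewrite subr_eq0 trans_neq.
have vF c : c \in in_rat t -> c != 0 -> v p c = 0.
  move=> /in_ratP[a [b [b0 ->]]] c0.
  have a0 : a != 0 by apply: contraNneq c0 => ->; rewrite ev0 mul0r.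
  have b0' : b != 0 by apply: contraNneq b0 => ->; rewrite ev0.
  by rewrite (vM Hv) ?invr_eq0 ?ev_neq0 // (vV Hv) // !vev.
case: (Hv p) => _ _ _ [y [y0 vy]].
have [c [cF [i1 ci1] c0]] := power_relation y.
pose i0 := [arg min_(i < i1 | c i != 0%R) (i : nat)]%N.
have [ci imin] : c i0 != 0 /\ forall i, c i != 0 -> (i0 <= i)%N.
  by rewrite /i0; case: arg_minnP.
have [] := @vsum_distinct p _ (fun i => c i * y ^+ i) (i0%:Z + 1) i0.
- by rewrite mulf_neq0 ?expf_neq0.
- by rewrite (vM Hv) ?expf_neq0 // vF // (vX Hv) // vy; lia.
- move=> i ii0; have [->|cin] := eqVneq (c i) 0; first by rewrite mul0r vge0.
  rewrite vgeE ?mulf_neq0 ?expf_neq0 // (vM Hv) ?expf_neq0 // vF // (vX Hv) // vy.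
  have := imin _ cin; rewrite leq_eqVlt => /orP[/eqP E|]; last by lia.
  by case/eqP: ii0; apply: val_inj.
by rewrite c0 eqxx.
Qed.

(** The residue field at p is k. A relation between the powers of y over k(t), reduced modulo a
    local parameter, is a nonzero polynomial over k whose value at y vanishes at p; [poly_root_near]
    then yields the residue. *)
Lemma residue p y : vge p 0 y -> exists c, vge p 1 (y - iota c).
Proof.
move=> y0; have [s [[Hs ts _] sp _]] := local_par_ex p.
have [c [cF ci c0]] := power_relation y.
have cs i : c i \in in_rat s by exact: in_rat_trans ts (cF i).
have [a [al [[i ali] h]]] := rat_reduce Hs cs ci.
pose q := \poly_(i < n.+1) al (inord i).
have q0 : q != 0.
  apply: contraNneq ali => /(congr1 (fun q : {poly k} => q`_i)).
  by rewrite coef_poly ltn_ord coef0 inord_val => ->.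
apply: (poly_root_near q0 y0).
have -> : ev y q = \sum_i (iota (al i) - c i * s ^ (- a)) * y ^+ i.
  under [RHS]eq_bigr do rewrite mulrBl mulrAC.
  rewrite sumrB -mulr_suml c0 mul0r subr0 (@ev_wide _ _ _ _ _ n.+1) ?size_poly //.
  by apply: eq_bigr => j _; rewrite coef_poly ltn_ord inord_val.
apply: (vge_sum Hv) => j _; rewrite -[1]addr0; apply: (vgeM Hv).
  rewrite -opprB (vgeN Hv); apply: vge_le (h p sp j); lia.
elim: (j : nat) => [|l IH]; first by apply: vgeI; rewrite expr0 (v1 Hv).
by rewrite exprS -[0]addr0; apply: (vgeM Hv).
Qed.

End FiniteExtension.
End Residue.

(** * Riemann-Roch spaces and approximation *)

Section Divisors.
Variables (k K : fieldType) (iota : {rmorphism k -> K}).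
Variables (P : choiceType) (v : P -> K -> int) (genus : nat).
Hypothesis Hv : forall p, is_dvaluation iota (v p).
Hypothesis Hfin : forall x, x != 0 -> finsupp (fun p => v p x).
Hypothesis Hinj : forall p q, (forall x, x != 0 -> v p x = v q x) -> p = q.
Hypothesis Hg : is_genus iota v genus.
Implicit Types (D : P -> int).

Notation vge := (vge v).

Lemma in_LDP D x : in_LD v D x <-> forall p, vge p (- D p) x.
Proof.
split=> [[->|h] p|h]; first exact: vge0.
  by apply: vgeI; exact: h.
have [->|x0] := eqVneq x 0; first by left.
by right=> p; rewrite -vgeE.
Qed.

Lemma LD_vge D x p : in_LD v D x -> vge p (- D p) x.
Proof. by move/in_LDP. Qed.

Lemma ell_ge_le D N M : (M <= N)%N -> ell_ge iota v D N -> ell_ge iota v D M.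
Proof.
move=> MN [y [Hy yD]]; exists (y \o widen_ord MN); split; last by move=> i; exact: yD.
by apply: klin_inj => // i j /(congr1 val) /= ij; apply: val_inj.
Qed.

Lemma ell_ge_mono D D' N : (forall p, D p <= D' p) ->
  ell_ge iota v D N -> ell_ge iota v D' N.
Proof.
move=> DD [y [Hy yD]]; exists y; split=> // i; apply/in_LDP => p.
by refine (vge_w (LD_vge p (yD i)) _); rewrite lerN2.
Qed.

Lemma ell_ge_mul x D D' N : x != 0 -> (forall p, D' p = D p - v p x) ->
  ell_ge iota v D N -> ell_ge iota v D' N.
Proof.
move=> x0 DD [y [Hy yD]]; exists (fun i => x * y i); split.
  move=> c h; apply: Hy; apply: (mulfI x0); rewrite mulr0 -[RHS]h mulr_sumr.
  by apply: eq_bigr => i _; rewrite mulrCA.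
move=> i; apply/in_LDP => p; apply: (vgeMl Hv) => //.
by refine (vge_w (LD_vge p (yD i)) _); rewrite DD opprB addrC addKr.
Qed.

(* Multiplication by [x ^+ m] identifies the spaces L(D0 + m (x)) and L(D0); if (x) had
   positive degree, the lower bound of Riemann on the former would exceed the upper
   bound on the latter for large m. *)
Lemma principal_le0 x : x != 0 -> fsum (fun p => v p x) <= 0.
Proof.
move=> x0; rewrite leNgt; apply/negP => pos.
have [lo [D0 [fD0 up]]] := Hg.
pose m := (absz (deg_div D0) + genus).+1%N.
pose D := fun p => D0 p + v p (x ^+ m).
have xm0 : x ^+ m != 0 by rewrite expf_neq0.
have fD : finsupp D by apply: finsuppD => //; exact: Hfin.
have dD : deg_div D = deg_div D0 + m%:Z * fsum (fun p => v p x).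
  rewrite /deg_div fsumD //; last exact: Hfin.
  rewrite -fsumM; last exact: Hfin.
  congr (_ + _); congr fsum; apply: functional_extensionality => p.
  exact: (vX Hv).
have dD' : deg_div D0 + m%:Z <= deg_div D by rewrite dD lerD2l ler_peMr // -gtz0_ge1.
have mE : `|deg_div D0| + genus%:Z < m%:Z by rewrite /m; lia.
have [N NE] : exists N : nat, N%:Z = deg_div D + 1 - genus%:Z.
  exists (absz (deg_div D + 1 - genus%:Z)%R); rewrite gez0_abs //; lia.
have := lo D fD N; rewrite NE => /(_ (lexx _)) hN.
have hN0 : ell_ge iota v D0 N by apply: ell_ge_mul xm0 _ hN => p; rewrite /D addrK.
have := up N hN0; rewrite NE; lia.
Qed.

Lemma principal_deg x : x != 0 -> fsum (fun p => v p x) = 0.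
Proof.
move=> x0; apply/eqP; rewrite eq_le principal_le0 //=.
have xi0 : x^-1 != 0 by rewrite invr_eq0.
have := principal_le0 xi0.
have -> : (fun p => v p x^-1) = (fun p => -1 * v p x).
  by apply: functional_extensionality => p; rewrite (vV Hv) // mulN1r.
rewrite fsumM; last exact: Hfin.
by rewrite mulN1r oppr_le0.
Qed.

Hypothesis residue : forall p y, vge p 0 y -> exists c, vge p 1 (y - iota c).

Lemma residue_ratio p x y : x != 0 -> vge p (v p x) y ->
  exists c, vge p (v p x + 1) (y - iota c * x).
Proof.
move=> x0 h; have [c hc] : exists c, vge p 1 (y / x - iota c).
  apply: residue; rewrite mulrC; apply: (vgeMl Hv); rewrite ?invr_eq0 //.
  by rewrite (vV Hv) // sub0r opprK.
exists c; have -> : y - iota c * x = x * (y / x - iota c) by field.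
by apply: (vgeM Hv) => //; exact: vge_refl.
Qed.

(** Imposing one more condition at q costs at most one dimension: an element [y i] violating it has
    the lowest order possible at q, and subtracting its multiples from the others raises their
    orders. *)
Lemma ell_step D D' q N : (forall p, p != q -> D p = D' p) -> D' q <= D q + 1 ->
  ell_ge iota v D' N.+1 -> ell_ge iota v D N.
Proof.
move=> DD Dq [y [Hy yD]].
have [/forallP h|] := boolP [forall i, vge q (- D q) (y i)].
  apply: (@ell_ge_le _ N.+1) => //; exists y; split=> // i; apply/in_LDP => p.
  have [->//|pq] := eqVneq p q; rewrite DD //; exact: (LD_vge p (yD i)).
move=> /forallPn[i hi].
have yi0 : y i != 0 by apply: contraNneq hi => ->; exact: vge0.
have vi j : vge q (v q (y i)) (y j).
  refine (vge_w (LD_vge q (yD j)) _); move: hi; rewrite vgeE // -ltNge; lia.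
have /(@choice _ _)[c hc] : forall j, exists c, vge q (v q (y i) + 1) (y j - iota c * y i).
  by move=> j; exact: residue_ratio.
pose A : 'M[k]_(N, N.+1) := \matrix_(j, l)
  ((l == lift i j)%:R - (l == i)%:R * c (lift i j)).
have AE : lcomb iota A y =1 (fun j => y (lift i j) - iota (c (lift i j)) * y i).
  move=> j; rewrite /lcomb (bigD1_ord i) //= mxE eqxx mul1r (negPf (neq_lift _ _)) sub0r.
  rewrite rmorphN mulNr addrC; congr (_ - _).
  rewrite (bigD1 j) //= mxE eqxx [lift i j == i]eq_sym (negPf (neq_lift _ _)) mul0r subr0.
  rewrite rmorph1 mul1r big1 ?addr0 // => l lj; rewrite mxE (inj_eq (@lift_inj _ i)) (negPf lj).
  by rewrite [lift i l == i]eq_sym (negPf (neq_lift _ _)) mul0r subr0 rmorph0 mul0r.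
exists (fun j => y (lift i j) - iota (c (lift i j)) * y i); split.
  apply: klin_indep_ext AE _; apply: klin_lcomb => //; apply/row_freeP.
  exists (\matrix_(l, j) (l == lift i j)%:R); apply/matrixP => j j'; rewrite !mxE.
  rewrite (bigD1 (lift i j')) //= !mxE eqxx mulr1 [lift i j' == i]eq_sym (negPf (neq_lift _ _))
    mul0r subr0.
  rewrite big1 ?addr0; first by rewrite (inj_eq (@lift_inj _ i)) eq_sym.
  by move=> l /negPf lj; rewrite !mxE lj mulr0.
move=> j; apply/in_LDP => p; have [->|pq] := eqVneq p q; last first.
  rewrite DD //; apply: (vgeB Hv); last apply: (vgeZ Hv);
  exact: (LD_vge p (yD _)).
refine (vge_w (hc _) _); move: hi; rewrite vgeE // -ltNge.
have := LD_vge q (yD i); rewrite vgeE //; lia.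
Qed.

Lemma ell_drop m D D' N : (forall p, D p <= D' p) -> finsupp (fun p => D' p - D p) ->
  fsum (fun p => D' p - D p) = m%:Z -> ell_ge iota v D' (N + m) -> ell_ge iota v D N.
Proof.
elim: m D' N => [|m IH] D' N le fs E h.
  rewrite addn0 in h; apply: ell_ge_mono h => p; rewrite leNgt; apply/negP => lt.
  have [T [uT aT _]] := finsupp_common fs fs.
  have pT : p \in T by apply: aT; lia.
  move: E; rewrite (fsumE uT aT) (bigD1_seq p) //= => /eqP.
  rewrite paddr_eq0 ?subr_ge0 // ?(ltW lt) // => [/andP[/eqP h _]|]; first by lia.
  by apply: sumr_ge0 => i _; rewrite subr_ge0.
have [q lt] : exists q, D q < D' q.
  apply: NNPP => /not_ex_all_not H; move: E; have [T [uT aT _]] := finsupp_common fs fs.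
  rewrite (fsumE uT aT) big1 => [|p _]; first by []. have := le p; have /negP := H p; lia.
pose dq p : int := if p == q then -1 else 0.
have fdq : finsupp dq.
  by exists [:: q] => p; rewrite /dq inE; case: (p == q).
have DE : (fun p => D' p + dq p - D p) = (fun p => (D' p - D p) + dq p).
  by apply: functional_extensionality => p; ring.
apply: (IH (fun p => D' p + dq p)).
- by move=> p; rewrite /dq; case: eqP => [->|_]; have := le p; lia.
- by rewrite DE; exact: finsuppD.
- rewrite DE fsumD // E (@fsumE _ dq [:: q]) //; last by move=> p; rewrite /dq inE; case: (p == q).
  by rewrite big_seq1 /dq eqxx; lia.
- have h1 p : p != q -> D' p + dq p = D' p by move=> /negPf pq; rewrite /dq pq addr0.
  have h2 : D' q <= D' q + dq q + 1 by rewrite /dq eqxx; lia.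
  by rewrite addnS in h; exact: (ell_step h1 h2 h).
Qed.

(** The genus gives an upper bound for a single divisor [D0]. It spreads to all effective D, because
    L(D) lies in L(D + |D0|) and descending from there to L(D0) loses at most the difference of
    degrees. *)
Lemma ell_upper : exists c : int, forall D, finsupp D -> (forall p, 0 <= D p) ->
  forall N, ell_ge iota v D N -> N%:Z <= fsum D + c.
Proof.
have [_ [D0 [fD0 up]]] := Hg.
pose B p := `|D0 p|; have fB : finsupp B by apply: finsupp_le fD0 _ => p; rewrite /B => ->.
exists (deg_div D0 + 1 - genus%:Z + fsum (fun p => B p - D0 p)) => D fD D0' N hN.
pose E := fun p => D p + B p.
have fE : finsupp (fun p => E p - D0 p).
  have -> : (fun p => E p - D0 p) = (fun p => E p + -1 * D0 p).
    by apply: functional_extensionality => p; ring.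
  by apply: finsuppD; [exact: finsuppD|exact: finsuppM].
have leE p : D0 p <= E p by have := D0' p; rewrite /E /B; lia.
have fBD : finsupp (fun p => B p - D0 p).
  by apply: finsupp_le fD0 _ => p; rewrite /B => ->.
have sE : fsum (fun p => E p - D0 p) = fsum D + fsum (fun p => B p - D0 p).
  rewrite -fsumD //; congr fsum; apply: functional_extensionality => p; rewrite /E; ring.
have hE : ell_ge iota v E N by apply: ell_ge_mono hN => p; rewrite /E /B; lia.
have E0 : 0 <= fsum (fun p => E p - D0 p) by apply: fsum_ge0 => p; rewrite subr_ge0.
pose m := absz (fsum (fun p => E p - D0 p)).
have mE : fsum (fun p => E p - D0 p) = m%:Z by rewrite /m gez0_abs.
have [le|lt] := leqP m N; last first.
  (* Here N is less than the difference of degrees, and the upper bound at dimension 0 only says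
     that the remaining constant is nonnegative. *)
  have := up 0%N; have : ell_ge iota v D0 0 by exists (fun _ => 0); split=> [c _ []|[]].
  by move=> h /(_ h); lia.
have := up (N - m)%N; rewrite -{1}(subnK le) in hE.
by move=> /(_ (ell_drop leE fE mE hE)); lia.
Qed.

(** If regularity at p implied regularity at q, the two valuations would be proportional; as both
    take the value 1 they would coincide, and so would p and q. The quotient of two elements
    separating in opposite directions is then as required. *)
Lemma place_separation p q : p != q -> exists x, [/\ x != 0, 0 < v p x & v q x < 0].
Proof.
have H p1 q1 : p1 != q1 -> exists y, [/\ y != 0, 0 <= v p1 y & v q1 y < 0].
  move=> pq; apply: NNPP => H; case/eqP: pq; apply: Hinj.
  have ge y : y != 0 -> 0 <= v p1 y -> 0 <= v q1 y.
    by move=> y0 h; rewrite leNgt; apply/negP => h'; apply: H; exists y.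
  have eq0 y : y != 0 -> v p1 y = 0 -> v q1 y = 0.
    move=> y0 h; apply/eqP; rewrite eq_le ge ?h // andbT.
    have := ge y^-1; rewrite !(vV Hv) // invr_eq0 h oppr0 => /(_ y0 (lexx _)).
    by rewrite oppr_ge0.
  have [_ _ _ [a [a0 va]]] := Hv p1.
  have E y : y != 0 -> v q1 y = v p1 y * v q1 a.
    move=> y0; apply/eqP; rewrite -subr_eq0; apply/eqP.
    rewrite -(vZ Hv) // -(vV Hv) ?expfz_neq0 // -(vM Hv) ?invr_eq0 ?expfz_neq0 //.
    apply: eq0; first by rewrite mulf_neq0 ?invr_eq0 ?expfz_neq0.
    by rewrite (vM Hv) ?invr_eq0 ?expfz_neq0 // (vV Hv) ?expfz_neq0 // (vZ Hv) // va mulr1 subrr.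
  have [_ _ _ [b [b0 vb]]] := Hv q1.
  have := ge a a0; rewrite va => /(_ isT) a1.
  have := E b b0; rewrite vb => Eb; move=> x x0; rewrite E //.
  suff -> : v q1 a = 1 by rewrite mulr1.
  move: (v q1 a) (v p1 b) a1 Eb => A B a1 Eb; case: (ltrgtP A 1) => // hA.
    have A0 : A = 0 by lia.
    by move: Eb; rewrite A0 mulr0.
  by have [hB|hB] := lerP B 0; nia.
move=> pq; have [y [y0 py qy]] := H _ _ pq.
have [z [z0 qz pz]] : exists y, [/\ y != 0, 0 <= v q y & v p y < 0].
  by apply: H; rewrite eq_sym.
exists (y / z); rewrite mulf_neq0 ?invr_eq0 // !(vM Hv) ?invr_eq0 // !(vV Hv) //; split=> //; lia.
Qed.

Lemma seq_bound (s : seq P) (f : P -> int) : exists m : nat, forall q, q \in s -> `|f q| < m%:Z.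
Proof.
elim: s => [|p s [m IH]]; first by exists 0%N.
exists (m + (absz (f p)).+1)%N => q; rewrite inE => /orP[/eqP->|/IH]; lia.
Qed.

(** The place q is added by means of a power of y whose exponent exceeds all the orders of x on s in
    absolute value, so that wherever y has a pole this power dominates x. *)
Lemma place_separation_seq p (s : seq P) : p \notin s ->
  exists x, [/\ x != 0, 0 < v p x & forall q, q \in s -> v q x < 0].
Proof.
elim: s => [|q s IH].
  by move=> _; have [_ _ _ [x [x0 vx]]] := Hv p; exists x; rewrite vx.
rewrite inE negb_or => /andP[pq /IH[x [x0 px sx]]].
have [qx|qx] := ltrP (v q x) 0.
  by exists x; split=> // r; rewrite inE => /orP[/eqP->|/sx].
have [y [y0 py qy]] := place_separation pq.
have [m mP] := seq_bound s (fun r => v r x).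
have m1 : 0 < m.+1%:Z by [].
have ym0 : y ^+ m.+1 != 0 by rewrite expf_neq0.
have vy r : v r (y ^+ m.+1) = m.+1%:Z * v r y by exact: (vX Hv).
have hq : x + y ^+ m.+1 != 0 /\ v q (x + y ^+ m.+1) < 0.
  have [||n0 E] := @vge_eq _ _ _ _ _ Hv q 0 _ x ym0; first by rewrite vy; nia.
    by rewrite vgeE.
  by rewrite addrC E vy; split=> //; nia.
exists (x + y ^+ m.+1); split=> //; first exact: hq.1.
  suff : vge p 1 (x + y ^+ m.+1) by rewrite vgeE ?hq.1.
  by apply: (vgeD Hv); rewrite vgeE // vy; nia.
move=> r; rewrite inE => /orP[/eqP->|rs]; first exact: hq.2.
have rx := sx r rs; have mr := mP r rs.
have [ry|ry] := ltrP (v r y) 0.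
  have [||_ E] := @vge_eq _ _ _ _ _ Hv r (v r x) _ x ym0; first by rewrite vy; nia.
    exact: vge_refl.
  by rewrite addrC E vy; nia.
have [||_ ->] := @vge_eq _ _ _ _ _ Hv r 0 _ (y ^+ m.+1) x0 => //.
by rewrite vgeE // vy; nia.
Qed.

(** With x vanishing at p and having poles on s, the element 1 / (1 + x^r) is 1 at p and vanishes on
    s to order at least r. *)
Lemma local_unit_approximation p (s : seq P) (m : int) : p \notin s ->
  exists x, [/\ x != 0, v p x = 0 & forall q, q \in s -> m <= v q x].
Proof.
move=> /place_separation_seq[x [x0 px sx]]; pose r := (absz m).+1.
have xr0 : x ^+ r != 0 by rewrite expf_neq0.
have i0 : (1 : K) != 0 by rewrite oner_neq0.
have vx q : v q (x ^+ r) = r%:Z * v q x by exact: (vX Hv).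
have [||n0 E] := @vge_eq _ _ _ _ _ Hv p 1 _ (x ^+ r) i0; first by rewrite (v1 Hv).
  by rewrite vgeE // vx /r; nia.
exists (1 + x ^+ r)^-1; rewrite invr_eq0; split=> //.
  by rewrite (vV Hv) // E (v1 Hv) oppr0.
move=> q qs; rewrite (vV Hv) // addrC.
have [||_ ->] := @vge_eq _ _ _ _ _ Hv q 0 _ 1 xr0; rewrite ?vx.
- by have := sx q qs; rewrite /r; nia.
- by rewrite vgeE // (v1 Hv).
by have := sx q qs; rewrite /r; nia.
Qed.

Lemma weak_approximation p (s : seq P) (j m : int) : p \notin s ->
  exists x, [/\ x != 0, v p x = j & forall q, q \in s -> m <= v q x].
Proof.
move=> ps; have [_ _ _ [y [y0 vy]]] := Hv p.
have [b bP] := seq_bound s (fun q => v q (y ^ j)).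
have [x [x0 px sx]] := local_unit_approximation (m + b%:Z) ps.
have yj0 : y ^ j != 0 by rewrite expfz_neq0.
exists (y ^ j * x); rewrite mulf_neq0 // (vM Hv) // (vZ Hv) // vy px addr0 mulr1; split=> // q qs.
by rewrite (vM Hv) //; have := sx q qs; have := bP q qs; lia.
Qed.

End Divisors.

Lemma klin_enum (k K : fieldType) (iota : {rmorphism k -> K}) (T : finType) (f : T -> K) :
  (forall c : T -> k, \sum_x iota (c x) * f x = 0 -> forall x, c x = 0) ->
  klin_indep iota (fun i : 'I_#|T| => f (enum_val i)).
Proof.
move=> h c c0 i; rewrite -(enum_valK i); apply: (h (fun x => c (enum_rank x))).
rewrite -[RHS]c0 (reindex (@enum_val T T)) /=; last exact: onW_bij (enum_val_bij _).
by apply: eq_bigr => j _; rewrite enum_valK.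
Qed.

(** * Ramification over k(t) *)

Section Ramification.
Variables (k : closedFieldType) (K : fieldType) (iota : {rmorphism k -> K}).
Variables (P : choiceType) (v : P -> K -> int) (genus : nat).
Hypothesis Hv : forall p, is_dvaluation iota (v p).
Hypothesis Hfin : forall x, x != 0 -> finsupp (fun p => v p x).
Hypothesis Hinj : forall p q, (forall x, x != 0 -> v p x = v q x) -> p = q.
Hypothesis Hg : is_genus iota v genus.
Variable t : K.
Hypothesis Ht : ktranscendental iota t.
Variables (n : nat) (e : 'I_n -> K) (co : K -> 'rV[ktfield iota t]_n).
Hypothesis Hco : coords (ktinc iota t) e co.

Notation vge := (vge v). Notation ev := (ev iota). Notation in_rat := (in_rat iota).
Notation phi := (ktinc iota t). Notation local_par := (local_par iota t).

Let res := residue Hv Ht Hco.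

Lemma F_indep m (y c : 'I_m -> K) : klin_indep phi y ->
  (forall i, c i \in in_rat t) -> \sum_i c i * y i = 0 -> forall i, c i = 0.
Proof.
move=> Hy cF; have /(@choice _ _)[d dE] : forall i, exists x, phi x = c i.
  by move=> i; exact: ktincP.
move=> c0 i; rewrite -dE (Hy d) ?rmorph0 // -[RHS]c0.
by apply: eq_bigr => j _; rewrite dE.
Qed.

Lemma finsupp_max x : x != 0 -> finsupp (fun p => Num.max 0 (v p x)).
Proof. by move=> x0; apply: finsupp_le (Hfin x0) _ => p ->; rewrite maxxx. Qed.

(* The products [e i * s ^- j] with [j <= l] are n (l + 1) independent elements with poles
   bounded by l times the zero divisor of s plus a constant divisor; let l tend to infinity
   in [ell_upper]. *)
Lemma deg_par_ge s : local_par s -> n%:Z <= fsum (fun p => Num.max 0 (v p s)).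
Proof.
move=> [Hs _ sF]; have s0 := trans_neq0 Hs.
have [c hc] := ell_upper Hv Hg res.
have e0 i : e i != 0 by exact: klin_neq0 Hco.1.
pose C p := \sum_i `|v p (e i)|.
have fC : finsupp C.
  have /(@choice _ _)[T TP] : forall i, exists s : seq P, forall p, v p (e i) != 0 -> p \in s.
    by move=> i; exact: Hfin.
  exists (flatten [seq T i | i <- enum 'I_n]) => p; rewrite /C => h.
  have [i vi] : exists i, v p (e i) != 0.
    apply: NNPP => /not_ex_all_not H; move: h; rewrite big1 ?eqxx // => i _.
    by have /negP/negPn/eqP-> := H i.
  by apply/flattenP; exists (T i); [apply: map_f; rewrite mem_enum|exact: TP].
pose B p := Num.max 0 (v p s); have fB : finsupp B by exact: finsupp_max.
have H (l : nat) : n%:Z * (l%:Z + 1) <= fsum C + l%:Z * fsum B + c.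
  pose f (x : 'I_n * 'I_l.+1) := e x.1 * s^-1 ^+ x.2.
  have Hf : klin_indep iota (fun i : 'I_#|{: 'I_n * 'I_l.+1}| => f (enum_val i)).
    apply: klin_enum => a; rewrite (eq_bigr (fun x => iota (a (x.1, x.2)) * f (x.1, x.2))) =>
      [|[]//].
    rewrite -(pair_bigA _ (fun i j => iota (a (i, j)) * f (i, j))) /= => h.
    pose q i := \poly_(j < l.+1) a (i, inord j).
    have qE i : ev s^-1 (q i) = \sum_(j < l.+1) iota (a (i, j)) * s^-1 ^+ j.
      rewrite (@ev_wide _ _ _ _ _ l.+1) ?size_poly //; apply: eq_bigr => j _.
      by rewrite coef_poly ltn_ord inord_val.
    have q0 i : ev s^-1 (q i) = 0.
      apply: (F_indep (c := fun i => ev s^-1 (q i)) Hco.1) => [j|].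
        apply: in_rat_trans (ev_rat _ _ _); by rewrite rpredV.
      rewrite -[RHS]h; apply: eq_bigr => j _; rewrite qE mulr_suml.
      by apply: eq_bigr => j' _; rewrite /f /=; ring.
    move=> [i j]; have := trans_inv Hs (q0 i) => /(congr1 (fun r : {poly k} => r`_j)).
    by rewrite coef_poly ltn_ord coef0 inord_val.
  have -> : l%:Z * fsum B = fsum (fun p => l%:Z * B p) by rewrite fsumM.
  rewrite -fsumD //; last exact: finsuppM.
  have -> : n%:Z * (l%:Z + 1) = #|{: 'I_n * 'I_l.+1}|%:Z.
    by rewrite card_prod !card_ord; lia.
  apply: hc.
  - by apply: finsuppD => //; exact: finsuppM.
  - move=> p; apply: addr_ge0; first exact: sumr_ge0.
    by apply: mulr_ge0 => //; rewrite le_max lexx.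
  exists (fun i => f (enum_val i)); split=> // x; apply/in_LDP => p.
  case: (enum_val x) => i j; rewrite /f /= exprVn exprnN.
  rewrite vgeE ?mulf_neq0 ?expfz_neq0 // (vM Hv) ?expfz_neq0 // (vZ Hv) //.
  have h1 : `|v p (e i)| <= C p by rewrite /C (bigD1 i) //= lerDl sumr_ge0.
  have h2 : j%:Z * v p s <= l%:Z * B p.
    have : v p s <= B p by rewrite /B le_max lexx orbT.
    have : 0 <= B p by rewrite /B le_max lexx.
    have := ltn_ord j; rewrite ltnS; move: (B p) (v p s) => b w; nia.
  by lia.
rewrite leNgt; apply/negP => lt.
have B0 : 0 <= fsum B by apply: fsum_ge0 => p; rewrite /B le_max lexx.
have := H (absz (fsum C + c)); move: lt B0; rewrite -/B; move: (fsum B) (fsum C) => b d lt b0.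
have : d + c <= (absz (d + c))%:Z by lia.
move: (absz _) => l; nia.
Qed.

(* The family consists, for each zero p of s and each order j < v p s, of an element of
   order j at p and of order at least v q s at the other zeros q of s. *)
Lemma adapted_ex s : local_par s ->
  exists (N : nat) (u : 'I_N -> K) (pt : 'I_N -> P) (ex : 'I_N -> nat),
  [/\ N%:Z = fsum (fun p => Num.max 0 (v p s)),
      forall i, [/\ u i != 0, 0 < v (pt i) s, v (pt i) (u i) = (ex i)%:Z & (ex i)%:Z < v (pt i) s],
      forall i p, 0 < v p s -> p != pt i -> v p s <= v p (u i)
    & injective (fun i => (pt i, ex i))].
Proof.
move=> [Hs _ _]; have s0 := trans_neq0 Hs.
have [T [uT aT _]] := finsupp_common (finsupp_max s0) (finsupp_max s0).
pose Z := [seq p <- T | 0 < v p s].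
have ZP p : (p \in Z) = (0 < v p s).
  rewrite mem_filter; case: ltrP => //= h; apply: aT; by rewrite max_r ?ltW // gt_eqF.
have uZ : uniq Z by exact: filter_uniq.
have [b bP] := seq_bound Z (fun q => v q s).
have /(@choice _ _)[a aP] : forall x : P * nat, exists y, [/\ y != 0, v x.1 y = x.2%:Z &
    forall q, 0 < v q s -> q != x.1 -> v q s <= v q y].
  move=> [p j]; have pn : p \notin [seq q <- Z | q != p] by rewrite mem_filter eqxx.
  have [y [y0 vy h]] := weak_approximation Hv Hinj j%:Z b%:Z pn.
  exists y; split=> // q qs qp; apply: le_trans (h q _); last by rewrite mem_filter qp ZP.
  by have := bP q; rewrite ZP => /(_ qs); lia.
pose L := [seq (p, j) | p <- Z, j <- seq.iota 0 (absz (v p s))].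
have uL : uniq L.
  apply: allpairs_uniq_dep => // [x _|]; first exact: iota_uniq.
  by move=> [x1 y1] [x2 y2] _ _ /= [-> ->].
have LP p j : ((p, j) \in L) = (0 < v p s) && (j%:Z < v p s).
  apply/allpairsPdep/andP => [[q [i [qZ iP [-> ->]]]]|[h1 h2]].
    by move: iP; rewrite mem_iota /=; move: qZ; rewrite ZP; lia.
  by exists p, j; rewrite ZP mem_iota; split=> //=; lia.
have Li (i : 'I_(size L)) : (tnth (in_tuple L) i) \in L by exact: mem_tnth.
exists (size L), (fun i => a (tnth (in_tuple L) i)), (fun i => (tnth (in_tuple L) i).1),
  (fun i => (tnth (in_tuple L) i).2); split.
- rewrite size_allpairs_dep (@fsumE _ _ Z uZ) => [|p]; last first.
    by rewrite ZP; case: ltrP => //= h; rewrite max_l ?eqxx.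
  rewrite sumnE big_map (big_morph Posz PoszD (erefl 0%:Z)) big_seq [RHS]big_seq.
  by apply: eq_bigr => p; rewrite ZP size_iota => h; rewrite max_r ?ltW // gtz0_abs.
- move=> i; have := Li i; case E: (tnth _ i) => [p j]; rewrite LP => /andP[h1 h2].
  by have [h3 h4 h5] := aP (p, j).
- move=> i p; have [_ _] := aP (tnth (in_tuple L) i); exact.
- move=> i j /= [h1 h2]; have x0 := tnth (in_tuple L) i.
  have /eqP := injective_projections _ _ h1 h2.
  by rewrite !(tnth_nth x0) nth_uniq // => /eqP/val_inj.
Qed.

Section AdaptedBasis.
Variable s : K.
Variables (N : nat) (u : 'I_N -> K) (pt : 'I_N -> P) (ex : 'I_N -> nat).
Hypothesis Hu : forall i, [/\ u i != 0, 0 < v (pt i) s, v (pt i) (u i) = (ex i)%:Z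
  & (ex i)%:Z < v (pt i) s].
Hypothesis Hpt : forall i p, 0 < v p s -> p != pt i -> v p s <= v p (u i).
Hypothesis Hex : injective (fun i => (pt i, ex i)).

(** The [u i] attached to p have distinct orders below [v p s] and all others have at least that
    order, so the smallest exponent with nonzero coefficient is the order of the sum. *)
Lemma adapted_coef_eq0 (al : 'I_N -> k) p (b : int) : 0 < v p s -> b <= v p s ->
  vge p b (\sum_i iota (al i) * u i) ->
  forall i, pt i = p -> (ex i)%:Z < b -> al i = 0.
Proof.
move=> ps bs h i1 pi1 exi1; apply/eqP/negPn/negP => al1.
pose Q i := (pt i == p) && (al i != 0).
have Q1 : Q i1 by rewrite /Q pi1 eqxx.
pose i0 := [arg min_(i < i1 | Q i) ex i]%N.
have [Q0 imin] : Q i0 /\ forall i, Q i -> (ex i0 <= ex i)%N.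
  by rewrite /i0; case: arg_minnP.
have /andP[/eqP p0 a0] := Q0; have [u0 _ v0 _] := Hu i0.
have ia0 : iota (al i0) != 0 by rewrite fmorph_eq0.
have vf0 : v p (iota (al i0) * u i0) = (ex i0)%:Z.
  by rewrite (vM Hv) // (vC Hv) // add0r -p0.
have le0 := imin _ Q1.
have [|||ne E] := @vsum_distinct _ _ _ _ _ Hv p N (fun i => iota (al i) * u i) ((ex i0)%:Z + 1) i0.
- by rewrite mulf_neq0.
- by rewrite vf0; lia.
- move=> i ii0; have [->|ai] := eqVneq (al i) 0; first by rewrite rmorph0 mul0r vge0.
  apply: (vgeZ Hv); have [ui0 _ vi _] := Hu i; rewrite vgeE //.
  have [pi|pi] := eqVneq (pt i) p; last first.
    by apply: le_trans (Hpt ps _); [clear -le0 exi1 bs; lia|rewrite eq_sym].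
  have := imin i; rewrite /Q pi eqxx ai => /(_ isT); rewrite leq_eqVlt => /orP[/eqP E|].
    by case/eqP: ii0; apply: Hex; rewrite /= p0 pi E.
  by rewrite -pi vi; clear; lia.
by move: h; rewrite vgeE // E vf0; lia.
Qed.

End AdaptedBasis.

(** The zeros of s lie over one point of the line, and c comes from the line: its order at each zero
    q is the same multiple of [v q s], and its value is the same at all of them. *)
Lemma reg_residue s c p : local_par s -> c \in in_rat t -> 0 < v p s -> vge p 0 c ->
  exists al, forall q, 0 < v q s -> vge q (v q s) (c - iota al).
Proof.
move=> [Hs ts _] cF ps c0; have [->|cn0] := eqVneq c 0.
  by exists 0 => q _; rewrite rmorph0 subr0 vge0.
have s0 := trans_neq0 Hs.
have [||a [al [[i ali] h]]] := @rat_reduce _ _ iota _ _ Hv s 1 (fun _ => c) Hs.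
- by move=> _; exact: in_rat_trans ts cF.
- by exists 0.
have vc q : 0 < v q s -> v q c = a * v q s.
  move=> qs; have ia : iota (al i) != 0 by rewrite fmorph_eq0.
  have [||_] := @vge_eq _ _ _ _ _ Hv q (v q s) _ (c * s ^ (- a) - iota (al i)) ia.
  - by rewrite (vC Hv).
  - exact: h.
  rewrite addrC subrK (vC Hv) // (vM Hv) ?expfz_neq0 // (vZ Hv) //; lia.
have [a0|a0] := eqVneq a 0.
  by exists (al i) => q qs; have := h q qs i; rewrite a0 oppr0 expr0z mulr1.
have a1 : 0 < a.
  by move: c0; rewrite vgeE // vc //; move: a0 ps; move: (v p s) => w; nia.
by exists 0 => q qs; rewrite rmorph0 subr0 vgeE // vc //; move: (v q s) qs => w; nia.
Qed.

(** If some coefficient has a pole at s = 0, clear the highest pole and reduce modulo s: the leading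
    coefficients form a relation over k between the [y i] modulo s. Bases without such relations
    thus have regular coordinates. *)
Lemma reg_or_rel s m (y c : 'I_m -> K) : local_par s -> (forall i, c i \in in_rat t) ->
  (forall p i, 0 < v p s -> vge p 0 (y i)) ->
  (forall p, 0 < v p s -> vge p 0 (\sum_i c i * y i)) ->
  (forall i p, 0 < v p s -> vge p 0 (c i)) \/
  exists al : 'I_m -> k, (exists i, al i != 0) /\
    forall p, 0 < v p s -> vge p (v p s) (\sum_i iota (al i) * y i).
Proof.
move=> [Hs ts _] cF y0 xr; have s0 := trans_neq0 Hs.
have [[i0 ci0]|] := classic (exists i, c i != 0); last first.
  move=> /not_ex_all_not H; left=> i p _.
  by have /negP/negPn/eqP-> := H i; exact: vge0.
have cs i : c i \in in_rat s by exact: in_rat_trans ts (cF i).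
have [|a [al [ali h]]] := @rat_reduce _ _ _ _ _ Hv s m c Hs cs; first by exists i0.
have [a0|a0] := lerP 0 a.
  left=> i p ps; have -> : c i = s ^ a * (iota (al i) + (c i * s ^ (- a) - iota (al i))).
    by rewrite addrC subrK mulrCA -expfzDr // subrr expr0z mulr1.
  rewrite -[0]addr0; apply: (vgeM Hv).
    by rewrite vgeE ?expfz_neq0 // (vZ Hv) //; move: (v p s) ps => w; nia.
  by apply: (vgeD Hv); [exact: (vgeC Hv)|apply: vge_w (h p ps i) _; exact: ltW].
right; exists al; split=> // p ps.
have -> : \sum_i iota (al i) * y i =
    s ^ (- a) * (\sum_i c i * y i) - \sum_i (c i * s ^ (- a) - iota (al i)) * y i.
  by rewrite mulr_sumr -sumrB; apply: eq_bigr => i _; ring.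
apply: (vgeB Hv).
  rewrite -[v p s]addr0; apply: (vgeM Hv); last exact: xr.
  by rewrite vgeE ?expfz_neq0 // (vZ Hv) //; move: (v p s) ps => w; nia.
apply: (vge_sum Hv) => i _; rewrite -[v p s]addr0; apply: (vgeM Hv); [exact: h|exact: y0].
Qed.

(** The family of [adapted_ex] is independent over k(t), so it has at most n elements, and by
    [deg_par_ge] at least n. Hence the ramification indices at the zeros of s have sum n, and u is
    an integral basis above s = 0. *)
Lemma adapted_basis s : local_par s -> exists (u : 'I_n -> K) (pt : 'I_n -> P) (ex : 'I_n -> nat),
  [/\ fsum (fun p => Num.max 0 (v p s)) = n%:Z,
      klin_indep phi u,
      forall i p, 0 < v p s -> vge p 0 (u i),
      forall i, [/\ 0 < v (pt i) s, vge (pt i) (ex i)%:Z (u i), (ex i)%:Z < v (pt i) s &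
        forall al : 'I_n -> k, vge (pt i) ((ex i)%:Z + 1) (\sum_j iota (al j) * u j) -> al i = 0] &
      forall c : 'I_n -> K, (forall i, c i \in in_rat t) ->
        (forall p, 0 < v p s -> vge p 0 (\sum_i c i * u i)) ->
        forall i p, 0 < v p s -> vge p 0 (c i)].
Proof.
move=> Hs; have [Hs1 ts sF] := Hs; have s0 := trans_neq0 Hs1.
have [N [u [pt [ex [NE Hu Hpt Hex]]]]] := adapted_ex Hs.
have lead i (al : 'I_N -> k) : vge (pt i) ((ex i)%:Z + 1) (\sum_j iota (al j) * u j) -> al i = 0.
  have [_ ps _ lt] := Hu i => h; apply: (adapted_coef_eq0 Hu Hpt Hex ps _ h) => //; lia.
have u0 i p : 0 < v p s -> vge p 0 (u i).
  move=> ps; have [ui0 _ vi _] := Hu i; rewrite vgeE //.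
  have [->|pi] := eqVneq p (pt i); first by rewrite vi.
  by apply: le_trans (Hpt i p ps pi); exact: ltW.
have ureg (c : 'I_N -> K) : (forall i, c i \in in_rat t) ->
    (forall p, 0 < v p s -> vge p 0 (\sum_i c i * u i)) ->
    forall i p, 0 < v p s -> vge p 0 (c i).
  move=> cF h; have [//|[al [[i ai] hal]]] := reg_or_rel Hs cF (fun p i => @u0 i p) h.
  have [_ ps _ lt] := Hu i.
  by case/eqP: ai; apply: lead; apply: vge_w (hal _ ps) _; lia.
have uind : klin_indep phi u.
  move=> d d0 i; apply/eqP/negPn/negP => di; have [_ ps _ _] := Hu i.
  have pdi : phi (d i) != 0 by rewrite fmorph_eq0.
  (* A relation may be multiplied by any power of s; this negative one gives its i-th coefficient a
     pole, against [ureg]. *)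
  pose a := `|v (pt i) (phi (d i))| + 1.
  have := ureg (fun j => phi (d j) * s ^ (- a)) _ _ i (pt i) ps.
  rewrite vgeE ?mulf_neq0 ?expfz_neq0 // (vM Hv) ?expfz_neq0 // (vZ Hv) //.
  have -> : (0 <= v (pt i) (phi (d i)) + - a * v (pt i) s) = false.
    by rewrite /a; move: (v _ _) (v _ _) ps => w z; nia.
  move=> H; suff: false by []. 
  apply: H => [j|p _]; first by rewrite rpredM ?ktinc_rat // rpredXz.
  have -> : \sum_j phi (d j) * s ^ (- a) * u j = s ^ (- a) * \sum_j phi (d j) * u j.
    by rewrite mulr_sumr; apply: eq_bigr => j _; ring.
  by rewrite d0 mulr0 vge0.
have Nn : N = n.
  apply/eqP; rewrite eqn_leq (klin_le Hco uind) /=.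
  by have := deg_par_ge Hs; rewrite -NE.
subst N; exists u, pt, ex; split=> // i.
have [ui0 ps vi lt] := Hu i; split=> //; last exact: lead.
by rewrite vgeE // vi.
Qed.

Lemma deg_par s : local_par s -> fsum (fun p => Num.max 0 (v p s)) = n%:Z.
Proof. by move=> /adapted_basis[u [pt [ex []]]]. Qed.

Notation tr := (trF e co).

(* In an adapted basis u, the order of [z * u i] at [pt i] exceeds [ex i], so the diagonal
   entries of the matrix of multiplication by z vanish at the zeros of s. *)
Lemma trace_reg1 s z : local_par s -> (forall p, 0 < v p s -> vge p 1 z) ->
  forall p, 0 < v p s -> vge p (v p s) (phi (tr z)).
Proof.
move=> Hs z1; have [u [pt [ex [_ uind u0 Hu ureg]]]] := adapted_basis Hs.
have Huc := klin_coords Hco uind.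
pose A : 'M_n := \matrix_(i, j) (co (z * u i) *m invmx (comx co u)) 0 j.
have AE i : z * u i = lcomb phi A u i.
  by apply: (etrans (Huc.2 _)); apply: eq_bigr => j _; rewrite [A _ _]mxE.
rewrite (trF_basis Hco uind AE) => p ps.
have zu i q : 0 < v q s -> vge q 0 (\sum_j phi (A i j) * u j).
  move=> qs; rewrite -/(lcomb phi A u i) -AE -[0]addr0; apply: (vgeM Hv); last exact: u0.
  by apply: vge_w (z1 q qs) _.
have Areg i j q : 0 < v q s -> vge q 0 (phi (A i j)).
  move=> qs; apply: (ureg (fun j => phi (A i j))) => //; first by move=> l; exact: ktinc_rat.
  by move=> q' qs'; exact: zu.
rewrite rmorph_sum; apply: (vge_sum Hv) => i _.
have [pis ui lt lead] := Hu i.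
have /(@choice _ _)[al alP] : forall j, exists a, forall q, 0 < v q s ->
  vge q (v q s) (phi (A i j) - iota a).
  by move=> j; apply: (reg_residue Hs (ktinc_rat _) pis); exact: Areg.
have ai0 : al i = 0.
  apply: lead; have -> : \sum_j iota (al j) * u j =
      z * u i - \sum_j (phi (A i j) - iota (al j)) * u j.
    by rewrite AE -sumrB; apply: eq_bigr => j _; ring.
  apply: (vgeB Hv); first by rewrite addrC; apply: (vgeM Hv) => //; exact: z1.
  apply: (vge_sum Hv) => j _; have h1 : (ex i)%:Z + 1 <= v (pt i) s + 0 by lia.
  by refine (vge_w _ h1); apply: (vgeM Hv); [exact: alP|exact: u0].
by have := alP i p ps; rewrite ai0 rmorph0 subr0.
Qed.

(** Powers of s come out of the trace. For a = -1: with e = [v p s] the ramification index, poles of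
    order at most e - 1 at all zeros of s leave the trace regular, which is how the ramification
    divisor enters. *)
Lemma trace_reg s z a : local_par s -> (forall p, 0 < v p s -> vge p (1 + a * v p s) z) ->
  forall p, 0 < v p s -> vge p ((a + 1) * v p s) (phi (tr z)).
Proof.
move=> Hs h p ps; have [Hs1 _ sF] := Hs; have s0 := trans_neq0 Hs1.
have [c cE] : exists c, phi c = s ^ (- a) by apply: ktincP; rewrite rpredXz.
have := @trace_reg1 s (s ^ (- a) * z) Hs _ p ps; rewrite -cE (trFZ Hco) rmorphM cE => H.
have -> : phi (tr z) = s ^ a * (s ^ (- a) * phi (tr z)).
  by rewrite mulrA -expfzDr // subrr expr0z mul1r.
apply: (vgeMl Hv); rewrite ?expfz_neq0 // (vZ Hv) // mulrDl addrC addKr mul1r.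
apply: H => q qs; apply: (vgeMl Hv); rewrite ?expfz_neq0 // (vZ Hv) //.
by apply: vge_w (h q qs) _; lia.
Qed.

End Ramification.

(** * Polynomials in t among the elements of k(t), and poles above infinity *)

Section PolesOfParameter.
Variables (k : closedFieldType) (K : fieldType) (iota : {rmorphism k -> K}).
Variables (P : choiceType) (v : P -> K -> int) (genus : nat).
Hypothesis char0 : [pchar k] =i pred0.
Hypothesis Hv : forall p, is_dvaluation iota (v p).
Hypothesis Hfin : forall x, x != 0 -> finsupp (fun p => v p x).
Hypothesis Hinj : forall p q, (forall x, x != 0 -> v p x = v q x) -> p = q.
Hypothesis Hg : is_genus iota v genus.
Variable t : K.
Hypothesis Ht : ktranscendental iota t.
Variables (n : nat) (e : 'I_n -> K) (co : K -> 'rV[ktfield iota t]_n).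
Hypothesis Hco : coords (ktinc iota t) e co.

Notation vge := (vge v). Notation ev := (ev iota). Notation in_rat := (in_rat iota).
Notation phi := (ktinc iota t). Notation local_par := (local_par iota t).

Let t0 : t != 0 := trans_neq0 Ht.
Definition pole p := Num.max 0 (- v p t).

Lemma local_par_sub c : local_par (t - iota c).
Proof.
split; [exact: trans_subC|exact: subC_rat|].
by have := ev_rat iota t ('X - c%:P); rewrite evB evX evC.
Qed.

Lemma local_par_inv : local_par t^-1.
Proof.
split; [exact: trans_inv|exact: inv_rat|].
by have := ev_rat iota t 'X; rewrite evX rpredV.
Qed.

Lemma n_gt0 : (0 < n)%N.
Proof.
case: n e co Hco => [|//] e' co' [_ /(_ 1)]; rewrite big_ord0 => /eqP.
by rewrite oner_eq0.
Qed.

Lemma zero_ex s : local_par s -> exists p, 0 < v p s.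
Proof.
move=> Hs; apply: NNPP => /not_ex_all_not H.
have := deg_par Hv Hfin Hinj Hg Ht Hco Hs; rewrite (@fsumE _ _ [::]) // ?big_nil.
  by have := n_gt0; lia.
by move=> p; have /negP := H p; rewrite -leNgt => h; rewrite max_l ?eqxx.
Qed.

Lemma pole_inv p : pole p = Num.max 0 (v p t^-1).
Proof. by rewrite /pole (vV Hv). Qed.

Lemma fin_pole : finsupp pole.
Proof. by apply: finsupp_le (Hfin t0) _ => p E; rewrite /pole E oppr0 maxxx. Qed.

Lemma deg_pole : fsum pole = n%:Z.
Proof.
rewrite -(deg_par Hv Hfin Hinj Hg Ht Hco local_par_inv).
by congr fsum; apply: functional_extensionality => p; rewrite pole_inv.
Qed.

Lemma pole_fin p : 0 <= v p t -> pole p = 0.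
Proof. by move=> h; rewrite /pole max_l // oppr_le0. Qed.
Lemma pole_infty p : v p t < 0 -> pole p = - v p t.
Proof. by move=> h; rewrite /pole max_r // oppr_ge0 ltW. Qed.
Lemma pole_ge0 p : 0 <= pole p.
Proof. by rewrite /pole le_max lexx. Qed.

Lemma vsub_fin p c : 0 <= v p t -> 0 <= v p (t - iota c).
Proof.
move=> h; rewrite -vgeE ?subr_eq0 ?(trans_neq _ Ht) //.
by apply: (vgeB Hv); [rewrite vgeE|exact: (vgeC Hv)].
Qed.

Lemma vsub_infty p c : v p t < 0 -> v p (t - iota c) = v p t.
Proof.
move=> h; have [|_ ->] // := @vge_eq _ _ _ _ _ Hv p 0 t (- iota c) t0 h.
by rewrite (vgeN Hv); exact: (vgeC Hv).
Qed.

Lemma v_ev_infty p (q : {poly k}) : v p t < 0 -> q != 0 ->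
  v p (ev t q) = (size q).-1%:Z * v p t.
Proof.
move=> h q0; rewrite ev_coef; have lc : q`_(size q).-1 != 0 by rewrite -lead_coefE lead_coef_eq0.
have sq : (0 < size q)%N by rewrite size_poly_gt0.
have lt : ((size q).-1 < size q)%N by rewrite prednK.
have il : iota q`_(size q).-1 != 0 by rewrite fmorph_eq0.
have E : v p (iota q`_(size q).-1 * t ^+ (size q).-1) = (size q).-1%:Z * v p t.
  by rewrite (vM Hv) ?expf_neq0 // (vC Hv) // add0r (vX Hv).
have [|||_ ->] // := @vsum_distinct _ _ _ _ _ Hv p _ (fun i : 'I_(size q) => iota q`_i * t ^+ i)
    ((size q).-1%:Z * v p t + 1) (Ordinal lt).
- by rewrite mulf_neq0 // expf_neq0.
- by rewrite [X in X < _]E ltrDl.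
move=> i ii; apply: (vgeZ Hv); rewrite vgeE ?expf_neq0 // (vX Hv) //.
have : (i != (size q).-1 :> nat) by apply: contraNneq ii => ii; apply/eqP/val_inj.
have := ltn_ord i; move: (nat_of_ord i) => i0; move: (v p t) h => w hw;
  move: (size q) => sz h1 h2; nia.
Qed.

Lemma v_ev_root p (q : {poly k}) c : 0 < v p (t - iota c) -> q.[c] != 0 -> v p (ev t q) = 0.
Proof.
move=> pc qc; have /factor_theorem[q1 E] : root (q - q.[c]%:P) c.
  by rewrite rootE !hornerE subrr.
have ic : iota q.[c] != 0 by rewrite fmorph_eq0.
have -> : ev t q = iota q.[c] + ev t q1 * (t - iota c).
  by rewrite -(evC iota t) -(evX iota t) -(evC iota t) -evB evX -evM -E -evD addrC subrK.
have [||_ ->] := @vge_eq _ _ _ _ _ Hv p 1 (iota q.[c]) (ev t q1 * (t - iota c)) ic.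
- by rewrite (vC Hv).
- rewrite -[1]add0r; apply: (vgeM Hv); last by apply: vgeI; lia.
  apply: (vge_ev Hv); rewrite -(subrK (iota c) t); apply: (vgeD Hv); last exact: (vgeC Hv).
  by apply: vgeI; exact: ltW.
by rewrite (vC Hv).
Qed.

(** A root of the denominator of the reduced fraction lies below some place, which would be a finite
    pole; so the fraction is a polynomial, and its degree shows at any pole of t. The bound d may be
    negative, whence the separate case of the zero polynomial. *)
Lemma poly_of_reg c (d : int) : c \in in_rat t -> (forall p, 0 <= v p t -> vge p 0 c) ->
  (forall p, v p t < 0 -> vge p (- d * pole p) c) ->
  exists q, c = ev t q /\ (size q = 0%N \/ (size q)%:Z <= d + 1).
Proof.
move=> /in_ratP[A [B [B0 ->]]] fin inf; have [A0|A0] := eqVneq A 0.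
  by exists 0; rewrite A0 ev0 mul0r size_poly0; split=> //; left.
have B0' : B != 0 by apply: contraNneq B0 => ->; rewrite ev0.
have cop : coprimep (A %/ gcdp A B) (B %/ gcdp A B) by rewrite coprimep_div_gcd // A0.
have EA := divpK (dvdp_gcdl A B); have EB := divpK (dvdp_gcdr A B).
move: (gcdp A B) (B %/ gcdp A B) (A %/ gcdp A B) EA EB cop => g B1 A1 EA EB cop.
have A10 : A1 != 0 by apply: contraNneq A0 => h; rewrite -EA h mul0r.
have B10 : B1 != 0 by apply: contraNneq B0' => h; rewrite -EB h mul0r.
have g0 : g != 0 by apply: contraNneq B0' => h; rewrite -EB h mulr0.
have cE : ev t A / ev t B = ev t A1 / ev t B1.
  by rewrite -EA -EB !evM -mulf_div divff ?mulr1 //; exact: ev_neq0.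
rewrite cE in fin inf *.
have [/closed_rootP[c1 rc]|] := boolP (size B1 != 1).
  have [p pc] := zero_ex (local_par_sub c1).
  have tp : 0 <= v p t.
    by rewrite leNgt; apply/negP => h; move: pc; rewrite vsub_infty //; lia.
  have Ac : A1.[c1] != 0 by rewrite coprimep_sym in cop; exact: coprimep_root cop rc.
  have vB : 0 < v p (ev t B1).
    have /factor_theorem[B2 EB2] := rc.
    have B20 : B2 != 0 by apply: contraNneq B10 => h; rewrite EB2 h mul0r.
    have vB2 : 0 <= v p (ev t B2).
      rewrite -vgeE ?ev_neq0 //; apply: (vge_ev Hv); exact: vgeI.
    by rewrite EB2 evM evB evX evC (vM Hv) ?ev_neq0 ?subr_eq0 ?(trans_neq _ Ht) // ltr_wpDl.
  have := fin p tp; rewrite vgeE ?mulf_neq0 ?invr_eq0 ?ev_neq0 // (vM Hv) ?invr_eq0 ?ev_neq0 //.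
  by rewrite (vV Hv) ?ev_neq0 // (v_ev_root pc Ac) add0r oppr_ge0 leNgt vB.
rewrite negbK => /size_poly1P[b b0 EB1].
have Eq : ev t A1 / ev t B1 = ev t (b^-1 *: A1).
  by rewrite EB1 evC evZ fmorphV mulrC.
exists (b^-1 *: A1); split=> //; rewrite Eq in inf.
have q0 : b^-1 *: A1 != 0 by rewrite scaler_eq0 invr_eq0 negb_or b0.
have [p] := zero_ex local_par_inv; rewrite (vV Hv) // oppr_gt0 => tp.
have := inf p tp; rewrite vgeE ?ev_neq0 // v_ev_infty // pole_infty //.
move: q0; rewrite -size_poly_gt0; move: (size _) => sz; move: (v p t) tp => w hw s0 h.
by right; nia.
Qed.

(* A k(t)-basis with w i in L(m i B), where B is the polar divisor of t. *)
Definition good_basis (w : 'I_n -> K) (m : 'I_n -> nat) : Prop :=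
  klin_indep phi w /\ forall i p, vge p (- (m i)%:Z * pole p) (w i).

(** At each finite pole p of x, multiply by a high power of the parameter t - c vanishing at p; this
    creates poles only above infinity. *)
Lemma clear_poles x : exists h, [/\ h \in in_rat t, h != 0 &
  exists m : nat, forall p, vge p (- m%:Z * pole p) (h * x)].
Proof.
have [->|x0] := eqVneq x 0.
  exists 1; rewrite rpred1 oner_neq0; split=> //; exists 0%N => p; rewrite mulr0; exact: vge0.
have [T [uT aT _]] := finsupp_common (Hfin x0) (Hfin x0).
have [b bP] := seq_bound T (fun p => v p x).
have /(@choice _ _)[s sP] := local_par_ex Hv Ht Hco.
pose Tf := [seq p <- T | 0 <= v p t].
pose h := \prod_(p <- Tf) s p ^+ b.
have sfin p q : 0 <= v p t -> 0 <= v q t -> 0 <= v q (s p).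
  move=> pt qt; have [_ _ [[c ->]|[_ pt']]] := sP p; first exact: vsub_fin.
  by move: pt; rewrite leNgt pt'.
have sinf p q : 0 <= v p t -> v q t < 0 -> v q (s p) = v q t.
  move=> pt qt; have [_ _ [[c ->]|[_ pt']]] := sP p; first exact: vsub_infty.
  by move: pt; rewrite leNgt pt'.
have s0 p : s p != 0 by have [[/trans_neq0]] := sP p.
have h0 : h != 0 by rewrite prodf_seq_neq0; apply/allP => p _; rewrite expf_neq0.
have vh q : v q h = \sum_(p <- Tf) b%:Z * v q (s p).
  rewrite (v_prod Hv) => [|p _]; last by rewrite expf_neq0.
  by apply: eq_bigr => p _; rewrite (vX Hv).
exists h; split=> //; first by apply: rpred_prod => p _; rewrite rpredX //; have [[]] := sP p.
exists (b * (size Tf).+1)%N => q; rewrite vgeE ?mulf_neq0 // (vM Hv) // vh.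
have bq : - b%:Z <= v q x.
  have [qT|qT] := boolP (q \in T); first by have := bP q qT; lia.
  have /eqP-> : v q x == 0 by apply: contraNT qT => /aT.
  by rewrite oppr_le0.
have [qt|qt] := ltrP (v q t) 0.
  rewrite pole_infty // big_seq (eq_bigr (fun=> b%:Z * v q t)) => [|p]; last first.
    by rewrite mem_filter => /andP[pt _]; rewrite sinf.
  rewrite -big_seq big_const_seq count_predT iter_addr_0 -mulr_natr natz.
  by move: (size Tf) (v q t) qt (v q x) bq => z w hw y hy; nia.
rewrite pole_fin // mulr0.
have ge0 : 0 <= \sum_(p <- Tf) b%:Z * v q (s p).
  rewrite big_seq; apply: sumr_ge0 => p; rewrite mem_filter => /andP[pt _].
  by rewrite mulr_ge0 // sfin.
have [qT|qT] := boolP (q \in T); last first.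
  have -> : v q x = 0 by apply/eqP; apply: contraNT qT => /aT.
  by rewrite addr0.
have qTf : q \in Tf by rewrite mem_filter qt.
rewrite (bigD1_seq q) ?filter_uniq //=.
have ge1 : 0 <= \sum_(p <- Tf | p != q) b%:Z * v q (s p).
  rewrite big_seq_cond; apply: sumr_ge0 => p; rewrite mem_filter => /andP[/andP[pt _] _].
  by rewrite mulr_ge0 // sfin.
have [_ qs _] := sP q; move: ge1; move: (\sum_(_ <- _ | _) _) => S S0.
by have := bP q qT; move: (v q (s q)) (v q x) qs => w y hw; nia.
Qed.

End PolesOfParameter.

Lemma coef_ev (k K : fieldType) (iota : {rmorphism k -> K}) n (m : 'I_n -> nat)
    (q : 'I_n -> {poly k}) (w : 'I_n -> K) (t : K) : (forall i, (size (q i) <= m i)%N) ->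
  \sum_i ev iota t (q i) * w i =
  \sum_(x : {i : 'I_n & 'I_(m i)}) iota (q (tag x))`_(tagged x) * (t ^+ (tagged x) * w (tag x)).
Proof.
move=> h; rewrite (eq_bigr (fun i => \sum_(j < m i) iota (q i)`_j * (t ^+ j * w i))) => [|i _].
  rewrite -(@sig_big_dep _ _ _ _ (fun i => 'I_(m i)) xpredT (fun _ => xpredT)
    (fun i (j : 'I_(m i)) => iota (q i)`_j * (t ^+ j * w i))) /=.
  by apply: eq_bigl => x.
by rewrite (ev_wide _ _ (h i)) mulr_suml; apply: eq_bigr => j _; rewrite mulrA.
Qed.

Lemma card_tag_ord n (m : 'I_n -> nat) : #|{: {i : 'I_n & 'I_(m i)}}| = (\sum_i m i)%N.
Proof.
rewrite card_tagged sumnE big_map big_enum; apply: eq_bigr => i _; by rewrite card_ord.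
Qed.

(** * Minimal bases and the spaces L(r B) *)

Section MinimalBases.
Variables (k : closedFieldType) (K : fieldType) (iota : {rmorphism k -> K}).
Variables (P : choiceType) (v : P -> K -> int) (genus : nat).
Hypothesis char0 : [pchar k] =i pred0.
Hypothesis Hv : forall p, is_dvaluation iota (v p).
Hypothesis Hfin : forall x, x != 0 -> finsupp (fun p => v p x).
Hypothesis Hinj : forall p q, (forall x, x != 0 -> v p x = v q x) -> p = q.
Hypothesis Hg : is_genus iota v genus.
Variable t : K.
Hypothesis Ht : ktranscendental iota t.
Variables (n : nat) (e : 'I_n -> K) (co : K -> 'rV[ktfield iota t]_n).
Hypothesis Hco : coords (ktinc iota t) e co.

Notation vge := (vge v). Notation ev := (ev iota). Notation in_rat := (in_rat iota).
Notation phi := (ktinc iota t). Notation local_par := (local_par iota t).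
Notation good_basis := (@good_basis k K iota P v t n). Notation pole := (pole v t).

Let t0 : t != 0 := trans_neq0 Ht.

Lemma good_ex : exists w m, good_basis w m.
Proof.
have /(@choice _ _)[h hP] := fun i => clear_poles Hv Hfin Ht Hco (e i).
have /(@choice _ _)[m mP] : forall i, exists m : nat, forall p, vge p (- m%:Z * pole p) (h i * e i).
  by move=> i; have [_ _] := hP i.
have /(@choice _ _)[a aP] : forall i, exists a, phi a = h i.
  by move=> i; apply: ktincP; have [] := hP i.
exists (fun i => h i * e i), m; split=> // c c0 i.
have E : c i * a i = 0.
  apply: (Hco.1 (fun i => c i * a i)); rewrite -[RHS]c0; apply: eq_bigr => j _.
  by rewrite rmorphM aP mulrA.
have ai : a i != 0 by rewrite -(fmorph_eq0 phi) aP; have [] := hP i.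
by move/eqP: E; rewrite mulf_eq0 (negPf ai) orbF => /eqP.
Qed.

Lemma min_basis_ex : exists w m, good_basis w m /\
  forall w' m', good_basis w' m' -> (\sum_i m i <= \sum_i m' i)%N.
Proof.
have [w0 [m0 h0]] := good_ex.
suff H N : (exists w m, good_basis w m /\ (\sum_i m i <= N)%N) -> exists w m, good_basis w m /\
  forall w' m', good_basis w' m' -> (\sum_i m i <= \sum_i m' i)%N.
  by apply: (H (\sum_i m0 i)%N); exists w0, m0.
elim: N => [|N IH] [w [m [g le]]].
  by exists w, m; split=> // w' m' _; apply: leq_trans le _.
have [h|h] := classic (exists w m, good_basis w m /\ (\sum_i m i <= N)%N); first exact: IH.
exists w, m; split=> // w' m' g'; apply: leq_trans le _; rewrite ltnNge; apply/negP => le'.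
by apply: h; exists w', m'.
Qed.

Section MinimalBasis.
Variables (w : 'I_n -> K) (m : 'I_n -> nat).
Hypothesis good : good_basis w m.
Hypothesis minimal : forall w' m', good_basis w' m' -> (\sum_i m i <= \sum_i m' i)%N.

(** Such a combination could replace [w i] with m i lowered by one. If m i = 0 there is nothing to
    lower, but then the combination has at least the zeros of a divisor of degree n > 0, while
    principal divisors have degree 0. *)
Lemma no_smaller (a : 'I_n -> K) i : (forall j, a j \in in_rat t) -> a i != 0 ->
  (forall p, vge p (- ((m i)%:Z - 1) * pole p) (\sum_j a j * w j)) -> False.
Proof.
move=> aF ai h; set z := \sum_j _ in h.
have z0 : z != 0 by apply: contraNneq ai => z0; apply/eqP; exact: (F_indep good.1 aF z0).
have [mi|mi] := posnP (m i).
  have := principal_deg Hv Hfin Hg z0; apply/eqP; rewrite gt_eqF //.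
  apply: (@lt_le_trans _ _ (fsum pole)).
    by rewrite (deg_pole Hv Hfin Hinj Hg Ht Hco); have := n_gt0 Hco.
  apply: fsum_le; [exact: (fin_pole Hfin Ht)|exact: Hfin|] => p.
  by have := h p; rewrite mi sub0r opprK mul1r vgeE.
have /(@choice _ _)[d dE] : forall j, exists x, phi x = a j by move=> j; exact: ktincP.
have di : d i != 0 by rewrite -(fmorph_eq0 phi) dE.
pose w' j := if j == i then z else w j; pose m' j := if j == i then (m i).-1 else m j.
suff /minimal : good_basis w' m'.
  rewrite (bigD1 i) // [X in (_ <= X)%N](bigD1 i) //= /m' eqxx.
  rewrite [X in (_ <= _ + X)%N](eq_bigr m) => [|j /negPf-> //].
  by rewrite leq_add2r; case: (m i) mi => // x _; rewrite ltnn.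
split; last first.
  move=> j p; rewrite /w' /m'; case: eqP => [_|_]; last exact: good.2.
  by have := h p; case: (m i) mi => // x _; rewrite intS addrC addKr.
move=> c c0.
have E j : c i * d j + (j != i)%:R * c j = 0.
  apply: (good.1 (fun j => c i * d j + (j != i)%:R * c j)).
  rewrite -[RHS]c0 [RHS](bigD1 i) // /w' eqxx /z mulr_sumr.
  rewrite [LHS](eq_bigr (fun l => phi (c i) * (a l * w l) + phi ((l != i)%:R * c l) * w l)).
    rewrite big_split; congr (_ + _).
    rewrite [RHS]big_mkcond; apply: eq_bigr => l _; cbv beta.
    by case: (eqVneq l i) => _; rewrite ?mul0r ?rmorph0 ?mul0r ?mul1r.
  by move=> l _; rewrite -dE; cbv beta; rewrite rmorphD mulrDl [phi (c i * d l)]rmorphM mulrA.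
have ci : c i = 0.
  by have /eqP := E i; rewrite eqxx mul0r addr0 mulf_eq0 (negPf di) orbF => /eqP.
move=> j; have [->//|ji] := eqVneq j i.
by have := E j; rewrite ji ci mul0r add0r mul1r.
Qed.

Lemma top_index (al : 'I_n -> k) : (exists i, al i != 0) ->
  exists i, al i != 0 /\ forall j, al j != 0 -> (m j <= m i)%N.
Proof.
move=> [i0 h0]; pose i := [arg max_(i > i0 | al i != 0%R) m i]%N; exists i.
by rewrite /i; case: arg_maxnP => //.
Qed.

Lemma vge_sub_fin p al : (forall j, al j != 0 -> vge p 0 (w j)) ->
  vge p 0 (\sum_j iota (al j) * w j).
Proof.
move=> h; apply: (vge_sum Hv) => j _; have [->|aj] := eqVneq (al j) 0.
  by rewrite rmorph0 mul0r vge0.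
by apply: (vgeZ Hv); exact: h.
Qed.

Lemma min_basis_fin p j : 0 <= v p t -> vge p 0 (w j).
Proof. by move=> h; have := good.2 j p; rewrite pole_fin // mulr0. Qed.

Lemma iota_rat a : iota a \in in_rat t.
Proof. by have := ev_rat iota t a%:P; rewrite evC. Qed.

Lemma t_rat : t \in in_rat t.
Proof. by have := ev_rat iota t 'X; rewrite evX. Qed.

(* Otherwise a combination of the w i could be divided by t - c, and it would replace in the
   basis an element of largest degree m i, against minimality. *)
Lemma no_rel_fin c (al : 'I_n -> k) : (exists i, al i != 0) ->
  (forall p, 0 < v p (t - iota c) ->
     vge p (v p (t - iota c)) (\sum_i iota (al i) * w i)) -> False.
Proof.
move=> /top_index[i [ai imax]] h; set s := t - iota c in h.
have [Hs1 _ sF] := local_par_sub Ht c; have s0 : s != 0 := trans_neq0 Hs1.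
apply: (@no_smaller (fun j => s^-1 * iota (al j)) i).
- by move=> j; rewrite rpredM ?rpredV ?iota_rat.
- by rewrite mulf_neq0 ?invr_eq0 ?fmorph_eq0.
move=> p; have -> : \sum_j s^-1 * iota (al j) * w j = s^-1 * \sum_j iota (al j) * w j.
  by rewrite mulr_sumr; apply: eq_bigr => j _; rewrite mulrA.
apply: (vgeMl Hv); rewrite ?invr_eq0 // (vV Hv) // opprK.
have [tp|tp] := ltrP (v p t) 0.
  rewrite /s vsub_infty // pole_infty //.
  have -> : - ((m i)%:Z - 1) * - v p t + v p t = - (m i)%:Z * pole p by rewrite pole_infty //; ring.
  apply: (vge_sum Hv) => j _; have [->|aj] := eqVneq (al j) 0.
    by rewrite rmorph0 mul0r vge0.
  apply: (vgeZ Hv); refine (vge_w (good.2 j p) _).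
  by rewrite ler_wpM2r ?pole_ge0 // lerN2 lez_nat imax.
rewrite pole_fin // mulr0 add0r.
have [sp|sp] := ltrP 0 (v p s); first exact: h.
refine (vge_w _ sp); apply: vge_sub_fin => j _; exact: min_basis_fin.
Qed.

(** Over infinity the elements t^(- m j) w j play the part of the basis. Multiplying a relation
    modulo 1 / t by t^(m i), with m i the largest exponent involved, keeps it regular at finite
    places and gains one order above infinity. *)
Lemma no_rel_infty (al : 'I_n -> k) : (exists i, al i != 0) ->
  (forall p, 0 < v p t^-1 ->
     vge p (v p t^-1) (\sum_i iota (al i) * (t^-1 ^+ m i * w i))) -> False.
Proof.
move=> /top_index[i [ai imax]] h.
apply: (@no_smaller (fun j => t ^+ m i * (iota (al j) * t^-1 ^+ m j)) i).
- by move=> j; rewrite rpredM ?rpredX ?t_rat // rpredM ?iota_rat // rpredX // rpredV t_rat.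
- by rewrite !mulf_neq0 ?expf_neq0 ?invr_eq0 ?fmorph_eq0.
move=> p; have -> : \sum_j t ^+ m i * (iota (al j) * t^-1 ^+ m j) * w j =
    t ^+ m i * \sum_j iota (al j) * (t^-1 ^+ m j * w j).
  by rewrite mulr_sumr; apply: eq_bigr => j _; rewrite !mulrA.
have [tp|tp] := ltrP (v p t) 0.
  apply: (vgeMl Hv); rewrite ?expf_neq0 // (vX Hv) // pole_infty //.
  have -> : - ((m i)%:Z - 1) * - v p t - (m i)%:Z * v p t = v p t^-1 by rewrite (vV Hv) //; ring.
  by apply: h; rewrite (vV Hv) // oppr_gt0.
rewrite pole_fin // mulr0 mulr_sumr; apply: (vge_sum Hv) => j _.
have [->|aj] := eqVneq (al j) 0; first by rewrite rmorph0 mul0r mulr0 vge0.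
have -> : t ^+ m i * (iota (al j) * (t^-1 ^+ m j * w j)) = iota (al j) * (t ^+ (m i - m j) * w j).
  rewrite -{1}(subnK (imax j aj)) exprD exprVn.
  have tj : t ^+ m j != 0 by rewrite expf_neq0.
  by field.
apply: (vgeZ Hv); rewrite -[0]addr0; apply: (vgeM Hv); last exact: min_basis_fin.
by rewrite vgeE ?expf_neq0 // (vX Hv) //; apply: mulr_ge0.
Qed.

(** By minimality there are no relations modulo t - c or, after the twist, modulo 1 / t;
    [reg_or_rel] then makes the coefficients regular at finite places and bounds their poles above
    infinity. *)
Lemma coef_bound x (r : nat) (c : 'I_n -> K) : (forall i, c i \in in_rat t) ->
  x = \sum_i c i * w i -> (forall p, vge p (- r%:Z * pole p) x) ->
  forall i, exists q, c i = ev t q /\ (size q <= r.+1 - m i)%N.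
Proof.
move=> cF xE xr i.
have [|||q [qE sq]] := poly_of_reg Hv Hfin Hinj Hg Ht Hco (c := c i) (d := r%:Z - (m i)%:Z).
- exact: cF.
- move=> p tp; have [s [Hs sp sE]] := local_par_ex Hv Ht Hco p.
  have [[c1 E]|[_ h]] := sE; last by move: tp; rewrite leNgt h.
  have fin q : 0 < v q s -> 0 <= v q t.
    by move=> qs; rewrite leNgt; apply/negP => h; move: qs; rewrite E vsub_infty // ltNge ltW.
  have [||h|[al [ai hal]]] := @reg_or_rel _ _ _ _ _ Hv t s n w c Hs cF.
  + by move=> q j /fin; exact: min_basis_fin.
  + by move=> q /fin tq; rewrite -xE; have := xr q; rewrite pole_fin // mulr0.
  + exact: h sp.
  + by case: (@no_rel_fin c1 al ai); rewrite -E.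
- move=> p tp; have Hs := local_par_inv Ht.
  have ti : t^-1 != 0 by rewrite invr_eq0.
  have infq q : 0 < v q t^-1 -> v q t < 0 by rewrite (vV Hv) // oppr_gt0.
  (* Regularity of c' j above infinity means that c j has degree at most r - m j; the twisted basis
     t^(- m j) w j and t^(- r) x are regular there. *)
  pose c' j := c j * t^-1 ^ (r%:Z - (m j)%:Z).
  have c'w : \sum_j c' j * (t^-1 ^+ m j * w j) = t^-1 ^+ r * x.
    rewrite xE mulr_sumr; apply: eq_bigr => j _; rewrite /c' expfzDr //.
    have -> : t^-1 ^ (- (m j)%:Z) = (t^-1 ^+ m j)^-1 by rewrite exprnN.
    have tj : t^-1 ^+ m j != 0 by rewrite expf_neq0.
    by rewrite -exprnP; move: (t^-1 ^+ m j) (t^-1 ^+ r) tj => T R tj; field.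
  have [|||h|[al [ai hal]]] := @reg_or_rel _ _ _ _ _ Hv t t^-1 n
      (fun j => t^-1 ^+ m j * w j) c' Hs.
  + by move=> j; rewrite rpredM // rpredXz // rpredV t_rat.
  + move=> q j /infq qt; apply: (vgeMl Hv); rewrite ?expf_neq0 // (vX Hv) // (vV Hv) // sub0r.
    by have := good.2 j q; rewrite pole_infty // mulNr.
  + move=> q /infq qt; rewrite c'w; apply: (vgeMl Hv);
    rewrite ?expf_neq0 // (vX Hv) // (vV Hv) // sub0r.
    by have := xr q; rewrite pole_infty // mulNr.
  + have := h i p; rewrite (vV Hv) // oppr_gt0 => /(_ tp).
    have -> : c i = t ^ (r%:Z - (m i)%:Z) * c' i.
      by rewrite /c' exprz_inv mulrCA -expfzDr // subrr expr0z mulr1.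
    move=> h1; apply: (vgeMl Hv); rewrite ?expfz_neq0 // (vZ Hv) // pole_infty //.
    by rewrite mulrNN subrr.
  + by case: (@no_rel_infty al ai).
by exists q; split=> //; case: sq; lia.
Qed.

(* L(r B) consists of the sums of [q i * w i] with q i a polynomial in t of degree at most
   r - m i. *)
Lemma ell_bound (r N : nat) : (forall i, (m i <= r)%N) ->
  ell_ge iota v (fun p => r%:Z * pole p) N -> (N <= \sum_i (r.+1 - m i))%N.
Proof.
move=> mr [y [Hy yD]]; have Hw := klin_coords Hco good.1.
set cw := (fun x : K => _) in Hw.
have /(@choice _ _)[Q QP] : forall x : 'I_N * 'I_n, exists q, phi (cw (y x.1) 0 x.2) = ev t q /\
  (size q <= r.+1 - m x.2)%N.
  move=> [j i] /=; have [||q [qE sq]] := @coef_bound (y j) r (fun i => phi (cw (y j) 0 i)) _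
    (Hw.2 (y j)) _ i.
  - by move=> l; exact: ktinc_rat.
  - by move=> p; rewrite mulNr; exact: (LD_vge p (yD j)).
  by exists q; split=> //; have := mr i; lia.
pose T : finType := {i : 'I_n & 'I_(r.+1 - m i)}.
pose A : 'M[k]_(N, #|T|) :=
  \matrix_(j, x) (Q (j, tag (enum_val x : T)))`_(tagged (enum_val x : T)).
pose z (x : 'I_#|T|) := t ^+ (tagged (enum_val x : T)) * w (tag (enum_val x : T)).
have := card_tag_ord (fun i => (r.+1 - m i)%N); rewrite -/T => <-.
suff : y =1 lcomb iota A z by exact: klin_bound.
move=> j.
rewrite (Hw.2 (y j)) (eq_bigr (fun i => ev t (Q (j, i)) * w i)) => [|i _]; last first.
  by have [-> _] := QP (j, i).
rewrite (@coef_ev _ _ _ _ (fun i => (r.+1 - m i)%N)); last by move=> i; have [] := QP (j, i).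
rewrite (reindex (@enum_val T T)) /=.
  by apply: eq_bigr => x _; rewrite mxE.
exact: onW_bij (enum_val_bij _).
Qed.

End MinimalBasis.
End MinimalBases.

(** * Traces and the bound for the ramification divisor *)

Section TraceEstimates.
Variables (k : closedFieldType) (K : fieldType) (iota : {rmorphism k -> K}).
Variables (P : choiceType) (v : P -> K -> int) (genus : nat).
Hypothesis char0 : [pchar k] =i pred0.
Hypothesis Hv : forall p, is_dvaluation iota (v p).
Hypothesis Hfin : forall x, x != 0 -> finsupp (fun p => v p x).
Hypothesis Hinj : forall p q, (forall x, x != 0 -> v p x = v q x) -> p = q.
Hypothesis Hg : is_genus iota v genus.
Variable t : K.
Hypothesis Ht : ktranscendental iota t.
Variables (n : nat) (e : 'I_n -> K) (co : K -> 'rV[ktfield iota t]_n).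
Hypothesis Hco : coords (ktinc iota t) e co.

Notation vge := (vge v). Notation ev := (ev iota). Notation in_rat := (in_rat iota).
Notation phi := (ktinc iota t). Notation local_par := (local_par iota t).
Notation good_basis := (@good_basis k K iota P v t n). Notation pole := (pole v t).
Notation tr := (trF e co).

Let t0 : t != 0 := trans_neq0 Ht.

(** A choice of parameter below each place, so that [v p (s p)] is the ramification index at p. *)
Definition place_par (s : P -> K) := forall p, [/\ local_par (s p), 0 < v p (s p) &
  (exists c, s p = t - iota c) \/ (s p = t^-1 /\ v p t < 0)].

Lemma place_par_ex : exists s, place_par s.
Proof. exact: (choice _ (local_par_ex Hv Ht Hco)). Qed.

Lemma place_par_fin s p : place_par s -> 0 <= v p t -> exists c, s p = t - iota c.
Proof. by move=> sP tp; have [_ _ [//|[_ h]]] := sP p; move: tp; rewrite leNgt h. Qed.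

Lemma place_par_infty s p : place_par s -> v p t < 0 -> s p = t^-1.
Proof.
move=> sP tp; have [_ sp [[c E]|[//]]] := sP p.
by move: sp; rewrite E vsub_infty // ltNge ltW.
Qed.

Lemma place_par_uniq s p q : place_par s -> 0 <= v p t -> 0 < v q (s p) -> s q = s p.
Proof.
move=> sP tp qs; have [c E] := place_par_fin sP tp.
have tq : 0 <= v q t by rewrite leNgt; apply/negP => h; move: qs; rewrite E vsub_infty // ltNge ltW.
have [c' E'] := place_par_fin sP tq.
have [_ qs' _] := sP q; suff cE : c' = c by rewrite E E' cE.
apply/eqP; rewrite -subr_eq0; apply/negPn/negP => cc.
have : vge q 1 (iota (c' - c)).
  have -> : iota (c' - c) = (t - iota c) - (t - iota c') by rewrite rmorphB; ring.
  by apply: (vgeB Hv); rewrite -?E -?E'; apply: vgeI; rewrite -gtz0_ge1.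
by rewrite vgeE ?fmorph_eq0 // (vC Hv).
Qed.

Lemma trF_iota a x : phi (tr (iota a * x)) = iota a * phi (tr x).
Proof.
have [b bE] : exists b, phi b = iota a by apply: ktincP; have := ev_rat iota t a%:P; rewrite evC.
by rewrite -bE (trFZ Hco) rmorphM.
Qed.

Lemma tr1_neq0 : tr 1 != 0.
Proof.
rewrite (trF1 Hco) -(fmorph_eq0 phi) rmorph_nat -(rmorph_nat iota) fmorph_eq0.
by move/pcharf0P: char0 => ->; rewrite -lt0n; exact: n_gt0 Hco.
Qed.

Section TraceBound.
Variables (w : 'I_n -> K) (m : 'I_n -> nat).
Hypothesis good : good_basis w m.
Variables (s : P -> K) (T : seq P) (r : nat).
Hypothesis sP : place_par s.
(** The ramification divisor cut down to a finite list T, as its support is not known beforehand to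
    be finite. *)
Let R p : int := if p \in T then v p (s p) - 1 else 0.
Let D p := r%:Z * pole p + R p.

(** With e the ramification index, y w_i has order at least 1 - e at finite places and at least 1 -
    (r + m i + 1) e above infinity; [trace_reg] with a = -1 and a = -(r + m i + 1) makes the trace a
    polynomial of degree at most r + m i. *)
Lemma tr_poly y i : in_LD v D y ->
  exists q, phi (tr (y * w i)) = ev t q /\ (size q <= r + m i + 1)%N.
Proof.
move=> yD; have Rle p : R p <= v p (s p) - 1.
  by rewrite /R; case: ifP => // _; have [_ + _] := sP p; rewrite subr_ge0 -gtz0_ge1.
have [|||q [qE sq]] := poly_of_reg Hv Hfin Hinj Hg Ht Hco (c := phi (tr (y * w i)))
    (d := r%:Z + (m i)%:Z).
- exact: ktinc_rat.
- move=> p tp; have [Hs ps _] := sP p.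
  have := trace_reg Hv Hfin Hinj Hg Ht Hco (s := s p) (z := y * w i) (a := -1) Hs.
  move=> h; suff H : forall q, 0 < v q (s p) -> vge q (1 + -1 * v q (s p)) (y * w i).
    by have := h H p ps; rewrite addNr mul0r.
  move=> q qs; have sq := place_par_uniq sP tp qs.
  have tq : 0 <= v q t.
    rewrite leNgt; apply/negP => h'; have [c E] := place_par_fin sP tp.
    by move: qs; rewrite E vsub_infty // ltNge ltW.
  have hw := min_basis_fin good i tq; rewrite -[X in vge _ X _]addr0; apply: (vgeM Hv) => //.
  refine (vge_w (LD_vge q yD) _); rewrite /D pole_fin // mulr0 add0r.
  by have := Rle q; rewrite sq; lia.
- move=> p tp; have Hs := local_par_inv Ht.
  have := trace_reg Hv Hfin Hinj Hg Ht Hco (s := t^-1) (z := y * w i)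
    (a := - (r%:Z + (m i)%:Z + 1)) Hs.
  move=> h; have ps : 0 < v p t^-1 by rewrite (vV Hv) // oppr_gt0.
  suff H : forall q, 0 < v q t^-1 -> vge q (1 + - (r%:Z + (m i)%:Z + 1) * v q t^-1) (y * w i).
    by have := h H p ps; rewrite (pole_infty tp) -(vV Hv) // opprD addrNK.
  move=> q qs.
  have tq : v q t < 0 by move: qs; rewrite (vV Hv) // oppr_gt0.
  have -> : 1 + - (r%:Z + (m i)%:Z + 1) * v q t^-1 = (- D q + (R q - v q (s q) + 1)) - (m i)%:Z *
    pole q.
    by rewrite (place_par_infty sP tq) /D (pole_infty tq) (vV Hv) //; ring.
  apply: (vgeM Hv); last by rewrite -mulNr; exact: good.2.
  by refine (vge_w (LD_vge q yD) _); have := Rle q; lia.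
by exists q; split=> //; case: sq; lia.
Qed.

(* y is determined by the polynomials Tr (y w_i), whose degrees are bounded by r + m i. *)
Lemma ell_bound_trace N : ell_ge iota v D N -> (N <= \sum_i (r + m i + 1))%N.
Proof.
move=> [y [Hy yD]].
have /(@choice _ _)[Q QP] : forall x : 'I_N * 'I_n, exists q,
    phi (tr (y x.1 * w x.2)) = ev t q /\ (size q <= r + m x.2 + 1)%N.
  by move=> [j i]; exact: tr_poly.
pose Ty : finType := {i : 'I_n & 'I_(r + m i + 1)}.
pose A : 'M[k]_(N, #|Ty|) :=
  \matrix_(j, x) (Q (j, tag (enum_val x : Ty)))`_(tagged (enum_val x : Ty)).
have := card_tag_ord (fun i => (r + m i + 1)%N); rewrite -/Ty => <-.
suff /eqP <- : row_free A by exact: rank_leq_col.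
apply: inj_row_free => la la0.
pose y' := lcomb iota la y 0.
have tr0 i : tr (y' * w i) = 0.
  apply: (fmorph_inj phi); rewrite rmorph0 mulr_suml (trF_sum Hco) rmorph_sum.
  pose q := \sum_j la 0 j *: Q (j, i).
  have q0 : ev t q = 0.
    suff -> : q = 0 by rewrite ev0.
    apply/polyP => l; rewrite coef0 coef_sum.
    have [h|h] := ltnP l (r + m i + 1); last first.
      apply: big1 => j _; rewrite coefZ nth_default ?mulr0 //.
      by apply: leq_trans h; have [] := QP (j, i).
    have := congr1 (fun B : 'rV_#|Ty| => B 0
      (enum_rank (Tagged (fun i => 'I_(r + m i + 1)) (Ordinal h) : Ty))) la0.
    rewrite [LHS]mxE [RHS]mxE => E; apply: etrans E; apply: eq_bigr => j _.
    by rewrite mxE enum_rankK coefZ.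
  rewrite -[RHS]q0 /q (big_morph (ev t) (evD iota t) (ev0 iota t)); apply: eq_bigr => j _.
  by rewrite evZ -mulrA trF_iota; have [-> _] := QP (j, i).
suff y'0 : y' = 0 by move/klin_indepP: Hy; apply.
(* Nondegeneracy of the trace form: expanding 1 / y' in the basis w would give Tr 1 = 0, while Tr 1
   = n is nonzero in characteristic 0. *)
apply/eqP/negPn/negP => y'0; case/eqP: tr1_neq0.
have Hw := klin_coords Hco good.1.
rewrite -(divff y'0) (Hw.2 y'^-1) mulr_sumr (trF_sum Hco) big1 // => i _.
by rewrite mulrCA (trFZ Hco) tr0 mulr0.
Qed.
End TraceBound.

(* For large r, the lower bound of Riemann against [ell_bound] bounds the sum of the m i by
   n + g - 1, and against [ell_bound_trace] bounds the degree of the ramification divisor by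
   n + g - 1 plus that sum. *)
Lemma ramification_bound s : place_par s -> forall T, uniq T ->
  \sum_(p <- T) (v p (s p) - 1) <= 2 * n%:Z + 2 * genus%:Z - 2.
Proof.
move=> sP T uT; have [lo _] := Hg.
have [w [m [good minimal]]] := min_basis_ex Hv Hfin Ht Hco.
have fp := fin_pole Hfin Ht; have dp := deg_pole Hv Hfin Hinj Hg Ht Hco.
(* Large enough to exceed every m i and to make r n + 1 - g nonnegative, hence a possible
   dimension. *)
pose r := (\sum_i m i + genus)%N.
have mr i : (m i <= r)%N by rewrite /r (bigD1 i) //= -addnA leq_addr.
have n0 := n_gt0 Hco.
have h1 : r%:Z * n%:Z + 1 - genus%:Z <= n%:Z * (r%:Z + 1) - (\sum_i m i)%N%:Z.
  have f1 : finsupp (fun p => r%:Z * pole p) by exact: finsuppM.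
  have d1 : deg_div (fun p => r%:Z * pole p) = r%:Z * n%:Z by rewrite /deg_div fsumM // dp.
  have pos : 0 <= r%:Z * n%:Z + 1 - genus%:Z by move: n0; rewrite /r; nia.
  have := lo _ f1 (absz (r%:Z * n%:Z + 1 - genus%:Z)%R); rewrite d1 gez0_abs // => /(_ (lexx _)).
  move=> /(ell_bound Hv Hfin Hinj Hg Ht Hco good minimal mr).
  have -> : (\sum_i (r.+1 - m i))%N = (n * r.+1 - \sum_i m i)%N.
    have E : (\sum_i (r.+1 - m i) + \sum_i m i)%N = (n * r.+1)%N.
      rewrite -big_split /= (eq_bigr (fun=> r.+1)) => [|i _];
        first by rewrite sum_nat_const card_ord.
      by rewrite subnK // ltnW // ltnS.
    by rewrite -E addnK.
  have : (\sum_i m i <= n * r.+1)%N.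
    apply: (@leq_trans (\sum_(i < n) r.+1)%N); first by apply: leq_sum => i _; rewrite ltnW // ltnS.
    by rewrite sum_nat_const card_ord.
  move: pos; move: (r%:Z * n%:Z + 1 - genus%:Z) (\sum_i m i)%N => z S; lia.
pose R p : int := if p \in T then v p (s p) - 1 else 0.
have fR : finsupp R by exists T => p; rewrite /R; case: ifP.
have dR : fsum R = \sum_(p <- T) (v p (s p) - 1).
  rewrite (fsumE uT) => [|p]; last by rewrite /R; case: ifP.
  by rewrite big_seq [RHS]big_seq; apply: eq_bigr => p pT; rewrite /R pT.
have h2 : r%:Z * n%:Z + fsum R + 1 - genus%:Z <= n%:Z * (r%:Z + 1) + (\sum_i m i)%N%:Z.
  have [pos|neg] := lerP 0 (r%:Z * n%:Z + fsum R + 1 - genus%:Z); last first.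
    apply: le_trans (ltW neg) _; by rewrite addr_ge0 // mulr_ge0.
  have f1 : finsupp (fun p => r%:Z * pole p + R p) by apply: finsuppD => //; exact: finsuppM.
  have d1 : deg_div (fun p => r%:Z * pole p + R p) = r%:Z * n%:Z + fsum R.
    by rewrite /deg_div fsumD ?fsumM ?dp //; exact: finsuppM.
  have := lo _ f1 (absz (r%:Z * n%:Z + fsum R + 1 - genus%:Z)%R);
    rewrite d1 gez0_abs // => /(_ (lexx _)).
  move=> /(ell_bound_trace good sP).
  have -> : (\sum_i (r + m i + 1))%N = (n * r.+1 + \sum_i m i)%N.
    rewrite (eq_bigr (fun i => r.+1 + m i)%N) => [|i _]; last by lia.
    by rewrite big_split /= sum_nat_const card_ord.
  move: pos; move: (r%:Z * n%:Z + fsum R + 1 - genus%:Z) (\sum_i m i)%N => z S; lia.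
rewrite -dR; lia.
Qed.

End TraceEstimates.

(** * Derivations and Wronskians *)

Section ExtendDerivation.
Variables (F K : fieldType) (phi : {rmorphism F -> K}).
Variables (d : F -> K) (th eta : K).
Hypothesis dD : forall a b, d (a + b) = d a + d b.
Hypothesis dM : forall a b, d (a * b) = phi a * d b + phi b * d a.
Implicit Types (f g : {poly F}).

Notation "f ^@" := ((map_poly phi f).[th]) (at level 2, format "f ^@").

Let d0 : d 0 = 0.
Proof. by apply: (addrI (d 0)); rewrite -dD !addr0. Qed.

(** The part of D(f(th)) that comes from the coefficients; the other part is f'(th) D(th), with eta
    in the place of D(th). *)
Definition pder f : K := \sum_(i < size f) d f`_i * th ^+ i.

Lemma pder_wide f m : (size f <= m)%N -> pder f = \sum_(i < m) d f`_i * th ^+ i.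
Proof.
move=> h; rewrite /pder (big_ord_widen _ (fun i => d f`_i * th ^+ i) h) big_mkcond.
apply: eq_bigr => i _; case: ifPn => //; rewrite -leqNgt => h'.
by rewrite nth_default ?d0 ?mul0r.
Qed.

Lemma pderD f g : pder (f + g) = pder f + pder g.
Proof.
pose m := maxn (size f) (size g).
rewrite (@pder_wide f m) ?leq_maxl // (@pder_wide g m) ?leq_maxr //.
rewrite (@pder_wide (f + g) m) ?size_polyD // -big_split.
by apply: eq_bigr => i _; rewrite coefD dD mulrDl.
Qed.

Lemma pderMX f : pder (f * 'X) = pder f * th.
Proof.
rewrite (@pder_wide (f * 'X) (size f).+1); last first.
  by apply: leq_trans (size_polyMleq _ _) _; rewrite size_polyX addn2.
rewrite big_ord_recl coefMX /= d0 mul0r add0r mulr_suml; apply: eq_bigr => i _.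
by rewrite coefMX /= exprSr mulrA.
Qed.

Lemma pderZ c f : pder (c *: f) = phi c * pder f + d c * f^@.
Proof.
rewrite (@pder_wide _ (size f)) ?size_scale_leq // horner_coef size_map_poly !mulr_sumr -big_split.
by apply: eq_bigr => i _; rewrite coefZ coef_map /= dM; ring.
Qed.

Lemma pderM f g : pder (f * g) = f^@ * pder g + g^@ * pder f.
Proof.
elim/poly_ind: f => [|f c IH].
  by rewrite mul0r rmorph0 horner0 mul0r /pder size_poly0 !big_ord0 mulr0 addr0.
have -> : (f * 'X + c%:P) * g = (f * g) * 'X + c *: g by rewrite -mul_polyC; ring.
rewrite pderD pderMX IH pderZ -[c%:P]mulr1 mul_polyC pderD pderMX pderZ.
have -> : (f * 'X + c *: 1)^@ = f^@ * th + phi c.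
  by rewrite rmorphD rmorphM /= map_polyX map_polyZ /= rmorph1 !hornerE.
have -> : (1 : {poly F})^@ = 1 by rewrite rmorph1 hornerC.
have -> : pder 1 = 0.
  rewrite /pder size_poly1 big_ord1 coefC /=.
  have : d (1 * 1) = d 1 + d 1 by rewrite dM rmorph1 !mul1r.
  by rewrite mulr1 => /eqP; rewrite -subr_eq0 opprD addNKr oppr_eq0 => /eqP->; rewrite mul0r.
ring.
Qed.

Variable p : {poly F}.
Hypothesis p0 : p^@ = 0.
Hypothesis pmin : forall f, f^@ = 0 -> exists h, f = p * h.
Hypothesis peta : pder p + (p^`())^@ * eta = 0.
Hypothesis gen : forall x, exists f, f^@ = x.

(** Define D(f(th)) as [E f]. Polynomials with equal value at th differ by a multiple of p, and [E]
    vanishes on multiples of p because p(th) = 0 and eta is chosen to make [E p] zero. *)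
Lemma extend_derivation : exists D : K -> K,
  [/\ forall x y, D (x + y) = D x + D y,
      forall x y, D (x * y) = x * D y + y * D x &
      forall a, D (phi a) = d a].
Proof.
pose E f := pder f + (f^`())^@ * eta.
have ED f g : E (f + g) = E f + E g.
  by rewrite /E pderD derivD rmorphD hornerD; ring.
have EM f g : E (f * g) = f^@ * E g + g^@ * E f.
  by rewrite /E pderM derivM rmorphD !rmorphM hornerD !hornerM; ring.
have Ewd f g : f^@ = g^@ -> E f = E g.
  move=> fg; have [h fE] : exists h, f - g = p * h by apply: pmin;
    rewrite rmorphB hornerD hornerN fg subrr.
  by rewrite -(subrK g f) fE ED EM p0 mul0r add0r /E peta mulr0 add0r.
have [r rP] := choice _ gen.
exists (fun x => E (r x)); split=> [x y|x y|a].
- by rewrite -ED; apply: Ewd; rewrite rmorphD hornerD !rP.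
- rewrite (@Ewd _ (r x * r y)); first by rewrite EM !rP.
  by rewrite rmorphM hornerM !rP.
rewrite (@Ewd _ a%:P); last by rewrite rP map_polyC hornerC.
rewrite /E derivC rmorph0 horner0 mul0r addr0 (@pder_wide _ 1) ?size_polyC ?leq_b1 //.
by rewrite big_ord1 coefC mulr1.
Qed.

End ExtendDerivation.

Section PrimitiveElement.
Variables (F K : fieldType) (phi : {rmorphism F -> K}).
Hypothesis char0 : [pchar F] =i pred0.
Hypothesis alg : forall x, exists2 p : {poly F}, p != 0 & root (map_poly phi p) x.

Lemma primitive_element (N : nat) (y : 'I_N -> K) : exists th, forall i, exists f,
  (map_poly phi f).[th] = y i.
Proof.
elim: N y => [|N IH] y; first by exists 0; case.
have [th thP] := IH (fun i => y (lift ord0 i)).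
have [p p0 pr] := alg th; have [q q0 qr] := alg (y ord0).
have [m /=[[r rE] [s sE]]] := pchar0_PET p0 pr q0 qr char0.
exists (y ord0 *+ m - th) => i; case: (unliftP ord0 i) => [j ->|->]; last by exists s.
have [f <-] := thP j; exists (f \Po r).
by rewrite map_comp_poly horner_comp rE.
Qed.

Lemma minimal_poly x : exists p : {poly F}, [/\ p != 0, root (map_poly phi p) x &
  forall f, (map_poly phi f).[x] = 0 -> exists h, f = p * h].
Proof.
have [p0 p0n p0r] := alg x.
suff H N : (exists p : {poly F}, [/\ p != 0, root (map_poly phi p) x & (size p <= N)%N]) ->
  exists p : {poly F}, [/\ p != 0, root (map_poly phi p) x &
    forall f, (map_poly phi f).[x] = 0 -> exists h, f = p * h].
  by apply: (H (size p0)); exists p0.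
elim: N => [|N IH] [p [pn pr sp]].
  by move: pn; rewrite -size_poly_eq0 -leqn0 sp.
have [h|h] := classic (exists p : {poly F}, [/\ p != 0, root (map_poly phi p) x & (size p <= N)%N]).
  exact: IH.
exists p; split=> // f fx; exists (f %/ p).
rewrite {1}(divp_eq f p) mulrC -[RHS]addr0; congr (_ + _); apply/eqP/negPn/negP => m0.
apply: h; exists (f %% p); split=> //; last first.
  by have := ltn_modp f p; rewrite pn => lt; have := leq_trans lt sp; rewrite ltnS.
have : (map_poly phi (f %/ p * p + f %% p)).[x] = 0 by rewrite -divp_eq.
by rewrite rmorphD rmorphM hornerD hornerM (rootP pr) mulr0 add0r => /eqP.
Qed.

End PrimitiveElement.

Section Derivation.
Variables (k : closedFieldType) (K : fieldType) (iota : {rmorphism k -> K}).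
Hypothesis char0 : [pchar k] =i pred0.
Variable t : K.
Hypothesis Ht : ktranscendental iota t.
Variables (n : nat) (e : 'I_n -> K) (co : K -> 'rV[ktfield iota t]_n).
Hypothesis Hco : coords (ktinc iota t) e co.
Notation ev := (ev iota). Notation in_rat := (in_rat iota).
Notation phi := (ktinc iota t).

(** The quotient rule on a chosen fraction; [wd] shows that any other fraction gives the same value,
    since t is transcendental. *)
Lemma rational_derivation : exists d : ktfield iota t -> K,
  [/\ forall a b, d (a + b) = d a + d b,
      forall a b, d (a * b) = phi a * d b + phi b * d a,
      forall c, phi c = t -> d c = 1 &
      forall c a, phi c = iota a -> d c = 0].
Proof.
have /(@choice _ _)[r rP] : forall c : ktfield iota t, exists x : {poly k} * {poly k},
    ev t x.2 != 0 /\ phi c * ev t x.2 = ev t x.1.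
  by move=> c; have /in_ratP[p [q [q0 ->]]] := ktinc_rat c; exists (p, q); rewrite divfK.
pose d c := (ev t (r c).1^`() - phi c * ev t (r c).2^`()) / ev t (r c).2.
have wd c p q : ev t q != 0 -> phi c * ev t q = ev t p ->
    d c = (ev t p^`() - phi c * ev t q^`()) / ev t q.
  move=> q0 E; have [r0 rE] := rP c; rewrite /d.
  have : (r c).1 * q = p * (r c).2.
    apply/eqP; rewrite -subr_eq0; apply/eqP/Ht; rewrite -/(ev t _) evB !evM -rE -E; ring.
  move/(congr1 (fun f : {poly k} => ev t f^`())); rewrite !derivM !evD !evM -rE -E.
  move: (ev t (r c).2) (ev t q) (ev t (r c).1^`()) (ev t (r c).2^`()) (ev t p^`()) (ev t q^`())
    (phi c) r0 q0.
  move=> B C A' B' p' q' c' r0 q0 h; apply/eqP; rewrite eqr_div //; apply/eqP.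
  rewrite !mulrBl; apply/eqP; rewrite subr_eq -addrA; apply/eqP.
  have -> : A' * C = p' * B + c' * C * B' - c' * B * q' by rewrite -h; ring.
  by ring.
exists d; split=> [a b|a b|c ct|c a ca].
- have [a0 aE] := rP a; have [b0 bE] := rP b.
  rewrite (wd (a + b) ((r a).1 * (r b).2 + (r b).1 * (r a).2) ((r a).2 * (r b).2)).
  + by rewrite /d !(derivD, derivM) !(evD, evM) rmorphD -aE -bE; field; rewrite a0 b0.
  + by rewrite evM mulf_neq0.
  by rewrite !(evD, evM) rmorphD -aE -bE; ring.
- have [a0 aE] := rP a; have [b0 bE] := rP b.
  rewrite (wd (a * b) ((r a).1 * (r b).1) ((r a).2 * (r b).2)).
  + by rewrite /d !derivM !(evD, evM) rmorphM -aE -bE; field; rewrite a0 b0.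
  + by rewrite evM mulf_neq0.
  by rewrite !evM rmorphM -aE -bE; ring.
- rewrite (wd c 'X 1); rewrite ?ev1 ?oner_neq0 //.
    by rewrite derivX derivC ev1 ev0 mulr0 subr0 divr1.
  by rewrite mulr1 evX ct.
- rewrite (wd c a%:P 1); rewrite ?ev1 ?oner_neq0 //.
    by rewrite !derivC ev0 mulr0 subr0 mul0r.
  by rewrite mulr1 evC ca.
Qed.

Lemma char0_ktfield : [pchar (ktfield iota t)] =i pred0.
Proof.
apply/pcharf0P => m; rewrite -(fmorph_eq0 phi) rmorph_nat -(rmorph_nat iota) fmorph_eq0.
by move: m; apply/pcharf0P.
Qed.

Lemma algebraic_over_kt x : exists2 p : {poly (ktfield iota t)}, p != 0 & root (map_poly phi p) x.
Proof.
have /not_all_ex_not[c H] : ~ klin_indep phi (fun i : 'I_n.+1 => x ^+ i).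
  by move=> /(klin_le Hco); rewrite ltnn.
have [c0 /not_all_ex_not[i /eqP ci]] := imply_to_and _ _ H.
exists (\poly_(j < n.+1) c (inord j)).
  apply: contraNneq ci => /(congr1 (fun q : {poly _} => q`_i)).
  by rewrite coef_poly ltn_ord coef0 inord_val => ->.
apply/rootP; rewrite (@horner_coef_wide _ n.+1); last first.
  by rewrite size_map_poly size_poly.
by rewrite -[RHS]c0; apply: eq_bigr => j _; rewrite coef_map coef_poly ltn_ord inord_val.
Qed.

Definition derivation (D : K -> K) : Prop :=
  [/\ forall x y, D (x + y) = D x + D y, forall x y, D (x * y) = x * D y + y * D x
    & forall c, D (iota c) = 0].

(** Extension of d/dt to K = k(t)(th). The value of D at th is forced to be - p^d(th) / p'(th), p
    being the minimal polynomial and p^d having differentiated coefficients. *)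
Lemma derivation_ex : exists D, derivation D /\ D t = 1.
Proof.
have [d [dD dM dt dC]] := rational_derivation.
have [th thP] := primitive_element char0_ktfield algebraic_over_kt e.
have [p [p0 pr pmin]] := minimal_poly algebraic_over_kt th.
have gen x : exists f, (map_poly phi f).[th] = x.
  have [f fP] := choice _ thP; exists (\sum_i co x 0 i *: f i).
  have hZ a (g : {poly ktfield iota t}) : (map_poly phi (a *: g)).[th] = phi a *
    (map_poly phi g).[th].
    by rewrite map_polyZ hornerZ.
  have hD (g h : {poly ktfield iota t}) : (map_poly phi (g + h)).[th] = (map_poly phi g).[th] +
    (map_poly phi h).[th].
    by rewrite rmorphD hornerD.
  have h0 : (map_poly phi 0).[th] = 0 by rewrite rmorph0 horner0.
  rewrite {2}(Hco.2 x) (big_morph (fun g => (map_poly phi g).[th]) hD h0).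
  by apply: eq_bigr => i _; rewrite hZ fP.
(* Separability: in characteristic 0 the derivative is nonzero and of smaller degree, so p does not
   divide it. *)
have p'0 : (map_poly phi p^`()).[th] != 0.
  apply/eqP => h; have [q qE] := pmin _ h.
  have sp : (1 < size p)%N.
    rewrite ltnNge; apply/negP => /size1_polyC pc; move: pr; rewrite pc map_polyC rootC fmorph_eq0.
    by move=> c0; move: p0; rewrite pc polyC_eq0 c0.
  have dp : p^`() != 0.
    apply/eqP => /(congr1 (fun q : {poly _} => q`_(size p).-2)); rewrite coef_deriv coef0.
    rewrite prednK -?subn1 ?subn_gt0 // subn1 -lead_coefE => /eqP.
    have /pcharf0P char := char0_ktfield.
    by rewrite -mulr_natr mulf_eq0 lead_coef_eq0 (negPf p0) char; case: (size p) sp => [|[]].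
  have q0 : q != 0 by apply: contraNneq dp => q0; rewrite qE q0 mulr0.
  have := lt_size_deriv p0; rewrite qE size_mul // ltnNge => /negP; apply.
  by move: q0; rewrite -size_poly_gt0; case: (size q) => // m _; rewrite addnS leq_addr.
pose eta := - pder d th p / (map_poly phi p^`()).[th].
have [||||D [DD DM DE]] := @extend_derivation _ _ phi d th eta dD dM p.
- exact/rootP.
- exact: pmin.
- by rewrite /eta mulrC divfK // subrr.
- exact: gen.
exists D; split; first split=> // c.
  have [a aE] : exists a, phi a = iota c by apply: ktincP; have := ev_rat iota t c%:P; rewrite evC.
  by rewrite -aE DE; exact: dC aE.
have [a aE] : exists a, phi a = t by apply: ktincP; have := ev_rat iota t 'X; rewrite evX.
by rewrite -aE DE; exact: dt.
Qed.

End Derivation.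

(** * Orders of derivatives and the degree of dt *)

Section LocalDerivation.
Variables (k : closedFieldType) (K : fieldType) (iota : {rmorphism k -> K}).
Variables (P : choiceType) (v : P -> K -> int) (genus : nat).
Hypothesis char0 : [pchar k] =i pred0.
Hypothesis Hv : forall p, is_dvaluation iota (v p).
Hypothesis Hfin : forall x, x != 0 -> finsupp (fun p => v p x).
Hypothesis Hinj : forall p q, (forall x, x != 0 -> v p x = v q x) -> p = q.
Hypothesis Hg : is_genus iota v genus.
Variable t : K.
Hypothesis Ht : ktranscendental iota t.
Variables (n : nat) (e : 'I_n -> K) (co : K -> 'rV[ktfield iota t]_n).
Hypothesis Hco : coords (ktinc iota t) e co.
Variable D : K -> K.
Hypothesis HD : derivation iota D.
Hypothesis Dt : D t = 1.

Notation vge := (vge v). Notation ev := (ev iota). Notation in_rat := (in_rat iota).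
Notation phi := (ktinc iota t). Notation local_par := (local_par iota t).

Let t0 : t != 0 := trans_neq0 Ht.

Lemma derD x y : D (x + y) = D x + D y. Proof. by have [h _ _] := HD; exact: h. Qed.
Lemma derM x y : D (x * y) = x * D y + y * D x. Proof. by have [_ h _] := HD; exact: h. Qed.
Lemma derC c : D (iota c) = 0. Proof. by have [_ _ h] := HD; exact: h. Qed.
Lemma der0 : D 0 = 0. Proof. by rewrite -{1}(rmorph0 iota) derC. Qed.
Lemma der1 : D 1 = 0. Proof. by rewrite -(rmorph1 iota) derC. Qed.
Lemma derN x : D (- x) = - D x.
Proof. by apply/eqP; rewrite -addr_eq0 -derD addNr der0. Qed.
Lemma derB x y : D (x - y) = D x - D y. Proof. by rewrite derD derN. Qed.
Lemma der_sum (I : Type) (r : seq I) Q (f : I -> K) :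
  D (\sum_(i <- r | Q i) f i) = \sum_(i <- r | Q i) D (f i).
Proof. exact: (big_morph D derD der0). Qed.
Lemma derX x m : D (x ^+ m.+1) = m.+1%:R * x ^+ m * D x.
Proof.
elim: m => [|m IH]; first by rewrite expr1 expr0 !mul1r.
rewrite exprS derM IH -[in RHS]addn1 natrD (exprS x m); ring.
Qed.
Lemma derV x : x != 0 -> D x^-1 = - (D x / x ^+ 2).
Proof.
move=> x0; have : D (x * x^-1) = 0 by rewrite divff // der1.
by rewrite derM => /eqP; rewrite addr_eq0 => /eqP h; apply: (mulfI x0); rewrite h; field.
Qed.
Lemma der_ev x (q : {poly k}) : D (ev x q) = ev x q^`() * D x.
Proof.
elim/poly_ind: q => [|q c IH]; first by rewrite deriv0 ev0 der0 mul0r.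
rewrite derivD derivM derivX derivC addr0 mulr1 !evD !evM evX evC derD derC addr0 derM IH.
ring.
Qed.

(** Inside k(t) = k(s) the chain rule gives D c = (dc/ds) D s, and dc/ds is regular where c is. *)
Lemma der_rat s c p : local_par s -> c \in in_rat t -> 0 < v p s -> vge p 0 c ->
  vge p (v p (D s)) (D c).
Proof.
move=> [Hs ts _] cF ps c0; have [->|cn0] := eqVneq c 0; first by rewrite der0 vge0.
have s0 := trans_neq0 Hs.
have [a [A [B [hA hB cE]]]] := rat_local (in_rat_trans ts cF) Hs cn0.
have [A0 vA] := v_ev0 Hv ps hA; have [B0 vB] := v_ev0 Hv ps hB.
have a0 : 0 <= a.
  move: c0; rewrite vgeE // cE (vM Hv) ?expfz_neq0 ?mulf_neq0 ?invr_eq0 // (vZ Hv) //.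
  by rewrite (vM Hv) ?invr_eq0 // (vV Hv) // vA vB subrr addr0; move: (v p s) ps => w; nia.
case: a a0 cE => // a _ cE.
have vs0 : vge p 0 s by rewrite vgeE // ltW.
have -> : D c = (ev s ('X^a * A)^`() - c * ev s B^`()) / ev s B * D s.
  have E : c * ev s B = ev s ('X^a * A) by rewrite cE evM evXn evX -exprnP; field.
  have := congr1 D E; rewrite derM !der_ev => E2.
  apply: (mulfI B0); rewrite [LHS](_ : _ = ev s ('X^a * A)^`() * D s - c * (ev s B^`() * D s)).
    by field.
  by rewrite -E2; ring.
rewrite -[v p (D s)]add0r; apply: (vgeM Hv); last exact: vge_refl.
rewrite -[0]addr0; apply: (vgeM Hv); last by rewrite vgeE ?invr_eq0 // (vV Hv) // vB.
apply: (vgeB Hv); first exact: (vge_ev Hv).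
by rewrite -[0]addr0; apply: (vgeM Hv) => //; exact: (vge_ev Hv).
Qed.

(** If y is regular at all zeros of s, expand it in an integral basis and use [der_rat]. If it is
    regular at p only, take x a unit at p vanishing enough at the other zeros, and use D y = (D(x y)
    - y D x) / x. *)
Lemma der_bounded s p : local_par s -> 0 < v p s ->
  exists c : int, forall y, vge p 0 y -> vge p c (D y).
Proof.
move=> Hs ps; have [Hs1 _ _] := Hs; have s0 := trans_neq0 Hs1.
have [u [pt [ex [_ uind u0 _ ureg]]]] := adapted_basis Hv Hfin Hinj Hg Ht Hco Hs.
have [T [uT aT _]] := finsupp_common (Hfin s0) (Hfin s0).
have [c [hc c1]] : exists c : int, (forall i, vge p c (D (u i))) /\ c <= v p (D s).
  exists (- (\sum_i `|v p (D (u i))|) - `|v p (D s)|); split=> [i|]; last first.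
    have : 0 <= \sum_i `|v p (D (u i))| by apply: sumr_ge0.
    by move: (\sum_i _) (v p (D s)) => S w; lia.
  refine (vge_w (vge_refl v p _) _); rewrite (bigD1 i) //=.
  have : 0 <= \sum_(j < n | j != i) `|v p (D (u j))| by apply: sumr_ge0.
  move: (\sum_(_ < _ | _) _) (v p (D s)) (v p _) => S w z; lia.
have reg y : (forall q, 0 < v q s -> vge q 0 y) -> vge p c (D y).
  move=> hy; have Hu := klin_coords Hco uind.
  set cu := (fun x : K => _) in Hu; rewrite (Hu.2 y) der_sum; apply: (vge_sum Hv) => i _.
  have ci : vge p 0 (phi (cu y 0 i)).
    apply: (ureg (fun i => phi (cu y 0 i))) => [j|q qs|//]; first exact: ktinc_rat.
    by rewrite -(Hu.2 y); exact: hy.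
  rewrite derM; apply: (vgeD Hv).
    by rewrite -[c]add0r; apply: (vgeM Hv).
  rewrite mulrC -[c]addr0; apply: (vgeM Hv); last exact: u0.
  by refine (vge_w (der_rat Hs (ktinc_rat _) ps ci) c1).
exists c => y y0; have [->|yn0] := eqVneq y 0; first by rewrite der0 vge0.
pose Z := [seq q <- T | (0 < v q s) && (q != p)].
have pZ : p \notin Z by rewrite mem_filter eqxx andbF.
have [b bP] := seq_bound Z (fun q => v q y).
have [x [x0 vx hx]] := weak_approximation Hv Hinj 0 b%:Z pZ.
have inZ q : 0 < v q s -> q != p -> q \in Z.
  move=> qs qp; rewrite mem_filter qs qp /=; apply: aT; by rewrite gt_eqF.
have xr : vge p c (D x).
  apply: reg => q qs; rewrite vgeE //; have [->|qp] := eqVneq q p; first by rewrite vx.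
  exact: le_trans (hx q (inZ q qs qp)).
have xyr : vge p c (D (x * y)).
  apply: reg => q qs; have [->|qp] := eqVneq q p.
    by rewrite -[0]add0r; apply: (vgeM Hv) => //; rewrite vgeE // vx.
  rewrite vgeE ?mulf_neq0 // (vM Hv) //.
  have := hx q (inZ q qs qp); have := bP q (inZ q qs qp); lia.
have -> : D y = x^-1 * (D (x * y) - y * D x) by rewrite derM; field.
rewrite -[c]add0r; apply: (vgeM Hv); first by rewrite vgeE ?invr_eq0 // (vV Hv) // vx.
by apply: (vgeB Hv) => //; rewrite -[c]add0r; apply: (vgeM Hv).
Qed.

Let res := residue Hv Ht Hco.

Lemma expansion p x y (M : nat) : x != 0 -> v p x = 1 -> vge p 0 y ->
  exists q z, vge p 0 z /\ y = ev x q + x ^+ M * z.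
Proof.
move=> x0 vx; elim: M y => [|M IH] y y0.
  by exists 0, y; rewrite ev0 add0r expr0 mul1r.
have [c hc] := res y0; have [q [z [z0 E]]] : exists q z, vge p 0 z /\
    (y - iota c) / x = ev x q + x ^+ M * z.
  by apply: IH; rewrite mulrC; apply: (vgeMl Hv); rewrite ?invr_eq0 // (vV Hv) // vx sub0r opprK.
exists (q * 'X + c%:P), z; split=> //.
have -> : y = (y - iota c) / x * x + iota c by field.
by rewrite E evD evM evX evC exprS; ring.
Qed.

(** Expand y in powers of a uniformizer x. By [der_bounded] the derivative of a remote tail is
    negligible, so D y is as regular as D x. Were D x = 0, every D y would vanish to all orders,
    against D s being nonzero. *)
Lemma local_derivation s p : local_par s -> 0 < v p s -> D s != 0 -> exists b : int,
  (forall y, vge p 0 y -> vge p b (D y)) /\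
  exists x, [/\ v p x = 1, x != 0, D x != 0 & v p (D x) = b].
Proof.
move=> Hs ps Ds; have [c hc] := der_bounded Hs ps.
have [_ _ _ [x [x0 vx]]] := Hv p.
have key y (b : int) : vge p 0 y -> vge p b (D x) -> vge p b (D y).
  move=> y0 hx; pose M := (absz b + absz c)%N.
  have [q [z [z0 ->]]] := expansion M.+1 x0 vx y0.
  have xr0 : vge p 0 x by rewrite vgeE // vx.
  have xM m : vge p 0 (x ^+ m) by rewrite vgeE ?expf_neq0 // (vX Hv) // vx mulr1.
  rewrite derD der_ev derM derX; apply: (vgeD Hv).
    by rewrite -[b]add0r; apply: (vgeM Hv) => //; exact: (vge_ev Hv).
  apply: (vgeD Hv).
    have h1 : b <= M.+1%:Z + c by rewrite /M; lia.
    refine (vge_w _ h1); apply: (vgeM Hv); last exact: hc.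
    by rewrite vgeE ?expf_neq0 // (vX Hv) // vx mulr1.
  rewrite mulrA -[b]add0r; apply: (vgeM Hv) => //.
  rewrite -[0]add0r; apply: (vgeM Hv) => //; rewrite -[0]add0r; apply: (vgeM Hv) => //.
  by rewrite -(rmorph_nat iota); exact: (vgeC Hv).
have Dx : D x != 0.
  apply: contraNneq Ds => Dx; apply/eqP; apply: (vge_inf (v := v) (p := p)) => b.
  have [Hs1 _ _] := Hs; have s0 := trans_neq0 Hs1.
  by apply: key; rewrite ?Dx ?vge0 // vgeE ?ltW.
exists (v p (D x)); split; last by exists x.
by move=> y y0; apply: key => //; exact: vge_refl.
Qed.

Lemma natr_neq0 (a : nat) : a != 0%N -> (a%:R : K) != 0.
Proof.
move=> a0; rewrite -(rmorph_nat iota) fmorph_eq0.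
by move/pcharf0P: char0 => ->.
Qed.

Lemma log_order s p : local_par s -> 0 < v p s -> D s != 0 -> exists h : int,
  (forall y, y != 0 -> vge p (v p y + h) (D y)) /\
  (forall y, y != 0 -> v p y != 0 -> D y != 0 /\ v p (D y) = v p y + h).
Proof.
move=> Hs ps Ds; have [b [hb [x [vx x0 Dx Db]]]] := local_derivation Hs ps Ds.
have pos (a : nat) y : y != 0 -> v p y = a%:Z ->
    vge p (a%:Z + (b - 1)) (D y) /\ (a != 0%N -> D y != 0 /\ v p (D y) = a%:Z + (b - 1)).
  move=> y0 vy; case: a vy => [|a] vy.
    split=> //; refine (vge_w (hb y _) _); first by rewrite vgeE // vy.
    lia.
  pose z := y / x ^+ a.+1; have xa0 m : x ^+ m != 0 by rewrite expf_neq0.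
  have z0 : z != 0 by rewrite mulf_neq0 ?invr_eq0.
  have vz : v p z = 0 by rewrite (vM Hv) ?invr_eq0 // (vV Hv) // (vX Hv) // vy vx mulr1 subrr.
  have yE : y = x ^+ a.+1 * z by rewrite mulrC divfK.
  clearbody z.
  have DE : D y = z * (a.+1%:R * x ^+ a * D x) + x ^+ a.+1 * D z.
    by rewrite yE derM derX addrC.
  have an0 : (a.+1%:R : K) != 0 by exact: natr_neq0.
  have t1 : z * (a.+1%:R * x ^+ a * D x) != 0 by rewrite !mulf_neq0 ?xa0.
  have v1 : v p (z * (a.+1%:R * x ^+ a * D x)) = a.+1%:Z + (b - 1).
    rewrite !(vM Hv) ?mulf_neq0 ?xa0 // vz -(rmorph_nat iota) (vC Hv); last first.
      by rewrite -(fmorph_eq0 iota) rmorph_nat.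
    by rewrite (vX Hv) // vx Db; lia.
  have t2 : vge p (a.+1%:Z + b) (x ^+ a.+1 * D z).
    apply: (vgeM Hv); last by apply: hb; rewrite vgeE // vz.
    by rewrite vgeE // (vX Hv) // vx mulr1.
  have [|n0 E] := vge_eq Hv t1 _ t2; first by rewrite v1; lia.
  by rewrite DE; split=> [|_]; [rewrite -[X in vge _ X _]v1 -E; exact: vge_refl|rewrite E v1].
have all y : y != 0 -> vge p (v p y + (b - 1)) (D y) /\
    (v p y != 0 -> D y != 0 /\ v p (D y) = v p y + (b - 1)).
  move=> y0; case E: (v p y) => [a|a].
    by have [h1 h2] := pos a y y0 E.
  have yi0 : y^-1 != 0 by rewrite invr_eq0.
  have vi : v p y^-1 = a.+1%:Z by rewrite (vV Hv) // E.
  have [h1 h2] := pos _ _ yi0 vi; have [D0 vD] := h2 isT.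
  have DE : D y = - (y ^+ 2 * D y^-1) by rewrite derV //; field.
  have n0 : y ^+ 2 * D y^-1 != 0 by rewrite mulf_neq0 // expf_neq0.
  have vE : v p (D y) = Negz a + (b - 1).
    by rewrite DE (vN Hv) (vM Hv) ?expf_neq0 // (vX Hv) // E vD NegzE; lia.
  have Dn : D y != 0 by rewrite DE oppr_eq0.
  by split=> // ; rewrite vgeE // vE.
by exists (b - 1); split=> y y0; have [h1 h2] := all y y0.
Qed.

(* [h p] is the order at p of the operator y |-> D y / y, that is -1 minus the order at p of
   the differential dt, so the last clause says that this differential has degree at
   most 2 g - 2. *)
Lemma log_orders : exists h : P -> int,
  [/\ forall p y, y != 0 -> vge p (v p y + h p) (D y),
      forall p y, y != 0 -> v p y != 0 -> D y != 0 &
      exists T0 : seq P, forall T, uniq T -> {subset T0 <= T} ->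
        \sum_(p <- T) (- 1 - h p) <= 2 * genus%:Z - 2].
Proof.
have [s sP] := place_par_ex Hv Ht Hco.
have Ds p : D (s p) != 0.
  have [_ _ [[c ->]|[-> _]]] := sP p.
    by rewrite derB derC subr0 Dt oner_neq0.
  by rewrite derV // Dt div1r oppr_eq0 invr_eq0 expf_neq0.
have /(@choice _ _)[h hP] : forall p, exists h : int,
  (forall y, y != 0 -> vge p (v p y + h) (D y)) /\
  (forall y, y != 0 -> v p y != 0 -> D y != 0 /\ v p (D y) = v p y + h).
  by move=> p; have [Hs ps _] := sP p; exact: log_order Hs ps (Ds p).
(* Let e be the ramification index. At a finite place D(t - c) = 1 gives h = - e; above infinity D(1
   / t) = - 1 / t^2 gives h = e. So dt has order e - 1, respectively - e - 1. *)
have hE p : - 1 - h p = (v p (s p) - 1) - 2 * pole v t p.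
  have [Hs ps _] := sP p; have s0 : s p != 0 by have [/trans_neq0] := Hs.
  have [_ hp] := hP p; have [_ E] := hp _ s0 (lt0r_neq0 ps).
  have [tp|tp] := ltrP (v p t) 0.
    have sE := place_par_infty Hv Ht sP tp.
    move: E; rewrite sE derV // Dt div1r (vN Hv) (vV Hv) ?expf_neq0 // (vX Hv) // (vV Hv) //
      pole_infty //.
    lia.
  have [c cE] := place_par_fin sP tp; move: E.
  by rewrite {1}cE derB derC subr0 Dt (v1 Hv) pole_fin //; lia.
have [T0 [uT0 aT0 _]] := finsupp_common (fin_pole Hfin Ht) (fin_pole Hfin Ht).
exists h; split.
- by move=> p; have [] := hP p.
- by move=> p y y0 vy; have [_ /(_ y y0 vy) []] := hP p.
exists T0 => T uT sub; rewrite (eq_bigr (fun p => (v p (s p) - 1) - 2 * pole v t p)) => [|p _];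
  last exact: hE.
rewrite sumrB -mulr_sumr.
have <- : fsum (pole v t) = \sum_(p <- T) pole v t p by apply: fsumE => // p /aT0/sub.
rewrite (deg_pole Hv Hfin Hinj Hg Ht Hco).
have := ramification_bound char0 Hv Hfin Hinj Hg Ht Hco sP uT.
move: (\sum_(_ <- _) _) => S; lia.
Qed.

(** Elements killed by D have no zeros or poles. If c is the residue of y at some place, then y - c
    is killed by D and vanishes there, so it is 0. *)
Lemma der_const y : D y = 0 -> exists c, y = iota c.
Proof.
move=> Dy; have [h [_ hn _]] := log_orders.
have [p _] := zero_ex Hv Hfin Hinj Hg Ht Hco (local_par_inv Ht).
have [->|y0] := eqVneq y 0; first by exists 0; rewrite rmorph0.
have nz z : D z = 0 -> z != 0 -> v p z = 0.
  by move=> Dz z0; apply/eqP/negPn/negP => /(hn p z z0); rewrite Dz eqxx.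
have [c hc] : exists c, vge p 1 (y - iota c) by apply: res; rewrite vgeE // nz.
exists c; apply/eqP; rewrite -subr_eq0; apply/negPn/negP => yc.
by move: hc; rewrite vgeE // nz // derB Dy derC subrr.
Qed.

End LocalDerivation.

(** * Wronskians *)

Section Wronskian.
Variables (k K : fieldType) (iota : {rmorphism k -> K}) (D : K -> K).
Hypothesis derD : forall x y, D (x + y) = D x + D y.
Hypothesis derM : forall x y, D (x * y) = x * D y + y * D x.
Hypothesis derC : forall c, D (iota c) = 0.
Hypothesis constants : forall y, D y = 0 -> exists c, y = iota c.

Definition wronskian N (f : 'I_N -> K) : K := \det (\matrix_(j < N, i < N) iter i D (f j)).

Let der0 : D 0 = 0.
Proof. by apply: (addrI (D 0)); rewrite -derD !addr0. Qed.

Let der_sum (I : Type) (r : seq I) (F : I -> K) :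
  D (\sum_(i <- r) F i) = \sum_(i <- r) D (F i).
Proof. exact: (big_morph D derD der0). Qed.

(** Induction on N: in a relation between the rows, normalized by a leading coefficient 1, the
    derivatives of the coefficients solve the smaller system, whose Wronskian is nonzero. The
    coefficients are then constants, against independence. *)
Lemma wronskian_neq0 N (f : 'I_N -> K) : klin_indep iota f -> wronskian f != 0.
Proof.
elim: N f => [|N IH] f Hf; first by rewrite /wronskian det_mx00 oner_neq0.
have Hf' : klin_indep iota (f \o lift ord0) by apply: klin_inj => //; exact: lift_inj.
have W' := IH _ Hf'.
have zero (b : 'I_N -> K) : (forall i : 'I_N, \sum_j b j * iter i D (f (lift ord0 j)) = 0) ->
    forall j, b j = 0.
  move=> h j; apply/eqP/negPn/negP => bj; case/negP: W'; apply/det0P.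
  exists (\row_j b j).
    by apply: contraNneq bj => /rowP/(_ j); rewrite !mxE => ->.
  by apply/rowP => i; rewrite !mxE -[RHS](h i); apply: eq_bigr => l _; rewrite !mxE.
apply/negP => /det0P[c c0 cA].
have E (i : 'I_N.+1) : \sum_j c 0 j * iter i D (f j) = 0.
  have := congr1 (fun x : 'rV_N.+1 => x 0 i) cA; rewrite [RHS]mxE => H; apply: etrans H.
  by rewrite [RHS]mxE; apply: eq_bigr => j _; rewrite mxE.
have cz : c 0 ord0 != 0.
  apply: contraNneq c0 => cz; apply/eqP/rowP => j; rewrite mxE.
  case: (unliftP ord0 j) => [l ->|-> //]; apply: (zero (fun l => c 0 (lift ord0 l))) => i.
  by have := E (widen_ord (leqnSn N) i); rewrite big_ord_recl cz mul0r add0r.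
pose a j := c 0 j / c 0 ord0.
have a0 : a ord0 = 1 by rewrite /a divff.
have Ea (i : 'I_N.+1) : \sum_j a j * iter i D (f j) = 0.
  transitivity ((\sum_j c 0 j * iter i D (f j)) / c 0 ord0); last by rewrite E mul0r.
  rewrite mulr_suml; apply: eq_bigr => j _.
  by rewrite /a mulrAC.
have d1 : D 1 = 0 by rewrite -(rmorph1 iota) derC.
have da j : D (a j) = 0.
  case: (unliftP ord0 j) => [l ->|->]; last by rewrite a0.
  apply: (zero (fun l => D (a (lift ord0 l)))) => i.
  have := congr1 D (Ea (widen_ord (leqnSn N) i)); rewrite der0 der_sum.
  rewrite (eq_bigr (fun j => a j * iter i.+1 D (f j) + D (a j) * iter i D (f j))) => [|m _].
    rewrite big_split /= (Ea (lift ord0 i)) add0r big_ord_recl a0 d1 mul0r add0r.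
    by move=> H; exact: H.
  by rewrite derM [D (a m) * _]mulrC.
have /(@choice _ _)[al alP] : forall j, exists x, a j = iota x by move=> j; exact: constants.
have al0 : al ord0 = 0.
  by apply: Hf; rewrite -[RHS](Ea ord0); apply: eq_bigr => j _; rewrite alP.
by have := a0; rewrite alP al0 rmorph0 => /eqP; rewrite eq_sym oner_eq0.
Qed.

Lemma iter_derC i c x : iter i D (iota c * x) = iota c * iter i D x.
Proof. by elim: i => //= i ->; rewrite derM derC mulr0 addr0. Qed.

Lemma iter_der_sum i (I : Type) (r : seq I) (F : I -> K) :
  iter i D (\sum_(j <- r) F j) = \sum_(j <- r) iter i D (F j).
Proof. by elim: i => //= i ->; rewrite der_sum. Qed.

Lemma wronskian_lcomb N (A : 'M[k]_N) (f : 'I_N -> K) :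
  wronskian (lcomb iota A f) = iota (\det A) * wronskian f.
Proof.
rewrite /wronskian -det_map_mx -det_mulmx; congr (\det _); apply/matrixP => j i.
rewrite !mxE iter_der_sum; apply: eq_bigr => l _; by rewrite iter_derC !mxE.
Qed.

Variables (P : choiceType) (v : P -> K -> int).
Hypothesis Hv : forall p, is_dvaluation iota (v p).

(** Each derivation adds h to the order, and in every term of the determinant the numbers of
    derivations have sum 0 + 1 + ... + (N - 1). *)
Lemma wronskian_vge p (h : int) N (f : 'I_N -> K) (a : 'I_N -> int) :
  (forall y, y != 0 -> vge v p (v p y + h) (D y)) -> (forall j, vge v p (a j) (f j)) ->
  vge v p (\sum_j a j + 'C(N, 2)%:Z * h) (wronskian f).
Proof.
move=> hD ha; have step b y : vge v p b y -> vge v p (b + h) (D y).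
  have [->|y0] := eqVneq y 0; first by rewrite der0 !vge0.
  by rewrite vgeE // => yb; refine (vge_w (hD y y0) _); rewrite lerD2r.
have stepi i b y : vge v p b y -> vge v p (b + i%:Z * h) (iter i D y).
  elim: i => [|i IH] hb; first by rewrite mul0r addr0.
  have -> : b + i.+1%:Z * h = (b + i%:Z * h) + h by rewrite intS; ring.
  exact: step (IH hb).
rewrite /wronskian /determinant; apply: (vge_sum Hv) => s _.
have sgn : vge v p 0 ((-1) ^+ s : K).
  by rewrite -(rmorphN1 iota) -rmorphXn; exact: (vgeC Hv).
rewrite -[X in vge _ _ X _]add0r; apply: (vgeM Hv) => //.
have -> : \sum_j a j + 'C(N, 2)%:Z * h = \sum_j (a j + (s j)%:Z * h).
  rewrite big_split -mulr_suml; congr (_ + _ * _).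
  transitivity (\sum_(j < N) j%:Z); last by rewrite (reindex_perm s).
  rewrite -triangular_sum big_mkord (big_morph Posz PoszD (erefl 0%:Z)) //.
by apply: (vge_prod Hv) => j _; rewrite mxE; exact: stepi.
Qed.

End Wronskian.

Section CurveTheorem.
Variables (k : closedFieldType) (K : fieldType) (iota : {rmorphism k -> K}).
Variables (P : choiceType) (v : P -> K -> int) (genus : nat).
Hypothesis char0 : [pchar k] =i pred0.
Hypothesis Hm : curve_model iota v.
Hypothesis Hg : is_genus iota v genus.

Lemma function_field_coords : exists t, ktranscendental iota t /\
  exists n (e : 'I_n -> K) co, coords (ktinc iota t) e co.
Proof.
have [t [Ht [b hb]]] := cm_ff Hm; exists t; split=> //.
apply: (@coords_exist _ _ _ (size b) (fun j => b`_j)) => x; have [r [rF ->]] := hb x.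
have /(@choice _ _)[c cE] : forall j, exists y, ktinc iota t y = r j.
  move=> j; apply: ktincP; have [p [q [q0 E]]] := rF j; apply/in_ratP; exists p, q; split=> //.
  exact: ev_neq0.
by exists c; apply: eq_bigr => j _; rewrite cE.
Qed.

Lemma curve_principal_deg x : x != 0 -> fsum (fun p => v p x) = 0.
Proof. exact: principal_deg (cm_val Hm) (cm_fin Hm) Hg x. Qed.

Lemma curve_residue p x y : x != 0 -> vge v p (v p x) y ->
  exists c, vge v p (v p x + 1) (y - iota c * x).
Proof.
have [t [Ht [n [e [co Hco]]]]] := function_field_coords.
exact: residue_ratio (cm_val Hm) (residue (cm_val Hm) Ht Hco) p x y.
Qed.

(** A change of basis over k multiplies the Wronskian by a nonzero constant, so a single w allows a
    different basis A at every place. *)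
Lemma curve_wronskian : exists h : P -> int,
  (exists T0 : seq P, forall T, uniq T -> {subset T0 <= T} ->
      \sum_(p <- T) (- 1 - h p) <= 2 * genus%:Z - 2) /\
  forall N (f : 'I_N -> K), klin_indep iota f -> exists w, w != 0 /\
    forall p (A : 'M[k]_N) (a : 'I_N -> int), A \in unitmx ->
      (forall i, vge v p (a i) (lcomb iota A f i)) ->
      \sum_i a i + 'C(N, 2)%:Z * h p <= v p w.
Proof.
have [t [Ht [n [e [co Hco]]]]] := function_field_coords.
have [D [HD Dt]] := derivation_ex char0 Ht Hco.
have Hv := cm_val Hm; have Hfin := cm_fin Hm; have Hinj := @cm_inj _ _ _ _ _ Hm.
have [h [h1 h2 h3]] := log_orders char0 Hv Hfin Hinj Hg Ht Hco HD Dt.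
exists h; split=> // N f Hf.
have const := der_const char0 Hv Hfin Hinj Hg Ht Hco HD Dt.
have [DD DM DC] := HD.
have w0 := wronskian_neq0 DD DM DC const Hf.
exists (wronskian D f); split=> // p A a uA ha.
have dA : iota (\det A) != 0 by rewrite fmorph_eq0 -unitfE -unitmxE.
have := wronskian_vge DD Hv (h1 p) ha.
rewrite (wronskian_lcomb DD DM DC) vgeE ?mulf_neq0 // (vM Hv) // (vC Hv) ?add0r //.
by rewrite -(fmorph_eq0 iota).
Qed.

End CurveTheorem.

(** * Greatest common divisors of polynomials *)

Definition divides (R : idomainType) (a b : R) := exists x, b = a * x.

(* A gcd with cofactors a' and b' such that a' is coprime to b' in the sense of the lemma of
   Gauss. *)
Definition strong_gcd (R : idomainType) := forall a b : R, a != 0 -> b != 0 ->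
  exists g a' b', [/\ a = g * a', b = g * b' & forall c, divides a' (b' * c) -> divides a' c].

Section Factorization.
Variables (R : idomainType) (size_of : R -> nat).
Hypothesis sizeM : forall a b, a != 0 -> b != 0 -> size_of (a * b) = (size_of a + size_of b)%N.
Hypothesis size0 : forall a, a != 0 -> size_of a = 0%N -> divides a 1.
Hypothesis gcdR : strong_gcd R.
Implicit Types (a b c : R) (f g h : {poly R}).

Definition prime_elt a := [/\ a != 0, (0 < size_of a)%N &
  forall b c, divides a (b * c) -> divides a b \/ divides a c].

(** Induction on the size. An element without factorization into two parts of positive size is prime
    thanks to [strong_gcd]: its gcd part against any f is trivial or everything. *)
Lemma prime_factorization a : a != 0 -> exists s : seq R,
  (forall b, b \in s -> prime_elt b) /\ exists u w, u * w = 1 /\ a = u * \prod_(b <- s) b.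
Proof.
have [m] := ubnP (size_of a); elim: m a => // m IH a; rewrite ltnS => am a0.
have [a1|a1] := posnP (size_of a).
  have [w wE] := size0 a0 a1; exists [::]; split=> //; exists a, w.
  by rewrite big_nil mulr1.
have [[b [c [E [b1 c1]]]]|irr] := classic
  (exists b c, a = b * c /\ (0 < size_of b /\ 0 < size_of c)%N).
  have b0 : b != 0 by apply: contraNneq a0 => b0; rewrite E b0 mul0r.
  have c0 : c != 0 by apply: contraNneq a0 => c0; rewrite E c0 mulr0.
  have sE := sizeM b0 c0; rewrite -E in sE.
  have [|s [sP [u [w [uw bE]]]]] := IH b _ b0; first by rewrite sE in am; apply: leq_trans am;
    rewrite -addn1 leq_add2l.
  have [|s' [sP' [u' [w' [uw' cE]]]]] := IH c _ c0; first by rewrite sE in am;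
    apply: leq_trans am; rewrite -add1n leq_add2r.
  exists (s ++ s'); split; first by move=> x; rewrite mem_cat => /orP[/sP|/sP'].
  exists (u * u'), (w * w'); split; first by rewrite mulrACA uw uw' mulr1.
  by rewrite big_cat E {1}bE {1}cE mulrACA.
exists [:: a]; split; last by exists 1, 1; rewrite !mul1r big_seq1.
move=> x; rewrite inE => /eqP->; split=> // f g [x0 fgE].
have [->|f0] := eqVneq f 0; first by left; exists 0; rewrite mulr0.
have [u [a' [b' [aE fE hs]]]] := gcdR a0 f0.
have u0 : u != 0 by apply: contraNneq a0 => u0; rewrite aE u0 mul0r.
have a'0 : a' != 0 by apply: contraNneq a0 => h; rewrite aE h mulr0.
have [h|h] := posnP (size_of a').
  by have [w wE] := size0 a'0 h; left; exists (w * b'); rewrite fE aE -mulrA; congr (_ * _);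
    rewrite mulrA -wE mul1r.
have [h'|h'] := posnP (size_of u); last by case: irr; exists u, a'.
have [w wE] := size0 u0 h'; right.
have [|y yE] := hs g.
  exists x0; apply: (mulfI u0); by rewrite !mulrA -fE -aE.
by exists (w * y); rewrite yE aE mulrACA -wE mul1r.
Qed.

Lemma polyC_divP a f : (exists g, f = a *: g) <-> forall i, divides a f`_i.
Proof.
split=> [[g ->] i|h]; first by exists g`_i; rewrite coefZ.
have [x xP] := choice _ h; have [az|a0] := eqVneq a 0.
  by exists 0; apply/polyP => i; rewrite xP scaler0 coef0 az mul0r.
exists (\poly_(i < size f) x i); apply/polyP => i; rewrite coefZ coef_poly.
case: ltnP => [_|h']; first exact: xP.
by rewrite nth_default // mulr0.
Qed.

Lemma divides_sum (I : Type) (r : seq I) (Q : pred I) (F : I -> R) a :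
  (forall i, Q i -> divides a (F i)) -> divides a (\sum_(i <- r | Q i) F i).
Proof.
move=> h; elim/big_ind: _ => //; first by exists 0; rewrite mulr0.
by move=> x y [b ->] [c ->]; exists (b + c); rewrite mulrDr.
Qed.

(** Lemma of Gauss: if i and j index the first coefficients of f and g not divisible by a, the
    coefficient of f g at i + j is not divisible either. *)
Lemma prime_polyC a f g h : prime_elt a -> a *: h = f * g ->
  (exists f1, f = a *: f1) \/ (exists g1, g = a *: g1).
Proof.
move=> [a0 _ pa] E; have [|nf] := classic (exists f1, f = a *: f1); first by left.
have [|ng] := classic (exists g1, g = a *: g1); first by right.
have first_bad (q : {poly R}) : ~ (exists q1, q = a *: q1) ->
    exists i, ~ divides a q`_i /\ forall j, (j < i)%N -> divides a q`_j.
  move=> nq; have [i hi] : exists i, ~ divides a q`_i.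
    by apply: NNPP => H; apply: nq; apply/polyC_divP => i; apply: NNPP => H'; apply: H; exists i.
  have [m] := ubnP i; elim: m i hi => // m IH i hi; rewrite ltnS => im.
  have [H|H] := classic (forall j, (j < i)%N -> divides a q`_j); first by exists i.
  have [j Hj] := not_all_ex_not _ _ H; have [ji jn] := imply_to_and _ _ Hj.
  by apply: (IH j jn); exact: leq_trans ji im.
have [i [hi mi]] := first_bad f nf; have [j [hj mj]] := first_bad g ng.
have : divides a (f`_i * g`_j); last by case/pa.
have := congr1 (fun q : {poly R} => q`_(i + j)) E; rewrite coefZ coefM.
have ij : (i < (i + j).+1)%N by rewrite ltnS leq_addr.
rewrite (bigD1 (Ordinal ij)) //= addKn => E'.
have [x xE] : divides a (\sum_(l < (i + j).+1 | l != Ordinal ij) f`_l * g`_(i + j - l)).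
  apply: divides_sum => l li.
  have [lt|] := ltnP l i; first by have [y ->] := mi l lt; exists (y * g`_(i + j - l));
    rewrite mulrA.
  rewrite leq_eqVlt => /orP[/eqP il|lt].
    by case/eqP: li; apply: val_inj.
  have [|y ->] := mj (i + j - l)%N; first by have := ltn_ord l; lia.
  by exists (f`_l * y); rewrite mulrCA.
exists (h`_(i + j) - x); rewrite mulrBr -xE E'.
by rewrite addrK.
Qed.

Lemma scale_cancel a f g : a != 0 -> a *: f = a *: g -> f = g.
Proof.
move=> a0; rewrite -!mul_polyC => /(@mulfI _ _ _) -> //; by rewrite polyC_eq0.
Qed.

(** By [prime_polyC] each prime factor of c divides g or h, and is taken out there. *)
Lemma clear_denominator c f g h : c != 0 -> c *: f = g * h ->
  exists a b g1 h1, [/\ a != 0, b != 0, g = a *: g1, h = b *: h1 & f = g1 * h1].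
Proof.
move=> c0; have [s [sP [u [w [uw ->]]]]] := prime_factorization c0.
rewrite mulrC -scalerA.
have u0 : u != 0 by apply/eqP => u0; move/eqP: uw; rewrite u0 mul0r eq_sym oner_eq0.
suff H (f' g' h' : {poly R}) : (\prod_(b <- s) b) *: f' = g' * h' ->
    exists a b g1 h1, [/\ a != 0, b != 0, g' = a *: g1, h' = b *: h1 & f' = g1 * h1].
  move=> /H[a [b [g1 [h1 [a0 b0 gE hE fE]]]]].
  exists (a * u), b, (w *: g1), h1; split=> //; first by rewrite mulf_neq0.
    by rewrite scalerA -mulrA uw mulr1.
  by apply: (scale_cancel u0); rewrite fE scalerAl scalerA uw scale1r.
elim: s sP f' g' h' => [|p s IH] sP f' g' h'.
  by rewrite big_nil scale1r => E; exists 1, 1, g', h'; rewrite !scale1r oner_neq0.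
have sP' b : b \in s -> prime_elt b by move=> bs; apply: sP; rewrite inE bs orbT.
have pp : prime_elt p by apply: sP; rewrite inE eqxx.
have [p0 _ _] := pp; rewrite big_cons -scalerA => E.
have [[g1 gE]|[h1 hE]] := prime_polyC pp E.
  have E1 : (\prod_(b <- s) b) *: f' = g1 * h'.
    by apply: (scale_cancel p0); rewrite E gE scalerAl.
  have [a [b [g2 [h2 [a0 b0 gE1 hE1 fE]]]]] := IH sP' _ _ _ E1.
  by exists (p * a), b, g2, h2; split=> //; rewrite ?mulf_neq0 // gE gE1 scalerA.
have E1 : (\prod_(b <- s) b) *: f' = g' * h1.
  by apply: (scale_cancel p0); rewrite E hE scalerAr.
have [a [b [g2 [h2 [a0 b0 gE1 hE1 fE]]]]] := IH sP' _ _ _ E1.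
by exists a, (p * b), g2, h2; split=> //; rewrite ?mulf_neq0 // hE hE1 scalerA.
Qed.

Definition no_common_prime f g :=
  forall a, prime_elt a -> (exists f1, f = a *: f1) -> ~ (exists g1, g = a *: g1).

(* Only the primes dividing the leading coefficient of f can be common, whence the
   induction. *)
Lemma strip_common_primes f g : f != 0 -> exists c f1 g1,
  [/\ c != 0, f = c *: f1, g = c *: g1 & no_common_prime f1 g1].
Proof.
have [m] := ubnP (size_of (lead_coef f)); elim: m f g => // m IH f g; rewrite ltnS => fm f0.
have [h|h] := classic (no_common_prime f g).
  by exists 1, f, g; rewrite !scale1r oner_neq0.
have [a [pa [[f1 fE] [g1 gE]]]] : exists a, prime_elt a /\
    ((exists f1, f = a *: f1) /\ (exists g1, g = a *: g1)).
  apply: NNPP => H; apply: h => a pa hf hg; apply: H; by exists a.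
have [a0 na _] := pa.
have f10 : f1 != 0 by apply: contraNneq f0 => f10; rewrite fE f10 scaler0.
have [|c [f2 [g2 [c0 fE2 gE2 no]]]] := IH f1 g1 _ f10.
  apply: leq_trans fm; rewrite fE lead_coefZ sizeM ?lead_coef_eq0 //.
  by rewrite -[X in (X < _)%N]add0n ltn_add2r.
exists (a * c), f2, g2; split=> //; first by rewrite mulf_neq0.
  by rewrite fE fE2 scalerA.
by rewrite gE gE2 scalerA.
Qed.

(** Cancel a prime p of the denominator. It divides r, and s gets shorter, or it divides f; then it
    divides g q, hence q as f and g share no prime, and p is removed from both f and q, lowering the
    size of the leading coefficient of f. *)
Lemma divides_from_fraction (s : seq R) (f g h q r : {poly R}) :
  (forall b, b \in s -> prime_elt b) -> f != 0 -> no_common_prime f g ->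
  (\prod_(b <- s) b) *: q = r * f -> g * q = f * h -> exists x, q = f * x.
Proof.
have [m] := ubnP (size s + size_of (lead_coef f))%N.
elim: m s f g h q r => // m IH s f g h q r; rewrite ltnS => le sP f0 no E E'.
case: s sP le E => [|p s] sP le E.
  by exists r; rewrite mulrC -E big_nil scale1r.
have sP' b : b \in s -> prime_elt b by move=> bs; apply: sP; rewrite inE bs orbT.
have pp : prime_elt p by apply: sP; rewrite inE eqxx.
have [p0 np _] := pp; move: (E); rewrite big_cons -scalerA => E1.
have [[r1 rE]|[f1 fE]] := prime_polyC pp E1.
  apply: (IH s f g h q r1) => //.
  by apply: (scale_cancel p0); rewrite E1 rE scalerAl.
have f10 : f1 != 0 by apply: contraNneq f0 => f10; rewrite fE f10 scaler0.
have E2 : p *: (f1 * h) = g * q by rewrite E' fE scalerAl.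
have [[g1 gE]|[q1 qE]] := prime_polyC pp E2.
  by case: (no p pp); [exists f1|exists g1].
have [||||x xE] := IH (p :: s) f1 g h q1 r _ sP f10.
- apply: leq_trans le; rewrite fE lead_coefZ sizeM ?lead_coef_eq0 // addnA ltn_add2r.
  by rewrite -[X in (X < _)%N]addn0 ltn_add2l.
- by move=> a pa [f2 f1E] hg; apply: (no a pa) => //; exists (p *: f2);
  rewrite fE f1E !scalerA mulrC.
- apply: (scale_cancel p0); rewrite scalerA mulrC -scalerA -qE E fE scalerAr //.
- by apply: (scale_cancel p0); rewrite scalerAr -qE E' fE scalerAl.
by exists x; rewrite qE xE fE scalerAl.
Qed.

(** [gcdp] is a gcd over the fraction field. Clearing denominators makes it divide f and g over R,
    and stripping common primes from the cofactors gives them the property of Gauss. *)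
Lemma strong_gcd_poly : strong_gcd {poly R}.
Proof.
move=> f g f0 g0; pose G := gcdp f g.
have G0 : G != 0 by rewrite gcdp_eq0 negb_and f0.
have /Pdiv.Idomain.dvdpP[[c1 h1] /= c10 E1] := dvdp_gcdl f g.
have /Pdiv.Idomain.dvdpP[[c2 h2] /= c20 E2] := dvdp_gcdr f g.
have [_ [a [f1 [G1 [_ a0 _ GE fE]]]]] := clear_denominator c10 E1.
have E3 : c2 *: g = (a *: h2) * G1 by rewrite E2 GE -scalerAr scalerAl.
have [_ [b [g1 [G2 [_ b0 _ G1E gE]]]]] := clear_denominator c20 E3.
have G20 : G2 != 0 by apply: contraNneq g0 => h; rewrite gE h mulr0.
have fE' : f = (b *: f1) * G2 by rewrite fE G1E -scalerAr scalerAl.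
have b10 : b *: f1 != 0 by apply: contraNneq f0 => h; rewrite fE' h mul0r.
have cop : coprimep (b *: f1) g1.
  have := eqp_size (gcdp_mul2r (b *: f1) g1 G2); rewrite -fE' -gE GE G1E.
  have n0 : gcdp (b *: f1) g1 != 0 by rewrite gcdp_eq0 negb_and b10.
  rewrite size_scale // size_scale // size_mul // coprimep_def.
  have := size_poly_gt0 (gcdp (b *: f1) g1); rewrite n0.
  have := size_poly_gt0 G2; rewrite G20; move: (size G2) (size (gcdp _ _)); clear; lia.
have [c [f2 [g2 [c0 f2E g2E no]]]] := strip_common_primes g1 b10.
exists (c *: G2), f2, g2; split.
- by rewrite fE' f2E -!scalerAl [G2 * _]mulrC.
- by rewrite gE g2E -!scalerAl [G2 * _]mulrC.
have f20 : f2 != 0 by apply: contraNneq b10 => h; rewrite f2E h scaler0.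
move=> q [h hE].
have cop2 : coprimep f2 g2.
  move: cop; rewrite f2E g2E coprimepZl // coprimepZr //.
have : f2 %| q by rewrite -(Gauss_dvdpr _ cop2) hE dvdp_mulIl.
move=> /Pdiv.Idomain.dvdpP[[d r] /= d0 dE].
have [s [sP [u [w [uw dd]]]]] := prime_factorization d0.
apply: (divides_from_fraction (s := s) (r := w *: r) sP f20 no _ hE).
by rewrite -scalerAl -dE dd scalerA mulrA [w * u]mulrC uw mul1r.
Qed.

End Factorization.

Lemma strong_gcd_iso (A B : idomainType) (f : {rmorphism A -> B}) :
  injective f -> (forall y, exists x, f x = y) -> strong_gcd B -> strong_gcd A.
Proof.
move=> fi fs gB a b a0 b0; have f0 x : x != 0 -> f x != 0.
  by apply: contra_neq => fx; apply: fi; rewrite fx rmorph0.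
have [g [a' [b' [aE bE hs]]]] := gB _ _ (f0 _ a0) (f0 _ b0).
have [g0 gE] := fs g; have [a1 a1E] := fs a'; have [b1 b1E] := fs b'.
exists g0, a1, b1; split; try by apply: fi; rewrite rmorphM gE ?a1E ?b1E.
move=> c [x xE]; have [|y yE] := hs (f c).
  by exists (f x); rewrite -a1E -b1E -!rmorphM xE.
by have [z zE] := fs y; exists z; apply: fi; rewrite rmorphM a1E zE.
Qed.

Section MuniBijective.
Variables (K : fieldType) (n : nat).

Definition unmuni (q : {poly {mpoly K[n]}}) : {mpoly K[n.+1]} :=
  (map_poly (@mwiden n K) q).['X_ord_max].

Lemma unmuniD p q : unmuni (p + q) = unmuni p + unmuni q.
Proof. by rewrite /unmuni rmorphD hornerD. Qed.
Lemma unmuniM p q : unmuni (p * q) = unmuni p * unmuni q.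
Proof. by rewrite /unmuni rmorphM hornerM. Qed.
Lemma unmuniC p : unmuni p%:P = mwiden p.
Proof. by rewrite /unmuni map_polyC hornerC. Qed.
Lemma unmuniX : unmuni 'X = 'X_ord_max.
Proof. by rewrite /unmuni map_polyX hornerX. Qed.
Lemma unmuniXn i : unmuni ('X ^+ i) = 'X_ord_max ^+ i.
Proof. by rewrite /unmuni rmorphXn horner_exp /= map_polyX hornerX. Qed.
Lemma unmuni0 : unmuni 0 = 0.
Proof. by rewrite /unmuni rmorph0 horner0. Qed.

Lemma muniK : cancel (@muni n K) unmuni.
Proof.
move=> p; rewrite muniE (big_morph unmuni unmuniD unmuni0) [RHS]mpolyE.
apply: eq_bigr => m _; rewrite -!mul_polyC unmuniM unmuniC unmuniXn.
rewrite -mul_mpolyC mwidenM mwidenC mwidenX -mulrA mul_mpolyC; congr (_ *: _).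
rewrite mpolyXn -mpolyXD; congr ('X_[_]); apply/mnmP => i; rewrite mnmDE mulmnE mnm1E.
case: (unliftP ord_max i) => [j ->|->]; last first.
  by rewrite mnmwiden_ordmax eqxx ?muln1 ?mul1n add0n.
rewrite (negPf (neq_lift _ _)) ?muln0 ?mul0n addn0.
have -> : lift ord_max j = widen_ord (leqnSn n) j by apply: val_inj; exact: lift_max.
by rewrite mnmwiden_widen mnmE.
Qed.

Lemma muni_mwiden p : muni (@mwiden n K p) = p%:P.
Proof.
have hD (a b : {mpoly K[n]}) : muni (mwiden (a + b)) = muni (mwiden a) + muni (mwiden b).
  by rewrite mwidenD muniD.
have h0 : muni (mwiden (0 : {mpoly K[n]})) = 0 by rewrite mwiden0 muni0.
rewrite [p in LHS]mpolyE (big_morph (fun q => muni (mwiden q)) hD h0).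
rewrite [p in RHS]mpolyE (big_morph (@polyC _) (@polyCD _) (erefl 0%:P)).
apply: eq_bigr => m _; rewrite mwidenZ muniZ mwidenX.
rewrite muniE msuppX big_seq1 mcoeffX eqxx scale1r mnmwiden_ordmax expr0.
rewrite -mul_mpolyC polyCM -mul_polyC; congr (_ * _).
rewrite -mul_polyC mulr1; congr (_%:P); congr ('X_[_]).
by apply/mnmP => i; rewrite mnmE mnmwiden_widen.
Qed.

Lemma muniX_max : muni ('X_ord_max : {mpoly K[n.+1]}) = 'X.
Proof.
rewrite muniE msuppX big_seq1 mcoeffX eqxx scale1r mnm1E eqxx expr1.
have -> : [multinom (U_(ord_max : 'I_n.+1)%MM (widen_ord (leqnSn n) i)) | i < n] = 0%MM.
  apply/mnmP => i; rewrite mnmE mnm1E mnm0E; case: eqP => // /(congr1 val) /= h.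
  by have := ltn_ord i; rewrite -h ltnn.
by rewrite mpolyX0 scale1r.
Qed.

Lemma unmuniK : cancel unmuni (@muni n K).
Proof.
elim/poly_ind => [|q c IH]; first by rewrite unmuni0 muni0.
by rewrite unmuniD unmuniM unmuniX unmuniC muniD muniM muniX_max muni_mwiden IH.
Qed.

End MuniBijective.

(** Induction on the number of variables through [muni], which views a polynomial in n + 1 variables
    as one in the last variable; size is total degree. *)
Lemma strong_gcd_mpoly (K : fieldType) n : strong_gcd {mpoly K[n]}.
Proof.
have unit_of m (a : {mpoly K[m]}) : a != 0 -> (msize a).-1 = 0%N -> divides a 1.
  move=> a0 sa; have /msize_poly1P[c c0 ->] : msize a == 1%N.
    by have := msize_poly_eq0 a; rewrite (negPf a0); move: sa; case: (msize a) => [|[]].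
  by exists (c^-1)%:MP; rewrite -mpolyCM divff.
elim: n => [|n IH].
  move=> a b a0 b0; exists a, 1; have [|x xE] := @unit_of _ a a0.
    apply/eqP; rewrite -subn1 subn_eq0 msizeE; apply/bigmax_leqP_seq => m _ _.
    by rewrite mdegE big_ord0.
  exists (x * b); rewrite mulr1 mulrA -xE mul1r; split=> // c _.
  by exists c; rewrite mul1r.
apply: (@strong_gcd_iso _ {poly {mpoly K[n]}} (@muni n K)).
- exact: can_inj (@muniK K n).
- by move=> y; exists (unmuni y); exact: unmuniK.
apply: (@strong_gcd_poly _ (fun a => (msize a).-1)) => //.
- move=> a b a0 b0; rewrite msizeM //; have := mpolySpred mdeg a0; have := mpolySpred mdeg b0.
  by move: (msize a) (msize b); lia.
- exact: unit_of.
Qed.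

Lemma coprime_syzygy (K : fieldType) n (f g a b : {mpoly K[n]}) :
  mcoprime f g -> f != 0 -> g != 0 -> f * a = g * b -> divides g a.
Proof.
move=> cop f0 g0 E; have [u [g' [f' [gE fE hs]]]] := strong_gcd_mpoly g0 f0.
have u0 : u != 0 by apply: contraNneq g0 => u0; rewrite gE u0 mul0r.
have /msize_poly1P[c c0 uE] : msize u == 1%N.
  by have := cop _ _ _ fE gE; have := msize_poly_eq0 u; rewrite (negPf u0);
    case: (msize u) => [|[]].
have [|x ->] := hs a.
  by exists b; apply: (mulfI u0); rewrite !mulrA -fE -gE.
exists (c^-1%:MP * x); rewrite gE uE mulrACA -mpolyCM divff // mpolyC1 mul1r //.
Qed.

Lemma card_bmultinom n b : #|{: 'X_{1..n < b.+1}}| = 'C(b + n, n).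
Proof.
rewrite addnC -card_partial_ord_partitions.
pose f (l : 'X_{1..n < b.+1}) : n.-tuple 'I_b.+1 := [tuple inord (l i) | i < n].
have lb (l : 'X_{1..n < b.+1}) i : (l i < b.+1)%N.
  apply: leq_ltn_trans (bmdeg l); by rewrite mdegE (bigD1 i) //= leq_addr.
have fi : injective f.
  move=> l1 l2 h; apply: val_inj; apply/mnmP => i.
  have := congr1 (fun x : n.-tuple 'I_b.+1 => val (tnth x i)) h.
  by rewrite /= !tnth_mktuple !inordK.
rewrite -(card_imset _ fi); apply: eq_card => x; rewrite !inE; apply/imsetP/idP.
  move=> [l _ ->]; have := bmdeg l; rewrite ltnS mdegE => h; apply: leq_trans h.
  by rewrite big_tuple; apply: leq_sum => i _; rewrite tnth_mktuple inordK.
move=> h; have xd : (mdeg [multinom (tnth x i : nat) | i < n] < b.+1)%N.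
  rewrite ltnS mdegE; apply: leq_trans h; rewrite big_tuple.
  by apply: leq_sum => i _; rewrite mnmE.
exists (BMultinom xd) => //; apply: eq_from_tnth => i; rewrite tnth_mktuple /=.
by apply: val_inj; rewrite /= mnmE inordK.
Qed.

Lemma mcoeff_shift (R : comRingType) n (F : {mpoly R[n]}) c l :
  ('X_[c] * F)@_l = 0 \/ exists j, l = (c + j)%MM /\ ('X_[c] * F)@_l = F@_j.
Proof.
have [h|h] := boolP (c <= l)%MM.
  right; exists (l - c)%MM; have E : l = (c + (l - c))%MM by rewrite addmC submK.
  by split=> //; rewrite mulrC {1}E mcoeffMX.
left; rewrite [F]mpolyE mulr_sumr raddf_sum big1 // => j _.
rewrite -scalerAr -mpolyXD /= mcoeffZ mcoeffX; case: eqP => [E|_]; last by rewrite mulr0.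
by case/negP: h; rewrite -E; apply/mnm_lepP => i; rewrite mnmDE leq_addr.
Qed.

Lemma msizeM_pred (R : idomainType) n (p q : {mpoly R[n]}) :
  (msize (p * q) <= (msize p + msize q).-1)%N.
Proof.
have [->|p0] := eqVneq p 0; first by rewrite mul0r msize0.
have [->|q0] := eqVneq q 0; first by rewrite mulr0 msize0.
by rewrite msizeM.
Qed.

(** * The Sylvester system of F1 and F2 *)

Section SylvesterMatrix.
Variables (K : fieldType) (n d m : nat) (F1 F2 : {mpoly K[n]}).
Hypothesis cop : mcoprime F1 F2.
Hypothesis s1 : msize F1 = d.+1.
Hypothesis s2 : msize F2 = d.+1.
Hypothesis dm : (2 * d <= m)%N.

Let F10 : F1 != 0. Proof. by rewrite -msize_poly_eq0 s1. Qed.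
Let F20 : F2 != 0. Proof. by rewrite -msize_poly_eq0 s2. Qed.

Notation Col := 'X_{1..n < m.+1}.
Definition syl_index : finType := (bool * 'X_{1..n < (m - d).+1})%type.
Definition syl_poly (x : syl_index) : {mpoly K[n]} := 'X_[x.2] * (if x.1 then F1 else F2).
Definition syl_mx : 'M[K]_(#|{: syl_index}|, #|{: Col}|) :=
  \matrix_(i, j) (syl_poly (enum_val i))@_(enum_val j : Col).

Lemma syl_msize x : (msize (syl_poly x) <= m.+1)%N.
Proof.
rewrite /syl_poly; apply: leq_trans (msizeM_pred _ _) _; rewrite msizeX.
have := bmdeg x.2; have -> : msize (if x.1 then F1 else F2) = d.+1 by case: ifP.
move: dm; move: (mdeg _); lia.
Qed.

Lemma syl_index_sum (h : syl_index -> {mpoly K[n]}) :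
  \sum_(i < #|{: syl_index}|) h (enum_val i) = \sum_c h (true, c) + \sum_c h (false, c).
Proof.
rewrite -(big_enum_val (A := syl_index) h) /=.
rewrite (eq_bigr (fun x => h (x.1, x.2))) => [|[]//].
by rewrite -(pair_bigA _ (fun b c => h (b, c))) /= big_bool.
Qed.

(* A relation A F1 + B F2 = 0 between multiples of the coprime F1 and F2 is a multiple of the
   trivial one. *)
Lemma syl_kernel (la : 'rV[K]_#|{: syl_index}|) : la *m syl_mx = 0 ->
  exists C : {mpoly K[n]}, (msize C <= (m - 2 * d).+1)%N /\
    forall i, la 0 i = (C * (if (enum_val i).1 then F2 else - F1))@_(enum_val i).2.
Proof.
move=> la0; pose co b := \sum_(c : 'X_{1..n < (m - d).+1}) (la 0 (enum_rank ((b, c) : syl_index)))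
  *: ('X_[c] : {mpoly K[n]}).
have coE b (c : 'X_{1..n < (m - d).+1}) : (co b)@_c = la 0 (enum_rank ((b, c) : syl_index)).
  rewrite /co; pose E (j : 'X_{1..n}) := if @idP (mdeg j < (m - d).+1)%N is ReflectT h
    then la 0 (enum_rank ((b, BMultinom h) : syl_index)) else 0.
  have EE (j : 'X_{1..n < (m - d).+1}) : E j = la 0 (enum_rank ((b, j) : syl_index)).
    rewrite /E; case: {-}_ / idP => [h|]; last by rewrite bmdeg.
    by congr (la 0 (enum_rank (b, _))); apply: val_inj.
  rewrite (eq_bigr (fun j : 'X_{1..n < (m - d).+1} => E j *: 'X_[j])) => [|j _]; last by rewrite EE.
  by rewrite mcoeff_mpoly ?bmdeg // EE.
have cosz b : (msize (co b) <= (m - d).+1)%N.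
  rewrite msizeE; apply/bigmax_leqP_seq => j jc _; rewrite ltnNge; apply/negP => h.
  move: jc; rewrite mcoeff_msupp /co raddf_sum big1 ?eqxx // => c _ /=.
  rewrite mcoeffZ mcoeffX; case: eqP => [E|]; last by rewrite mulr0.
  by have := bmdeg c; rewrite E ltnNge h.
have E0 : F1 * co true + F2 * co false = 0.
  have sz : (msize (F1 * co true + F2 * co false) <= m.+1)%N.
    apply: leq_trans (msizeD_le _ _) _; rewrite geq_max; apply/andP; split;
    apply: leq_trans (msizeM_pred _ _) _; rewrite ?s1 ?s2; have := cosz true; have := cosz false;
    move: dm; move: (msize (co true)) (msize (co false)); lia.
  have -> : F1 * co true + F2 * co false = \sum_(i < #|{: syl_index}|) la 0 i *:
    syl_poly (enum_val i).
    pose h (x : syl_index) := la 0 (enum_rank x) *: syl_poly x.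
    transitivity (\sum_(i < #|{: syl_index}|) h (enum_val i)).
      rewrite (syl_index_sum h) /co /h !mulr_sumr; congr (_ + _); apply: eq_bigr => c _;
      by rewrite /syl_poly /= scalerAr mulrC -scalerAl -scalerAr.
    by apply: eq_bigr => i _; rewrite /h enum_valK.
  set Q := \sum_(i < _) _; apply/mpolyP => j; rewrite mcoeff0.
  have [h|h] := ltnP (mdeg j) m.+1.
    have := congr1 (fun x : 'rV_#|{: Col}| => x 0 (enum_rank (BMultinom h : Col))) la0.
    rewrite [RHS]mxE [LHS]mxE => H; apply: etrans H; rewrite /Q raddf_sum; apply: eq_bigr => i _.
    by rewrite mxE enum_rankK /= mcoeffZ.
  rewrite memN_msupp_eq0 //; apply: msize_mdeg_ge; apply: leq_trans h.
  apply: leq_trans (msize_sum _ _ _) _; apply/bigmax_leqP_seq => i _ _.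
  exact: leq_trans (msizeZ_le _ _) (syl_msize _).
have E1 : F1 * co true = F2 * - co false.
  by apply/eqP; rewrite mulrN -addr_eq0 E0.
have [C CE] := coprime_syzygy cop F10 F20 E1.
have CE' : co false = - F1 * C.
  apply: (mulfI F20); apply/eqP; rewrite -[_ == _]eqr_opp -mulrN -E1 CE; apply/eqP; ring.
exists C; split.
  have [->|C0] := eqVneq C 0; first by rewrite msize0.
  have := cosz true; rewrite CE msizeM // s2 /=; move: dm; move: (msize C); lia.
move=> i; case E: (enum_val i) => [b c] /=.
have -> : la 0 i = (co b)@_c by rewrite coE -E enum_valK.
by case: b {E} => /=; rewrite ?CE ?CE' mulrC // mulrN mulNr.
Qed.

(** The kernel is spanned by the multiples of the trivial relation by the monomials of degree at
    most m - 2d; subtract their number from that of the rows. *)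
Lemma syl_rank : (Mcoef n d m <= \rank syl_mx)%N.
Proof.
pose Psi : 'M[K]_(#|{: 'X_{1..n < (m - 2 * d).+1}}|, #|{: syl_index}|) :=
  \matrix_(c, i) ('X_[enum_val c : 'X_{1..n < (m - 2 * d).+1}] *
    (if (enum_val i : syl_index).1 then F2 else - F1))@_((enum_val i : syl_index).2).
have kerle : (kermx syl_mx <= Psi)%MS.
  apply/row_subP => j; have [|C [sC CE]] := syl_kernel (la := row j (kermx syl_mx)).
    by rewrite -row_mul mulmx_ker row0.
  apply/submxP; exists (\row_c C@_(enum_val c : 'X_{1..n < (m - 2 * d).+1})).
  apply/rowP => i; rewrite CE {1}(mpolywE sC) mulr_suml raddf_sum mxE.
  rewrite [LHS](reindex (@enum_val 'X_{1..n < (m - 2 * d).+1} {: 'X_{1..n < (m - 2 * d).+1}})) /=;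
    last first.
    exact: onW_bij (enum_val_bij _).
  by apply: eq_bigr => c _; rewrite !mxE -scalerAl mcoeffZ.
have := mxrankS kerle; rewrite mxrank_ker => h1.
have := leq_trans h1 (rank_leq_row _); move: (rank_leq_row syl_mx); move: (\rank syl_mx) => rk.
rewrite card_prod card_bool !card_bmultinom /Mcoef.
have -> : (m - d + n = m + n - d)%N by move: dm; lia.
have -> : (m - 2 * d + n = m + n - 2 * d)%N by move: dm; lia.
by move: 'C(_, _) 'C(_, _); lia.
Qed.

Lemma syl_rows : exists f : 'I_(Mcoef n d m) -> syl_index,
  row_free (\matrix_(i < Mcoef n d m, j < #|{: Col}|) (syl_poly (f i))@_(enum_val j : Col)).
Proof.
have le := syl_rank; exists (fun i => enum_val (maxrankfun syl_mx (widen_ord le i))).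
have fr := maxrowsub_free syl_mx.
have -> : \matrix_(i, j) (syl_poly (enum_val (maxrankfun syl_mx (widen_ord le i))))@_(enum_val j :
  Col) =
    rowsub (widen_ord le) (rowsub (maxrankfun syl_mx) syl_mx).
  by apply/matrixP => i j; rewrite !mxE.
move: (rowsub _ syl_mx) fr => B fr; apply: inj_row_free => x.
rewrite [rowsub _ B](_ : _ = rowsub (widen_ord le) 1%:M *m B); last by rewrite mul_rowsub_mx mul1mx.
rewrite mulmxA => /eqP; rewrite mulmx_free_eq0 // => /eqP x0; apply/rowP => i; rewrite mxE.
have := congr1 (fun y : 'rV_(\rank syl_mx) => y 0 (widen_ord le i)) x0; rewrite !mxE => H;
  apply: etrans H.
rewrite (bigD1 i) //= !mxE eqxx mulr1 big1 ?addr0 // => j ji.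
rewrite !mxE -val_eqE /= val_eqE (negPf ji) mulr0 //.
Qed.

End SylvesterMatrix.

(** * Minors of least weight *)

Section MinimalMinor.
Variables (K : fieldType) (M C : nat) (Phi : 'M[K]_(M, C)) (om : 'I_C -> int).
Hypothesis free : row_free Phi.

(* A basis of columns of least total weight: by exchange, no column can be
   expressed in it using a basis column of larger weight. *)
Lemma min_minor : exists J : 'I_M -> 'I_C, [/\ injective J, colsub J Phi \in unitmx &
  forall i l, (invmx (colsub J Phi) *m Phi) i l != 0 -> om (J i) <= om l].
Proof.
have full : row_full Phi^T by rewrite /row_full mxrank_tr.
pose J0 : {ffun 'I_M -> 'I_C} := [ffun i => fullrankfun full i].
have U0 : colsub J0 Phi \in unitmx.
  suff -> : colsub J0 Phi = (rowsub (fullrankfun full) Phi^T)^T by rewrite unitmx_tr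
    fullrowsub_unit.
  by apply/matrixP => i j; rewrite !mxE ffunE.
pose S (J : {ffun 'I_M -> 'I_C}) := \sum_i om (J i).
pose J := [arg min_(J < J0 | colsub J Phi \in unitmx) S J]%O.
have [UJ Jmin] : colsub J Phi \in unitmx /\
    forall J' : {ffun 'I_M -> 'I_C}, colsub J' Phi \in unitmx -> S J <= S J'.
  by rewrite /J; case: arg_minP.
pose B := invmx (colsub J Phi) *m Phi.
have BJ i j : B i (J j) = (i == j)%:R.
  have := congr1 (fun A : 'M_M => A i j) (mulVmx UJ); rewrite [RHS]mxE => <-.
  by rewrite /B !mxE; apply: eq_bigr => l _; rewrite !mxE.
exists J; split=> // [i j ij|i l].
  apply/eqP/negPn/negP => ne; have := BJ i i; rewrite {1}ij BJ eqxx (negPf ne) => /eqP.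
  by rewrite eq_sym oner_eq0.
(* In terms of the basis J, the exchanged columns form the identity with column i replaced by column
   l of B, invertible because the entry [B i l] is nonzero. Minimality of the weight then compares
   [om (J i)] with [om l]. *)
rewrite -/B => Bil; pose J' := [ffun j => if j == i then l else J j].
have E : colsub J' Phi = colsub J Phi *m colsub J' B.
  have -> : colsub J' B = invmx (colsub J Phi) *m colsub J' Phi by rewrite /B -mulmx_colsub.
  by rewrite mulmxA mulmxV // mul1mx.
clearbody B.
have UJ' : colsub J' Phi \in unitmx.
  rewrite E unitmx_mul UJ -unitmx_tr /= -row_free_unit; apply: inj_row_free => x x0.
  have xE a : x 0 i * B a l + (if a == i then 0 else x 0 a) = 0.
    have := congr1 (fun y : 'rV_M => y 0 a) x0; rewrite [RHS]mxE => H; apply: etrans H.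
    rewrite mxE (bigD1 i) //= !mxE ffunE eqxx; congr (_ + _).
    case: eqP => [->|/eqP ai].
      by rewrite big1 // => j ji; rewrite !mxE ffunE (negPf ji) BJ eq_sym (negPf ji) mulr0.
    rewrite (bigD1 a) //= !mxE ffunE (negPf ai) BJ eqxx mulr1 big1 ?addr0 // => j /andP[ji ja].
    by rewrite !mxE ffunE (negPf ji) BJ eq_sym (negPf ja) mulr0.
  have xi : x 0 i = 0.
    by have /eqP := xE i; rewrite eqxx addr0 mulf_eq0 (negPf Bil) orbF => /eqP.
  apply/rowP => a; rewrite mxE; have [->//|ai] := eqVneq a i.
  by have := xE a; rewrite xi mul0r add0r (negPf ai).
have := Jmin _ UJ'; rewrite /S (bigD1 i) //= [X in _ <= X](bigD1 i) //= ffunE eqxx.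
rewrite [X in _ <= _ + X](eq_bigr (fun j => om (J j))) ?lerD2r // => j ji.
by rewrite ffunE (negPf ji).
Qed.

(** The adjugate is a nonzero multiple of the inverse, hence has the same zero pattern, but its
    entries are polynomials in the coefficients and so lie in V(M - 1). *)
Lemma min_minor_adj : exists J : 'I_M -> 'I_C, [/\ injective J, \adj (colsub J Phi) \in unitmx &
  forall i l, (\adj (colsub J Phi) *m Phi) i l != 0 -> om (J i) <= om l].
Proof.
have [J [Ji UJ h]] := min_minor; exists J; split=> //.
  have dU : \det (colsub J Phi) \is a GRing.unit by rewrite -unitmxE.
  have := mul_adj_mx (colsub J Phi) => E.
  have : \adj (colsub J Phi) *m colsub J Phi \in unitmx.
    by rewrite E unitmxE det_scalar unitrX.
  by rewrite unitmx_mul => /andP[].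
move=> i l nz; apply: h; apply: contraNneq nz => z.
have -> : \adj (colsub J Phi) = \det (colsub J Phi) *: invmx (colsub J Phi).
  by rewrite /invmx UJ scalerA divff ?scale1r // -unitfE -unitmxE.
by rewrite -scalemxAl mxE z mulr0.
Qed.

End MinimalMinor.

(** * The spaces V(s) *)

Section CoefficientSpaces.
Variables (k K : fieldType) (iota : {rmorphism k -> K}) (n : nat) (F1 F2 : {mpoly K[n]}).
Notation inV := (inV iota F1 F2). Notation coefs := (coefs F1 F2).

Lemma inV_gen s (f : {ffun 'I_s -> 'I_(size coefs)}) : inV s (coef_prod f).
Proof.
exists 1%N, (fun _ => 1), (fun _ => f); by rewrite big_ord1 rmorph1 mul1r.
Qed.

Lemma inV0 s : inV s 0.
Proof.
have h (i : 'I_0) : False by case: i.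
exists 0%N, (fun i => 0), (fun i => match h i with end); by rewrite big_ord0.
Qed.

Lemma inVD s x y : inV s x -> inV s y -> inV s (x + y).
Proof.
move=> [N [c [f ->]]] [N' [c' [f' ->]]].
exists (N + N')%N, (fun i => match split i with inl j => c j | inr j => c' j end),
  (fun i => match split i with inl j => f j | inr j => f' j end).
rewrite big_split_ord /=; congr (_ + _); apply: eq_bigr => i _.
  by rewrite (unsplitK (inl i)).
by rewrite (unsplitK (inr i)).
Qed.

Lemma inVZ s a x : inV s x -> inV s (iota a * x).
Proof.
move=> [N [c [f ->]]]; exists N, (fun i => a * c i), f.
by rewrite mulr_sumr; apply: eq_bigr => i _; rewrite rmorphM mulrA.
Qed.

Lemma inV_sum s (I : Type) (r : seq I) (Q : pred I) (F : I -> K) :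
  (forall i, Q i -> inV s (F i)) -> inV s (\sum_(i <- r | Q i) F i).
Proof. by move=> h; elim/big_ind: _ => //; [exact: inV0|move=> ? ?; exact: inVD]. Qed.

Lemma coef_prod_join s s' (f : {ffun 'I_s -> 'I_(size coefs)})
  (f' : {ffun 'I_s' -> 'I_(size coefs)}) :
  inV (s + s') (coef_prod f * coef_prod f').
Proof.
pose g : {ffun 'I_(s + s') -> 'I_(size coefs)} :=
  [ffun i => match split i with inl j => f j | inr j => f' j end].
suff -> : coef_prod f * coef_prod f' = coef_prod g by exact: inV_gen.
rewrite /coef_prod big_split_ord /=; congr (_ * _); apply: eq_bigr => i _; rewrite ffunE.
  by rewrite (unsplitK (inl i)).
by rewrite (unsplitK (inr i)).
Qed.

Lemma inVM s s' x y : inV s x -> inV s' y -> inV (s + s') (x * y).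
Proof.
move=> [N [c [f ->]]] [N' [c' [f' ->]]]; rewrite mulr_suml; apply: inV_sum => i _.
rewrite mulr_sumr; apply: inV_sum => j _.
by rewrite mulrACA -rmorphM; apply: inVZ; exact: coef_prod_join.
Qed.

Lemma inV_coef x : x \in coefs -> inV 1 x.
Proof.
move=> xc; have ix : (index x coefs < size coefs)%N by rewrite index_mem.
have := inV_gen ([ffun => Ordinal ix] : {ffun 'I_1 -> 'I_(size coefs)}).
by rewrite /coef_prod big_ord1 ffunE /= nth_index.
Qed.

Lemma inV_0_1 : inV 0 1.
Proof.
have h (i : 'I_0) : False by case: i.
have := inV_gen ([ffun i => match h i with end] : {ffun 'I_0 -> 'I_(size coefs)}).
by rewrite /coef_prod big_ord0.
Qed.

Lemma inV_prod s (F : 'I_s -> K) : (forall i, inV 1 (F i)) -> inV s (\prod_i F i).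
Proof.
elim: s F => [|s IH] F h; first by rewrite big_ord0; exact: inV_0_1.
by rewrite big_ord_recl; apply: (@inVM 1 s) => //; apply: IH.
Qed.

Lemma inV_det s (A : 'M[K]_s) : (forall i j, inV 1 (A i j)) -> inV s (\det A).
Proof.
move=> h; apply: inV_sum => p _; rewrite -(rmorphN1 iota) -rmorphXn; apply: inVZ.
exact: inV_prod.
Qed.

Lemma inV_adj s (A : 'M[K]_s) i j : (forall i j, inV 1 (A i j)) -> inV s.-1 (\adj A i j).
Proof.
move=> h; rewrite mxE /cofactor -(rmorphN1 iota) -rmorphXn; apply: inVZ.
by apply: inV_det => a b; rewrite !mxE.
Qed.

Lemma inV_coeff (b : bool) l : inV 1 ((if b then F1 else F2)@_l).
Proof.
have [h|h] := boolP (l \in msupp (if b then F1 else F2)).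
  apply: inV_coef; rewrite mem_cat; case: b h => h; apply/orP; [left|right];
  by apply/mapP; exists l.
by rewrite memN_msupp_eq0 //; exact: inV0.
Qed.

Hypothesis has1 : exists mo, F1@_mo = 1.

Lemma inV1 : inV 1 1.
Proof. by have [mo <-] := has1; exact: (inV_coeff true). Qed.

Lemma inV_leq s s' x : (s <= s')%N -> inV s x -> inV s' x.
Proof.
move=> /subnK <-; elim: (s' - s)%N => [|i IH] // hx.
by rewrite addSn -[x]mul1r -add1n; apply: inVM; [exact: inV1|exact: IH].
Qed.

Lemma inV_one s : inV s 1.
Proof. exact: inV_leq (leq0n s) inV_0_1. Qed.

Lemma klin_setP (T : finType) (f : T -> K) (A : {set T}) :
  klin_indep iota (fun i : 'I_#|A| => f (enum_val i)) <->
  (forall c : T -> k, \sum_(x in A) iota (c x) * f x = 0 -> forall x, x \in A -> c x = 0).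
Proof.
split=> [h c c0 x xA|h c c0 i].
  have := h (fun i => c (enum_val i)); rewrite -(big_enum_val (fun x => iota (c x) * f x)).
  by move=> /(_ c0 (enum_rank_in xA x)); rewrite enum_rankK_in.
have iA := enum_valP i.
have := h (fun x => c (enum_rank_in iA x)) _ _ iA; rewrite enum_valK_in; apply.
rewrite -[RHS]c0 big_enum_val; apply: eq_bigr => j _; by rewrite enum_valK_in.
Qed.

(** A set of products attaining the maximum in [dimV] spans, since otherwise some product could be
    added to it. *)
Lemma dimV_basis s : exists b : 'I_(dimV iota F1 F2 s) -> K,
  [/\ klin_indep iota b, forall i, inV s (b i) &
      forall x, inV s x -> exists c, x = \sum_i iota (c i) * b i].
Proof.
pose T : finType := {ffun 'I_s -> 'I_(size coefs)}.
pose f (x : T) := coef_prod x.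
pose ind (A : {set T}) := klin_indep iota (fun i : 'I_#|A| => f (enum_val i)).
pose w (A : {set T}) := (if excluded_middle_informative (ind A) then #|A| else 0)%N.
have [A wA] : exists A, dimV iota F1 F2 s = w A.
  have [|A AE] := @bigop.eq_bigmax {set T} w; last by exists A.
  by apply/card_gt0P; exists set0.
have [A' [indA wA']] : exists A', ind A' /\ dimV iota F1 F2 s = #|A'|.
  rewrite /w in wA; destruct (excluded_middle_informative (ind A)) as [h|h]; first by exists A.
  (* If the maximum is attained at a dependent set it is the default value 0, attained by the empty
     set as well. *)
  exists set0; rewrite cards0 wA; split=> //.
  by apply/klin_setP => c _ x; rewrite inE.
have span x : exists c : T -> k, f x = \sum_(y in A') iota (c y) * f y.
  have [xA|xA] := boolP (x \in A').
    exists (fun y => (y == x)%:R); rewrite (bigD1 x) //= eqxx rmorph1 mul1r big1 ?addr0 //.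
    by move=> y /andP[_ /negPf->]; rewrite rmorph0 mul0r.
  apply: NNPP => H; have ixA : ind (x |: A').
    apply/klin_setP => c; rewrite big_setU1 //= => c0.
    have cx : c x = 0.
      apply/eqP/negPn/negP => cx; apply: H; exists (fun y => - (c x)^-1 * c y).
      under eq_bigr do rewrite rmorphM -mulrA.
      rewrite -mulr_sumr rmorphN fmorphV; have ic : iota (c x) != 0 by rewrite fmorph_eq0.
      by apply: (mulfI ic); rewrite mulNr mulrN mulVKf //; apply/eqP; rewrite -addr_eq0 c0.
    move=> y; rewrite !inE => /orP[/eqP->//|yA].
    by move/klin_setP: indA; apply=> //; rewrite -[RHS]c0 cx rmorph0 mul0r add0r.
  have : (w (x |: A') <= dimV iota F1 F2 s)%N by exact: (leq_bigmax (F := w)).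
  rewrite /w; destruct (excluded_middle_informative (ind (x |: A'))) as [h|h] => //=.
  by rewrite cardsU1 xA wA' add1n ltnn.
have {wA A} E : dimV iota F1 F2 s = #|A'| := wA'.
suff : exists b : 'I_#|A'| -> K, [/\ klin_indep iota b, forall i, inV s (b i) &
      forall x, inV s x -> exists c, x = \sum_i iota (c i) * b i] by rewrite -E.
exists (fun i => f (enum_val i)); split=> //; first by move=> i; exact: inV_gen.
move=> x [N [c [g ->]]].
have /(@choice _ _)[d dE] : forall j, exists d : T -> k, f (g j) = \sum_(y in A') iota (d y) * f y.
  by move=> j; exact: span.
exists (fun i => \sum_j c j * d j (enum_val i)).
rewrite (eq_bigr (fun j => \sum_(y in A') iota (c j * d j y) * f y)) => [|j _]; last first.
  by rewrite -/(f (g j)) dE mulr_sumr; apply: eq_bigr => y _; rewrite rmorphM mulrA.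
rewrite exchange_big big_enum_val /=; apply: eq_bigr => i _.
by rewrite rmorph_sum mulr_suml.
Qed.

Lemma dimV_leq s s' : (s <= s')%N -> (dimV iota F1 F2 s <= dimV iota F1 F2 s')%N.
Proof.
move=> le; have [b [bi bV _]] := dimV_basis s; have [b' [_ _ sp]] := dimV_basis s'.
have /(@choice _ _)[c cE] := fun i => sp _ (inV_leq le (bV i)).
by apply: (klin_bound (A := \matrix_(i, j) c i j) (z := b') bi) => i; rewrite cE;
  apply: eq_bigr => j _; rewrite mxE.
Qed.

Lemma dimV_gt0 s : (0 < dimV iota F1 F2 s)%N.
Proof.
have [b [_ _ sp]] := dimV_basis s; have [c] := sp 1 (inV_one s).
case: (dimV iota F1 F2 s) b c sp => // b c _; rewrite big_ord0 => /eqP.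
by rewrite oner_eq0.
Qed.

Section Values.
Variables (P : choiceType) (v : P -> K -> int).
Hypothesis Hv : forall p, is_dvaluation iota (v p).

Lemma inV_vge p mu s x : (forall a, a \in coefs -> vge v p mu a) -> inV s x ->
  vge v p (s%:Z * mu) x.
Proof.
move=> h [N [c [f ->]]]; apply: (vge_sum Hv) => j _; apply: (vgeZ Hv).
have -> : s%:Z * mu = \sum_(i < s) mu by rewrite sumr_const card_ord -mulr_natl natz.
by apply: (vge_prod Hv) => i _; apply: h; exact: mem_nth.
Qed.

End Values.
End CoefficientSpaces.

(** * Local and global estimates *)

Lemma complete_basis (k : fieldType) q r (X : 'M[k]_(q, q + r)) : row_free X ->
  exists Y : 'M_(r, q + r), col_mx X Y \in unitmx.
Proof.
move=> fX; exists (row_mx 0 1%:M *m row_ebase X).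
have E : col_mx X (row_mx 0 1%:M *m row_ebase X) = block_mx (col_ebase X) 0 0 1%:M *m row_ebase X.
  rewrite block_mxEv mul_col_mx; congr col_mx.
  rewrite -[X in LHS]mulmx_ebase; congr (_ *m _); rewrite (eqP fX).
  by rewrite pid_mx_row mul_mx_row mulmx1 mulmx0.
rewrite E unitmx_mul row_ebase_unit andbT unitmxE det_lblock det1 mulr1 -unitmxE.
exact: col_ebase_unit.
Qed.

(** By pigeonhole one of N + 1 distinct integers at least a is at least a + N; remove it and
    induct. *)
Lemma distinct_sum N (u : 'I_N -> int) (a : int) : injective u -> (forall i, a <= u i) ->
  N%:Z * a + 'C(N, 2)%:Z <= \sum_i u i.
Proof.
elim: N u => [|N IH] u ui ua; first by rewrite big_ord0 mul0r.
have [i hi] : exists i, a + N%:Z <= u i.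
  apply: NNPP => H; have lt i : (absz (u i - a)%R < N)%N.
    rewrite ltnNge; apply/negP => h; apply: H; exists i; have := ua i; lia.
  have /leq_card : injective (fun i : 'I_N.+1 => Ordinal (lt i)).
    move=> i j /(congr1 val) /= h; apply: ui; have := ua i; have := ua j; lia.
  by rewrite !card_ord ltnn.
rewrite (bigD1_ord i) //=.
have := IH (fun j => u (lift i j)) _ (fun j => ua (lift i j)).
move=> /(_ _) h; have {}h := h (fun x y e => @lift_inj _ i x y (ui _ _ e)).
have -> : 'C(N.+1, 2)%:Z = 'C(N, 2)%:Z + N%:Z by rewrite binS bin1 addnC PoszD addrC.
rewrite intS mulrDl mul1r; move: (\sum_(_ < _) _) h hi; lia.
Qed.

Section LinearCombinations.
Variables (F K : fieldType) (phi : {rmorphism F -> K}).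

Lemma lcombB m N (A B : 'M[F]_(m, N)) y i :
  lcomb phi (A - B) y i = lcomb phi A y i - lcomb phi B y i.
Proof.
by rewrite /lcomb -sumrB; apply: eq_bigr => j _; rewrite !mxE rmorphB mulrBl.
Qed.

Lemma lcombZ m N c (A : 'M[F]_(m, N)) y i :
  lcomb phi (c *: A) y i = phi c * lcomb phi A y i.
Proof.
by rewrite /lcomb mulr_sumr; apply: eq_bigr => j _; rewrite !mxE rmorphM mulrA.
Qed.

Lemma lcomb_delta m N (y : 'I_N -> K) (j : 'I_m) l i :
  lcomb phi (delta_mx j l) y i = (i == j)%:R * y l.
Proof.
rewrite /lcomb (bigD1 l) //= mxE eqxx andbT rmorph_nat big1 ?addr0 // => x xl.
by rewrite mxE (negPf xl) andbF rmorph0 mul0r.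
Qed.

Lemma lcomb1 N (y : 'I_N -> K) i : lcomb phi 1%:M y i = y i.
Proof.
rewrite /lcomb (bigD1 i) //= mxE eqxx rmorph1 mul1r big1 ?addr0 // => x xi.
by rewrite mxE eq_sym (negPf xi) rmorph0 mul0r.
Qed.

End LinearCombinations.

Section ValuationBounds.
Variables (k K : fieldType) (iota : {rmorphism k -> K}) (P : choiceType) (v : P -> K -> int).
Hypothesis Hv : forall p, is_dvaluation iota (v p).
Variables (p : P) (N : nat) (f : 'I_N -> K) (W c : int).
Hypothesis H : forall (A : 'M[k]_N) (a : 'I_N -> int), A \in unitmx ->
  (forall i, vge v p (a i) (lcomb iota A f i)) -> \sum_i a i + c <= W.
Variable a : int.
Hypothesis fa : forall j, vge v p a (f j).

Let comb_a m (A : 'M[k]_(m, N)) i : vge v p a (lcomb iota A f i).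
Proof. by apply: (vge_sum Hv) => j _; apply: (vgeZ Hv). Qed.

(* Complete q independent combinations to a basis. *)
Lemma exchange_bound q (X : 'M[k]_(q, N)) (bd : 'I_q -> int) : row_free X ->
  (forall i, vge v p (bd i) (lcomb iota X f i)) ->
  \sum_i bd i + (N%:Z - q%:Z) * a + c <= W.
Proof.
move=> fX hX; have qN : (q <= N)%N by rewrite -(eqP fX) rank_leq_col.
have [r E] : exists r, N = (q + r)%N by exists (N - q)%N; rewrite subnKC.
move: f H fa X fX hX comb_a; rewrite E => f' H' fa' X fX hX hc.
have [Y UY] := complete_basis fX.
pose a' (i : 'I_(q + r)) := match split i with inl x => bd x | inr _ => a end.
have aE : \sum_i a' i = \sum_i bd i + r%:Z * a.
  rewrite big_split_ord /a'; congr (_ + _).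
    by apply: eq_bigr => i _; rewrite (unsplitK (inl i)).
  rewrite (eq_bigr (fun=> a)) => [|i _]; last by rewrite (unsplitK (inr i)).
  by rewrite sumr_const card_ord -mulr_natl natz.
have := H' _ a' UY; rewrite aE PoszD [q%:Z + _]addrC addrK; apply=> i.
rewrite /a'; case: (split_ordP i) => j ->; rewrite ?(unsplitK (inl j)) ?(unsplitK (inr j)) //.
suff -> : lcomb iota (col_mx X Y) f' (lshift r j) = lcomb iota X f' j by exact: hX.
by apply: eq_bigr => l _; rewrite col_mxEu.
Qed.

Hypothesis ratio : forall x y, x != 0 -> vge v p (v p x) y ->
  exists c, vge v p (v p x + 1) (y - iota c * x).
Hypothesis find : klin_indep iota f.

(* Some k-basis of the span of f has pairwise distinct orders at p; the orders increase
   under reduction, and the hypothesis bounds their sum. *)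
Lemma echelon_bound : N%:Z * a + 'C(N, 2)%:Z + c <= W.
Proof.
(* The natural number m bounds the number of reductions left: each raises the sum of the orders,
   which never exceeds W - c. *)
have main (m : nat) (A : 'M[k]_N) : A \in unitmx ->
    W - c - \sum_i v p (lcomb iota A f i) < m%:Z -> N%:Z * a + 'C(N, 2)%:Z + c <= W.
  elim: m A => [|m IH] A UA lt.
    have := H UA (fun i => vge_refl v p (lcomb iota A f i)).
    by move: (\sum_i _) lt => S; lia.
  have indA : klin_indep iota (lcomb iota A f) by apply: klin_lcomb; rewrite ?row_free_unit.
  have A0 i : lcomb iota A f i != 0 by exact: klin_neq0 indA.
  have [inj|ninj] := classic (injective (fun i => v p (lcomb iota A f i))).
    have := H UA (fun i => vge_refl v p (lcomb iota A f i)).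
    have := distinct_sum (a := a) inj; move: (\sum_i _) => S h1 h2.
    have {}h1 : N%:Z * a + 'C(N, 2)%:Z <= S by apply: h1 => i; rewrite -vgeE //.
    by apply: le_trans h2; rewrite lerD2r.
  have [i [j [ij vij]]] : exists i j, i != j /\ v p (lcomb iota A f i) = v p (lcomb iota A f j).
    apply: NNPP => Hn; apply: ninj => i j e; apply/eqP/negPn/negP => ne; apply: Hn.
    by exists i, j.
  have [c0 hc0] : exists c, vge v p (v p (lcomb iota A f i) + 1)
      (lcomb iota A f j - iota c * lcomb iota A f i).
    by apply: ratio => //; rewrite vij; exact: vge_refl.
  pose T : 'M[k]_N := 1%:M - c0 *: delta_mx j i.
  have UT : T \in unitmx.
    have : T *m (1%:M + c0 *: delta_mx j i) = 1%:M.
      rewrite /T mulmxDr mulmx1 mulmxBl mul1mx -scalemxAl -scalemxAr mul_delta_mx_0 //.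
      by rewrite !scaler0 subr0 subrK.
    by move=> /mulmx1_unit[].
  have TE l : lcomb iota (T *m A) f l =
      lcomb iota A f l - (l == j)%:R * (iota c0 * lcomb iota A f i).
    by rewrite lcombM /T lcombB lcomb1 lcombZ lcomb_delta mulrCA.
  have UTA : T *m A \in unitmx by rewrite unitmx_mul UT UA.
  have TA0 : lcomb iota (T *m A) f j != 0.
    by apply: (@klin_neq0 _ _ iota N); apply: klin_lcomb => //; rewrite row_free_unit.
  apply: (IH _ UTA); move: lt; rewrite (bigD1 j) //= [X in _ -> _ - X < _](bigD1 j) //=.
  have -> : \sum_(l < N | l != j) v p (lcomb iota (T *m A) f l) =
            \sum_(l < N | l != j) v p (lcomb iota A f l).
    by apply: eq_bigr => l lj; rewrite TE (negPf lj) mul0r subr0.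
  have : v p (lcomb iota A f j) + 1 <= v p (lcomb iota (T *m A) f j).
    by rewrite -vgeE // -vij TE eqxx mul1r.
  move: (\sum_(_ < _ | _) _) (v p (lcomb iota A f j)) (v p (lcomb iota (T *m A) f j)) => S x y.
  move: (W - c) => Wc; lia.
apply: (main (absz (W - c - \sum_i v p (lcomb iota 1%:M f i))%R).+1 1%:M); first exact: unitmx1.
by move: (_ - _); lia.
Qed.

End ValuationBounds.

Section CoefficientValuations.
Variables (k K : fieldType) (iota : {rmorphism k -> K}) (P : choiceType) (v : P -> K -> int)
  (n : nat).
Hypothesis Hv : forall p, is_dvaluation iota (v p).
Hypothesis Hfin : forall x, x != 0 -> finsupp (fun p => v p x).
Implicit Types F : {mpoly K[n]}.

Definition minval F p := \big[Num.min/ v p (mleadc F)]_(l <- msupp F) v p F@_l.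

Lemma hpolyE F : hpoly v F = fsum (fun p => - minval F p). Proof. by []. Qed.

Lemma minval_le F p l : l \in msupp F -> minval F p <= v p F@_l.
Proof.
rewrite /minval; elim: (msupp F) => // a s IH; rewrite inE big_cons ge_min.
by move=> /orP[/eqP->|/IH->]; rewrite ?lexx // orbT.
Qed.

Lemma minval_vge F p l : vge v p (minval F p) F@_l.
Proof.
have [h|h] := boolP (l \in msupp F); first by rewrite vgeE ?minval_le // -mcoeff_msupp.
by rewrite memN_msupp_eq0 // vge0.
Qed.

Lemma minval_le0 F p : (exists l, F@_l = 1) -> minval F p <= 0.
Proof.
move=> [l F1]; rewrite -(v1 Hv p) -F1; apply: minval_le.
by rewrite mcoeff_msupp F1 oner_neq0.
Qed.

Lemma finsupp_seq (T : eqType) (s : seq T) (f : T -> K) : (forall x, x \in s -> f x != 0) ->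
  exists Z : seq P, forall p x, x \in s -> v p (f x) != 0 -> p \in Z.
Proof.
elim: s => [|a s IH] h; first by exists [::].
have [|Z hZ] := IH; first by move=> x xs; apply: h; rewrite inE xs orbT.
have [Z' hZ'] := Hfin (h a (mem_head _ _)).
exists (Z' ++ Z) => p x; rewrite inE mem_cat => /orP[/eqP->|xs] vx.
  by rewrite hZ'.
by rewrite (hZ p x xs vx) orbT.
Qed.

Lemma finsupp_minval F : F != 0 -> finsupp (minval F).
Proof.
move=> F0; have [|Z hZ] := @finsupp_seq _ (msupp F) (fun l => F@_l).
  by move=> l; rewrite mcoeff_msupp.
exists Z => p; apply: contraNT => pZ; apply/eqP.
have z l : l \in msupp F -> v p F@_l = 0.
  by move=> ls; apply/eqP; apply: contraNT pZ; exact: hZ.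
rewrite /minval; have : v p (mleadc F) = 0 by apply: z; rewrite mlead_supp.
move=> ->; elim: (msupp F) z => [|a s IH] z; first by rewrite big_nil.
rewrite big_cons z ?mem_head // IH ?minxx // => l ls; apply: z; by rewrite inE ls orbT.
Qed.

Variable g : 'I_n -> K.
Hypothesis g0 : forall i, g i != 0.

Lemma gpow_neq0 l : gpow g l != 0.
Proof. by rewrite /gpow; apply/prodf_neq0 => i _; rewrite expf_neq0. Qed.

Lemma v_gpow p l : v p (gpow g l) = \sum_i (l i)%:Z * v p (g i).
Proof.
rewrite /gpow (v_prod Hv) => [|i _]; last by rewrite expf_neq0.
by apply: eq_bigr => i _; rewrite (vX Hv).
Qed.

Lemma meval_gpow l : ('X_[l] : {mpoly K[n]}).@[g] = gpow g l.
Proof. by rewrite mevalX. Qed.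

Lemma meval_wide F m : (msize F <= m)%N ->
  F.@[g] = \sum_(l : 'X_{1..n < m}) F@_l * gpow g l.
Proof.
move=> h; rewrite {1}(mpolywE h) raddf_sum /=; apply: eq_bigr => l _.
by rewrite mevalZ meval_gpow.
Qed.

Lemma mdeg_le (l : 'X_{1..n}) i : (l i <= mdeg l)%N.
Proof. by rewrite mdegE (bigD1 i) //= leq_addr. Qed.

Definition posval p := \sum_i Num.max 0 (v p (g i)).
Definition negval p := \sum_i Num.max 0 (- v p (g i)).

Lemma v_gpow_le p l m : (mdeg l <= m)%N -> v p (gpow g l) <= m%:Z * posval p.
Proof.
move=> lm; rewrite v_gpow mulr_sumr; apply: ler_sum => i _.
have li := leq_trans (mdeg_le l i) lm.
apply: (@le_trans _ _ ((l i)%:Z * Num.max 0 (v p (g i)))).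
  by rewrite ler_wpM2l // le_max lexx orbT.
by rewrite ler_wpM2r // le_max lexx.
Qed.

Lemma v_gpow_ge p l m : (mdeg l <= m)%N -> - (m%:Z * negval p) <= v p (gpow g l).
Proof.
move=> lm; rewrite v_gpow mulr_sumr -sumrN; apply: ler_sum => i _.
have li := leq_trans (mdeg_le l i) lm.
rewrite lerNl -mulrN; apply: (@le_trans _ _ ((l i)%:Z * Num.max 0 (- v p (g i)))).
  by rewrite ler_wpM2l // le_max lexx orbT.
by rewrite ler_wpM2r // le_max lexx.
Qed.

End CoefficientValuations.

(** For x the order of F1(g) or F2(g): it can be negative, where the truncated order is 0 and the
    coefficient bound u suffices. *)
Lemma le_add_min_max (u x y : int) : u <= 0 -> u <= x ->
  u + Num.min (Num.max 0 x) y <= x.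
Proof.
move=> u0 ux; apply: (@le_trans _ _ (u + Num.max 0 x)); first by rewrite lerD2l ge_min lexx.
by case: (lerP 0 x) => h; rewrite ?gerDr // addr0.
Qed.

(** * Estimates at one place *)

Section LocalEstimates.
Variables (k : closedFieldType) (K : fieldType) (iota : {rmorphism k -> K}).
Variables (P : choiceType) (v : P -> K -> int) (n d m r : nat) (F1 F2 : {mpoly K[n]}).
Hypothesis Hv : forall p, is_dvaluation iota (v p).
Hypothesis ratio : forall p x y, x != 0 -> vge v p (v p x) y ->
  exists c, vge v p (v p x + 1) (y - iota c * x).
Hypothesis s1 : msize F1 = d.+1.
Hypothesis s2 : msize F2 = d.+1.
Hypothesis dm : (2 * d <= m)%N.
Hypothesis r0 : (0 < r)%N.
Hypothesis one1 : exists l, F1@_l = 1.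
Hypothesis one2 : exists l, F2@_l = 1.
Variable g : 'I_n -> K.
Hypothesis g0 : forall i, g i != 0.

Notation M := (Mcoef n d m).
Notation Col := 'X_{1..n < m.+1}.
Notation C := #|{: Col}|.
Notation inV := (inV iota F1 F2).
Notation dimV := (dimV iota F1 F2).
Notation vge := (vge v).

Hypothesis nd : nondeg_over iota F1 F2 (M * r + 1) g m.
Variable rows : 'I_M -> syl_index n d m.
Definition syl_rows_mx : 'M[K]_(M, C) :=
  \matrix_(i, j) (syl_poly F1 F2 (rows i))@_(enum_val j : Col).
Notation Phi := syl_rows_mx.
Hypothesis free : row_free Phi.

Definition monval (l : 'I_C) : K := gpow g (enum_val l : Col).
Definition sylval (j : 'I_M) : K := (syl_poly F1 F2 (rows j)).@[g].

Lemma sylval_lcomb j : sylval j = \sum_l Phi j l * monval l.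
Proof.
rewrite /sylval (meval_wide _ (syl_msize s1 s2 dm (rows j))).
rewrite [LHS](reindex (@enum_val Col {: Col})) /=; last exact: onW_bij (enum_val_bij _).
by apply: eq_bigr => l _; rewrite mxE.
Qed.

Lemma Phi_inV i j : inV 1 (Phi i j).
Proof.
rewrite mxE /syl_poly; case: (mcoeff_shift (if (rows i).1 then F1 else F2) (rows i).2
  (enum_val j : Col)).
  by move=> ->; exact: inV0.
by move=> [l [_ ->]]; exact: inV_coeff.
Qed.

Lemma nondeg_monval (a : 'I_C -> K) : (forall l, inV (M * r + 1) (a l)) ->
  \sum_l a l * monval l = 0 -> forall l, a l = 0.
Proof.
move=> aV a0 l; rewrite -(enum_valK l); apply: (nd (a := fun x => a (enum_rank x))) => //.
rewrite -[RHS]a0 [LHS](reindex (@enum_val Col {: Col})) /=; last exact: onW_bij (enum_val_bij _).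
by apply: eq_bigr => j _; rewrite enum_valK.
Qed.

Lemma nondeg_sylval (a : 'rV[K]_M) : (forall j, inV (M * r) (a 0 j)) ->
  \sum_j a 0 j * sylval j = 0 -> a = 0.
Proof.
move=> aV a0; suff /eqP : a *m Phi = 0 by rewrite mulmx_free_eq0 // => /eqP.
apply/rowP => l; rewrite [RHS]mxE; apply: (nondeg_monval (a := fun l => (a *m Phi) 0 l)) => [j|].
  by rewrite mxE; apply: inV_sum => i _; apply: inVM => //; exact: Phi_inV.
rewrite -[RHS]a0 (eq_bigr (fun l => \sum_j a 0 j * Phi j l * monval l)) => [|j _]; last first.
  by rewrite mxE mulr_suml.
rewrite exchange_big; apply: eq_bigr => j _ /=; rewrite sylval_lcomb mulr_sumr.
by apply: eq_bigr => i _; rewrite mulrA.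
Qed.

Variable b : 'I_(dimV (M * r)) -> K.
Hypothesis bind : klin_indep iota b.
Hypothesis bV : forall s, inV (M * r) (b s).
Hypothesis bspan : forall x, inV (M * r) x -> exists c, x = \sum_i iota (c i) * b i.

Notation Idx := ('I_(dimV (M * r)) * 'I_M)%type.
Definition prodfam (x : Idx) : K := b x.1 * sylval x.2.
Definition prodfam_enum (i : 'I_#|{: Idx}|) : K := prodfam (enum_val i).

Lemma prodfam_indep : klin_indep iota prodfam_enum.
Proof.
apply: klin_enum => c; rewrite (eq_bigr (fun x => iota (c (x.1, x.2)) * prodfam (x.1, x.2))) =>
  [|[]//].
rewrite -(pair_bigA _ (fun s j => iota (c (s, j)) * prodfam (s, j))) /= exchange_big => c0 [s j].
pose a : 'rV[K]_M := \row_j \sum_s iota (c (s, j)) * b s.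
have a0 : a = 0.
  apply: nondeg_sylval => [i|]; first by rewrite mxE; apply: inV_sum => l _; exact: inVZ.
  rewrite -[RHS]c0; apply: eq_bigr => i _; rewrite mxE mulr_suml; apply: eq_bigr => l _.
  by rewrite /prodfam /= mulrA.
apply: (bind (c := fun s => c (s, j))).
by have := congr1 (fun x : 'rV_M => x 0 j) a0; rewrite !mxE.
Qed.

(** Both minima are at most 0 because 1 is a coefficient, so their sum bounds the orders of all
    coefficients of both polynomials; summed over the places it gives - (h(F1) + h(F2)). *)
Definition coefval p := minval v F1 p + minval v F2 p.

Lemma coefval_le0 p : coefval p <= 0.
Proof. by rewrite /coefval -[0]addr0; apply: lerD;
  [exact: (minval_le0 Hv p one1)|exact: (minval_le0 Hv p one2)]. Qed.

Lemma coefval_coeff p (e : bool) l : vge p (coefval p) ((if e then F1 else F2)@_l).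
Proof.
case: e; refine (vge_w (minval_vge v _ p l) _); rewrite /coefval;
have := minval_le0 Hv p one1; have := minval_le0 Hv p one2; lia.
Qed.

Lemma coefval_coefs p a : a \in coefs F1 F2 -> vge p (coefval p) a.
Proof.
by rewrite mem_cat => /orP[] /mapP[l _ ->];
  [exact: (coefval_coeff p true)|exact: (coefval_coeff p false)].
Qed.

Lemma coefval_inV p s x : inV s x -> vge p (s%:Z * coefval p) x.
Proof. exact: inV_vge (@coefval_coefs p). Qed.

Lemma meval_neq0 (e : bool) : (0 < M)%N -> (if e then F1 else F2).@[g] != 0.
Proof.
move=> M0; have sF : msize (if e then F1 else F2) = d.+1 by case: e.
have FV l : inV 1 ((if e then F1 else F2)@_l) by exact: inV_coeff.
move: (if e then F1 else F2) sF FV => F sF FV.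
have sF' : (msize F <= m.+1)%N by rewrite sF ltnS (leq_trans _ dm) // leq_pmull.
rewrite (meval_wide _ sF'); apply/eqP => E.
have F0 : F = 0.
  apply/mpolyP => l; rewrite mcoeff0; have [h|h] := ltnP (mdeg l) m.+1.
    apply: (nd (a := fun x : Col => F@_x) _ E (BMultinom h)) => x.
    by apply: (inV_leq one1 _ (FV x)); rewrite addn1.
  by rewrite memN_msupp_eq0 //; apply: msize_mdeg_ge; exact: leq_trans sF' h.
by have := sF; rewrite F0 msize0.
Qed.

Lemma prodfam_vge p a i : (forall j, vge p a (sylval j)) ->
  vge p ((M * r)%N%:Z * coefval p + a) (prodfam_enum i).
Proof. by move=> h; apply: (vgeM Hv) => //; exact: coefval_inV. Qed.

Variables (p : P) (W c : int).
Notation N0 := #|{: Idx}|.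
Hypothesis H : forall (A : 'M[k]_N0) (a : 'I_N0 -> int), A \in unitmx ->
  (forall i, vge p (a i) (lcomb iota A prodfam_enum i)) -> \sum_i a i + c <= W.

(* At p outside S, every [sylval j] vanishes at least to the common order of F1(g) and
   F2(g), and the bound gains 'C(N0, 2) because a basis can be chosen with distinct orders. *)
Lemma estimate_outside : (forall i, v p (g i) = 0) -> (0 < M)%N ->
  N0%:Z * ((M * r)%N%:Z * coefval p + (coefval p + Num.min (Num.max 0 (v p F1.@[g]))
    (Num.max 0 (v p F2.@[g]))))
   + 'C(N0, 2)%:Z + c <= W.
Proof.
move=> gp M0; apply: (echelon_bound Hv H) => [i|x y|]; last exact: prodfam_indep.
  apply: prodfam_vge => j; rewrite /sylval /syl_poly mevalM meval_gpow.
  rewrite -[X in vge _ X _]add0r; apply: (vgeM Hv).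
    by rewrite vgeE ?gpow_neq0 // (v_gpow Hv) // big1 // => l _; rewrite gp mulr0.
  have gm e : coefval p <= v p (if e then F1 else F2).@[g].
    rewrite -vgeE ?meval_neq0 //.
    have sF : (msize (if e then F1 else F2) <= m.+1)%N by case: e; rewrite ?s1 ?s2; move: dm; lia.
    rewrite (meval_wide _ sF); apply: (vge_sum Hv) => l _; rewrite -[coefval p]addr0.
    apply: (vgeM Hv); first exact: coefval_coeff.
    by rewrite vgeE ?gpow_neq0 // (v_gpow Hv) // big1 // => q _; rewrite gp mulr0.
  have g1 := gm true; have g2 := gm false; have g3 := coefval_le0 p.
  have n1 := meval_neq0 true M0; have n2 := meval_neq0 false M0; rewrite /= in g1 g2 n1 n2.
  case: ((rows j).1); rewrite vgeE //; first exact: le_add_min_max.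
  by rewrite minC; exact: le_add_min_max.
exact: ratio.
Qed.

Let D1 := dimV (M * (r - 1)).

(* At p in S, M combinations of the [sylval j] have at least, up to coefficients, the orders
   of the M monomials selected by a minor of least weight. *)
Lemma estimate_inside :
  (M * D1)%N%:Z * ((M * r)%N%:Z * coefval p) +
  D1%:Z * (\sum_l v p (monval l) - (C%:Z - M%:Z) * (m%:Z * posval v g p)) +
  (N0%:Z - (M * D1)%N%:Z) * ((M * r)%N%:Z * coefval p + (coefval p - m%:Z * negval v g p)) + c <= W.
Proof.
have [b' [b'ind b'V b'span]] := dimV_basis iota F1 F2 (M * (r - 1)).
have [J [Ji UJ Jmin]] := min_minor_adj (fun l => v p (monval l)) free.
set Ad := \adj (colsub J Phi) in UJ Jmin.
pose L i := \sum_j Ad i j * sylval j.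
have AdV i j : inV M.-1 (Ad i j) by apply: inV_adj => a e; rewrite mxE; exact: Phi_inV.
have M0 (i : 'I_M) : (0 < M)%N by exact: leq_ltn_trans (ltn_ord i).
have Mr (i : 'I_M) : (M * (r - 1) + M.-1 <= M * r)%N.
  by have := M0 i; case: r r0 => // r' _; rewrite subn1 /= mulnS addnC leq_add2r leq_pred.
have LE i : L i = \sum_l (Ad *m Phi) i l * monval l.
  rewrite /L (eq_bigr (fun j => \sum_l Ad i j * (Phi j l * monval l))) => [|j _]; last first.
    by rewrite sylval_lcomb mulr_sumr.
  rewrite exchange_big; apply: eq_bigr => l _; rewrite /= mxE mulr_suml.
  by apply: eq_bigr => j _; rewrite mulrA.
have Lv i : vge p (M%:Z * coefval p + v p (monval (J i))) (L i).
  rewrite LE; apply: (vge_sum Hv) => l _; have [->|nz] := eqVneq ((Ad *m Phi) i l) 0.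
    by rewrite mul0r vge0.
  apply: (vgeM Hv); last by rewrite vgeE ?gpow_neq0 //; exact: Jmin.
  apply: coefval_inV; rewrite mxE; apply: inV_sum => j _.
  have := inVM (AdV i j) (Phi_inV j l); by rewrite addn1 (prednK (M0 i)).
pose Idx' : finType := ('I_D1 * 'I_M)%type.
have /(@choice _ _)[co coE] : forall x : Idx' * 'I_M, exists cc,
  b' x.1.1 * Ad x.1.2 x.2 = \sum_s iota (cc s) * b s.
  move=> [[s i] j] /=; apply: bspan; apply: (inV_leq one1 (Mr i)); exact: inVM.
(* [X] holds the coordinates, in the family of products, of the elements b'_s L_i: the coefficients
   b'_s [Ad i j] lie in V(M r), which b spans. *)
pose X : 'M[k]_(#|{: Idx'}|, N0) := \matrix_(x, y) co (enum_val x, (enum_val y : Idx).2)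
  (enum_val y : Idx).1.
have XE x : lcomb iota X prodfam_enum x = b' (enum_val x).1 * L (enum_val x).2.
  pose h (z : Idx) := iota (co (enum_val x, z.2) z.1) * prodfam z.
  transitivity (\sum_z h z).
    rewrite [RHS](reindex (@enum_val Idx {: Idx})) /=; last exact: onW_bij (enum_val_bij _).
    by apply: eq_bigr => y _; rewrite mxE.
  rewrite (eq_bigr (fun z => h (z.1, z.2))) => [|[]//].
  rewrite -(pair_bigA _ (fun s j => iota (co (enum_val x, j) s) * prodfam (s, j))) /= exchange_big
    /L mulr_sumr.
  apply: eq_bigr => j _; rewrite mulrA (coE (enum_val x, j)) mulr_suml.
  by apply: eq_bigr => s _; rewrite /prodfam /= mulrA.
have fX : row_free X.
  apply: inj_row_free => la la0.
  have E0 : \sum_x iota (la 0 x) * (b' (enum_val x).1 * L (enum_val x).2) = 0.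
    transitivity (lcomb iota la (lcomb iota X prodfam_enum) 0).
      by apply: eq_bigr => x _; rewrite XE.
    by rewrite -lcombM la0; apply: big1 => j _; rewrite mxE rmorph0 mul0r.
  pose be : 'rV[K]_M := \row_i \sum_s iota (la 0 (enum_rank ((s, i) : Idx'))) * b' s.
  have E1 : \sum_i be 0 i * L i = 0.
    pose h (x : Idx') := iota (la 0 (enum_rank x)) * (b' x.1 * L x.2).
    have h0 : \sum_x h x = 0.
      rewrite -[RHS]E0 [LHS](reindex (@enum_val Idx' {: Idx'})) /=;
        last exact: onW_bij (enum_val_bij _).
      by apply: eq_bigr => x _; rewrite /h enum_valK.
    rewrite -[RHS]h0 [RHS](eq_bigr (fun x => h (x.1, x.2))) => [|[]//].
    rewrite -(pair_bigA _ (fun s i => h (s, i))) /= [RHS]exchange_big; apply: eq_bigr => i _ /=.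
    by rewrite mxE mulr_suml; apply: eq_bigr => s _; rewrite /h /= mulrA.
  (* The entries of [be] lie in V(M (r - 1)), so those of [be *m Ad] lie in V(M r) and nondegeneracy
     applies; [Ad] being invertible, [be] is 0. *)
  have E2 : be *m Ad = 0.
    apply: nondeg_sylval => [j|].
      rewrite mxE; apply: inV_sum => i _; apply: (inV_leq one1 (Mr i)); apply: inVM => //.
      by rewrite mxE; apply: inV_sum => s _; exact: inVZ.
    rewrite -[RHS]E1 (eq_bigr (fun j => \sum_i be 0 i * (Ad i j * sylval j))) => [|j _]; last first.
      by rewrite mxE mulr_suml; apply: eq_bigr => i _; rewrite mulrA.
    by rewrite exchange_big; apply: eq_bigr => i _; rewrite /= /L mulr_sumr.
  have be0 : be = 0 by rewrite -[be](mulmxK UJ) E2 mul0mx.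
  apply/rowP => x; rewrite [RHS]mxE -(enum_valK x); case: (enum_val x) => s i.
  apply: (b'ind (fun s => la 0 (enum_rank ((s, i) : Idx')))).
  by have := congr1 (fun y : 'rV_M => y 0 i) be0; rewrite !mxE.
pose bd (x : 'I_#|{: Idx'}|) := (M * (r - 1))%N%:Z * coefval p +
  (M%:Z * coefval p + v p (monval (J (enum_val x).2))).
have hbd x : vge p (bd x) (lcomb iota X prodfam_enum x).
  rewrite XE; apply: (vgeM Hv); [exact: coefval_inV|exact: Lv].
have gen i : vge p ((M * r)%N%:Z * coefval p + (coefval p - m%:Z * negval v g p)) (prodfam_enum i).
  apply: prodfam_vge => j; rewrite sylval_lcomb; apply: (vge_sum Hv) => l _; apply: (vgeM Hv).
    by rewrite -[coefval p]mul1r; apply: (@coefval_inV p 1); exact: Phi_inV.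
  rewrite vgeE ?gpow_neq0 //; apply: (v_gpow_ge Hv) => //.
  by have := bmdeg (enum_val l : Col); rewrite ltnS.
have := exchange_bound Hv H gen fX hbd.
have Mr' : (M * (r - 1))%N%:Z + M%:Z = (M * r)%N%:Z.
  by rewrite -PoszD; case: r r0 => // r' _; rewrite subn1 /= mulnS addnC.
have -> : \sum_x bd x = (M * D1)%N%:Z * ((M * r)%N%:Z * coefval p) + D1%:Z * \sum_i v p
  (monval (J i)).
  pose h (x : Idx') := (M * r)%N%:Z * coefval p + v p (monval (J x.2)).
  transitivity (\sum_x h x).
    rewrite [RHS](reindex (@enum_val Idx' {: Idx'})) /=; last exact: onW_bij (enum_val_bij _).
    by apply: eq_bigr => x _; rewrite /bd /h -Mr'; ring.
  rewrite (eq_bigr (fun x => h (x.1, x.2))) => [|[]//].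
  rewrite -(pair_bigA _ (fun s i => h (s, i))).
  transitivity (\sum_(s < D1) (M%:Z * ((M * r)%N%:Z * coefval p) + \sum_i v p (monval (J i)))).
    by apply: eq_bigr => s _; rewrite /h /= big_split /= sumr_const card_ord -mulr_natl natz.
  rewrite sumr_const card_ord -mulr_natl natz PoszM; ring.
have -> : #|{: Idx'}| = (M * D1)%N by rewrite card_prod !card_ord mulnC.
apply: le_trans; rewrite lerD2r lerD2r lerD2l ler_wpM2l //.
(* The chosen monomials have the total order of all monomials minus that of the C - M omitted ones,
   each at most m times the positive parts of the orders of the g_i. *)
rewrite lerBlDr; pose A := [set J i | i : 'I_M].
have cA : #|A| = M by rewrite card_imset // card_ord.
rewrite (bigID (mem A)) /=; apply: lerD.
  by rewrite big_imset //=; move=> x y _ _; exact: Ji.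
have -> : C%:Z - M%:Z = #|~: A|%:Z.
  have e : (M + #|~: A|)%N%:Z = C%:Z by rewrite -cA cardsC card_ord.
  by rewrite -e PoszD addrC addKr.
have -> : #|~: A|%:Z * (m%:Z * posval v g p) = \sum_(l | l \notin A) (m%:Z * posval v g p).
  rewrite sumr_const -mulr_natl natz; congr (_%:Z * _); apply: eq_card => l; by rewrite !inE.
apply: ler_sum => l _; apply: (v_gpow_le Hv) => //.
by have := bmdeg (enum_val l : Col); rewrite ltnS.
Qed.

End LocalEstimates.

Lemma Mcoef_gt0 n d m : (2 * d <= m)%N -> (0 < Mcoef n d m)%N.
Proof.
move=> dm; rewrite /Mcoef subn_gt0.
have h : ('C(m + n - 2 * d, n) <= 'C(m + n - d, n))%N by apply: leq_bin2l; lia.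
have h' : (0 < 'C(m + n - d, n))%N by rewrite bin_gt0; lia.
lia.
Qed.

(** * Summation over all places *)

Section GlobalEstimate.
Variables (k : closedFieldType) (K : fieldType) (iota : {rmorphism k -> K}).
Variables (P : choiceType) (v : P -> K -> int) (genus n d : nat) (S : seq P) (F1 F2 : {mpoly K[n]}).
Hypothesis char0 : [pchar k] =i pred0.
Hypothesis Hm : curve_model iota v.
Hypothesis Hg : is_genus iota v genus.
Hypothesis uS : uniq S.
Hypothesis cop : mcoprime F1 F2.
Hypothesis s1 : msize F1 = d.+1.
Hypothesis s2 : msize F2 = d.+1.
Hypothesis one1 : exists l, F1@_l = 1.
Hypothesis one2 : exists l, F2@_l = 1.
Variables (g : 'I_n -> K) (m r : nat).
Hypothesis gS : forall i, S_unit v S (g i).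
Hypothesis dm : (2 * d <= m)%N.
Hypothesis r0 : (0 < r)%N.

Notation M := (Mcoef n d m).
Notation dimV := (dimV iota F1 F2).
Hypothesis nd : nondeg_over iota F1 F2 (M * r + 1) g m.
Notation H := (\big[Num.max/0]_(i < n) hK v (g i)).
Notation D := (dimV (M * r)).
Notation D1 := (dimV (M * (r - 1))).

Lemma hK_le_max i : hK v (g i) <= H.
Proof. by apply: le_bigmax. Qed.

Lemma Mprime_ge0 : 0 <= Mprime n d m.
Proof.
have [f /eqP fr] := syl_rows cop s1 s2 dm.
rewrite /Mprime subr_ge0 lez_nat -(card_bmultinom n m) -{1}fr; exact: rank_leq_col.
Qed.

Lemma Ngcd_ge0 : 0 <= Ngcd v S F1.@[g] F2.@[g].
Proof.
by apply: fsum_ge0 => p; case: ifP => // _; rewrite le_min !le_max lexx.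
Qed.

Lemma hpoly_ge0 (F : {mpoly K[n]}) : (exists l, F@_l = 1) -> 0 <= hpoly v F.
Proof.
move=> h; rewrite hpolyE; apply: fsum_ge0 => p; rewrite oppr_ge0.
exact: (minval_le0 (cm_val Hm) p h).
Qed.

(** The inequality of the theorem times d_{M(r-1)}, in integers and before any weakening: D still
    multiplies the gcd term, and the binomial coefficient is exact. *)
Lemma integral_estimate :
  (D * M)%N%:Z * Ngcd v S F1.@[g] F2.@[g] <=
    (D * M)%N%:Z * ((M * r).+1%:Z * (hpoly v F1 + hpoly v F2))
    + D1%:Z * (Mprime n d m * (m%:Z * (n%:Z * H)))
    + ((D * M)%N%:Z - (M * D1)%N%:Z) * (m%:Z * (n%:Z * H))
    + 'C(D * M, 2)%:Z * Num.max 0 (2 * genus%:Z - 2 + (size S)%:Z).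
Proof.
have Hv := cm_val Hm; have Hfin := cm_fin Hm.
have g0 i : g i != 0 by have [] := gS i.
have M0 := Mcoef_gt0 n dm.
have ratio p x y : x != 0 -> vge v p (v p x) y -> exists c, vge v p (v p x + 1) (y - iota c * x).
  exact: curve_residue.
have [rows free] := syl_rows cop s1 s2 dm.
have [b [bind bV bspan]] := dimV_basis iota F1 F2 (M * r).
have [h [[T0 hT0] hw]] := curve_wronskian char0 Hm Hg.
have find := prodfam_indep s1 s2 dm nd free bind bV.
have [w [w0 wW]] := hw _ _ find.
have F1g : F1.@[g] != 0 := meval_neq0 s1 s2 dm one1 nd true M0.
have F2g : F2.@[g] != 0 := meval_neq0 s1 s2 dm one1 nd false M0.
have F10 : F1 != 0 by rewrite -msize_poly_eq0 s1.
have F20 : F2 != 0 by rewrite -msize_poly_eq0 s2.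
have card0 : #|{: 'I_D * 'I_M}| = (D * M)%N by rewrite card_prod !card_ord.
(* The orders of all the monomials are those of the single element z, whose divisor has degree 0. *)
pose z := \prod_l monval (m := m) g l.
have mon0 l : monval (m := m) g l != 0 by exact: gpow_neq0.
have z0 : z != 0 by apply/prodf_neq0.
have vz p : v p z = \sum_l v p (monval (m := m) g l) by rewrite (v_prod Hv).
pose ng p := if p \in S then 0 else Num.min (Num.max 0 (v p F1.@[g])) (Num.max 0 (v p F2.@[g])).
pose C2 := 'C(D * M, 2)%:Z.
have D1D : (M * D1 <= D * M)%N.
  by rewrite mulnC leq_mul2r (dimV_leq iota _ one1) ?orbT // leq_mul2l leq_subr orbT.
(* One inequality for all places. The gain [C2] of distinct orders outside S is credited everywhere
   through -1 - h p, and the term in [(p \in S)] takes it back inside S; this is how |S| joins 2 g -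
   2. *)
have loc p : (D * M)%N%:Z * ((M * r).+1%:Z * coefval v F1 F2 p + ng p)
   - D1%:Z * (Mprime n d m * (m%:Z * posval v g p))
   - ((D * M)%N%:Z - (M * D1)%N%:Z) * (m%:Z * negval v g p)
   + D1%:Z * v p z - C2 * (-1 - h p) - C2 * (p \in S)%:Z <= v p w.
  have [pS|pS] := boolP (p \in S).
    have := estimate_inside Hv s1 s2 dm r0 one1 one2 g0 nd free bV bspan (fun A a => wW p A a).
    rewrite card0 -vz /ng pS card_bmultinom -/(Mprime n d m) -/C2.
    have := coefval_le0 Hv one1 one2 p; have : (M * D1)%N%:Z <= (D * M)%N%:Z by rewrite lez_nat.
    move: (coefval _ _ _ _) (_ * posval _ _ _) (_ * negval _ _ _) (v p z) (v p w) (h p) C2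
      (Mprime n d m) => a q q' x y e c M'.
    have -> : (M * r).+1%:Z = M%:Z * r%:Z + 1 by clear; rewrite -PoszM; lia.
    rewrite !(PoszM D) !(PoszM M).
    move: D%:Z M%:Z D1%:Z r%:Z (ltac:(by []) : 0 <= D1%:Z) (ltac:(by []) : 0 <= M%:Z).
    move=> DD MM DD1 rr D0 M0' _ a0; have := mulr_ge0_le0 (mulr_ge0 M0' D0) a0.
    rewrite (_ : (nat_of_bool true)%:Z = 1) //; clear; lia.
  have gp i : v p (g i) = 0 by have [_ ->] := gS i.
  have := estimate_outside Hv ratio s1 s2 dm r0 one1 one2 g0 nd free bind bV (fun A a => wW p A a)
    gp M0.
  rewrite card0 /ng (negbTE pS) -/C2.
  have -> : v p z = 0 by rewrite vz big1 // => l _; rewrite (v_gpow Hv) // big1 // => i _;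
    rewrite gp mulr0.
  have -> : posval v g p = 0 by apply: big1 => i _; rewrite gp.
  have -> : negval v g p = 0 by apply: big1 => i _; rewrite gp.
  move: (coefval _ _ _ _) (Num.min _ _) (v p w) (h p) C2 => a q y e c.
  have -> : (M * r).+1%:Z = (M * r)%N%:Z + 1 by clear; lia.
  rewrite (_ : (nat_of_bool false)%:Z = 0) // !mulr0 !subr0; move: (D * M)%N (M * r)%N => x x'.
  by clear; lia.
have [Zw hZw] := Hfin _ w0; have [Zz hZz] := Hfin _ z0.
have [Z1 hZ1] := Hfin _ F1g; have [Z2 hZ2] := Hfin _ F2g.
have [Y1 hY1] := finsupp_minval Hfin F10; have [Y2 hY2] := finsupp_minval Hfin F20.
have [Zg hZg] := finsupp_seq Hfin (s := enum 'I_n) (f := g) (fun i _ => g0 i).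
pose T := undup (S ++ T0 ++ Zw ++ Zz ++ Z1 ++ Z2 ++ Y1 ++ Y2 ++ Zg).
have uT : uniq T by exact: undup_uniq.
have inT p : p \in T = [|| p \in S, p \in T0, p \in Zw, p \in Zz, p \in Z1, p \in Z2, p \in Y1,
  p \in Y2 | p \in Zg].
  by rewrite mem_undup !mem_cat.
have Sw : \sum_(p <- T) v p w = 0.
  by rewrite -(fsumE uT (a := fun p => v p w)) ?(curve_principal_deg Hm Hg) // => p /hZw;
    rewrite inT => ->; rewrite !orbT.
have Sz : \sum_(p <- T) v p z = 0.
  by rewrite -(fsumE uT (a := fun p => v p z)) ?(curve_principal_deg Hm Hg) // => p /hZz;
    rewrite inT => ->; rewrite !orbT.
have Sg i : \sum_(p <- T) v p (g i) = 0.
  rewrite -(fsumE uT (a := fun p => v p (g i))) ?(curve_principal_deg Hm Hg) // => p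
    /(hZg p i (mem_enum _ _)).
  by rewrite inT => ->; rewrite !orbT.
have SN : \sum_(p <- T) ng p = Ngcd v S F1.@[g] F2.@[g].
  rewrite /Ngcd (fsumE uT) // => p; case: ifP => // _ e.
  have [/hZ1 h1|/negPn/eqP h1] := boolP (v p F1.@[g] != 0); first by rewrite inT h1 !orbT.
  by move: e; rewrite h1 maxxx min_l ?eqxx // le_max lexx.
have Smu : \sum_(p <- T) coefval v F1 F2 p = - (hpoly v F1 + hpoly v F2).
  rewrite !hpolyE !(fsumE uT) => [|p|p]; rewrite ?oppr_eq0.
  - by rewrite !sumrN big_split opprD !opprK.
  - by move=> /hY2; rewrite inT => ->; rewrite !orbT.
  - by move=> /hY1; rewrite inT => ->; rewrite !orbT.
have hKE i : hK v (g i) = \sum_(p <- T) Num.max 0 (- v p (g i)).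
  rewrite /hK (fsumE uT) // => p e; rewrite inT (hZg p i (mem_enum _ _)) ?orbT //.
  by apply: contraNneq e => ->; rewrite oppr0 maxxx.
have hKE' i : hK v (g i) = \sum_(p <- T) Num.max 0 (v p (g i)).
  apply/esym/eqP; rewrite hKE -subr_eq0 -sumrB; apply/eqP; rewrite -[RHS](Sg i).
  by apply: eq_bigr => p _; clear; lia.
have sumH : \sum_i hK v (g i) <= n%:Z * H.
  apply: (@le_trans _ _ (\sum_(i < n) H)); first by apply: ler_sum => i _; exact: hK_le_max.
  by rewrite sumr_const card_ord -mulr_natl natz.
have Spos : \sum_(p <- T) posval v g p <= n%:Z * H.
  apply: le_trans sumH; rewrite /posval exchange_big /=; apply: ler_sum => i _; by rewrite hKE'.
have Sneg : \sum_(p <- T) negval v g p <= n%:Z * H.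
  apply: le_trans sumH; rewrite /negval exchange_big /=; apply: ler_sum => i _; by rewrite hKE.
have Sh : \sum_(p <- T) (-1 - h p) <= 2 * genus%:Z - 2.
  by apply: hT0 => // p; rewrite inT => ->; rewrite orbT.
have SS : \sum_(p <- T) (p \in S)%:Z = (size S)%:Z.
  have pS p : (p \in S)%:Z != 0 -> p \in S by case: (p \in S).
  rewrite -(fsumE uT (a := fun p => (p \in S)%:Z)) => [|p /pS]; last by rewrite inT => ->.
  rewrite (fsumE uS pS) -[RHS]natz -sum1_size natr_sum; by apply: eq_big_seq => p ->.
have : \sum_(p <- T) ((D * M)%N%:Z * ((M * r).+1%:Z * coefval v F1 F2 p + ng p)
   - D1%:Z * (Mprime n d m * (m%:Z * posval v g p))
   - ((D * M)%N%:Z - (M * D1)%N%:Z) * (m%:Z * negval v g p)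
   + D1%:Z * v p z - C2 * (-1 - h p) - C2 * (p \in S)%:Z) <= \sum_(p <- T) v p w.
  by apply: ler_sum => p _; exact: loc.
rewrite Sw !big_split /= !sumrN -!mulr_sumr big_split /= -!mulr_sumr Smu SN Sz SS.
have leC : (M * D1)%N%:Z <= (D * M)%N%:Z by rewrite lez_nat.
have Lpos : D1%:Z * (Mprime n d m * (m%:Z * \sum_(p <- T) posval v g p)) <=
    D1%:Z * (Mprime n d m * (m%:Z * (n%:Z * H))).
  by rewrite !ler_wpM2l // Mprime_ge0.
have Lneg : ((D * M)%N%:Z - (M * D1)%N%:Z) * (m%:Z * \sum_(p <- T) negval v g p) <=
    ((D * M)%N%:Z - (M * D1)%N%:Z) * (m%:Z * (n%:Z * H)).
  by rewrite !ler_wpM2l // subr_ge0.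
have Lchi : C2 * (\sum_(p <- T) (-1 - h p) + (size S)%:Z) <=
    C2 * Num.max 0 (2 * genus%:Z - 2 + (size S)%:Z).
  by rewrite ler_wpM2l // le_max lerD2r Sh orbT.
rewrite -/C2 mulr0 addr0; move: Lpos Lneg Lchi.
move: (D1%:Z * (_ * (_ * \sum_(p <- T) _))) (D1%:Z * (_ * (_ * (n%:Z * _)))).
move: (_ * (m%:Z * \sum_(p <- T) negval v g p)) (_ * (m%:Z * (n%:Z * _))) (C2 * Num.max _ _) => a1
  a2 a3 a4 a5.
move: (\sum_(p <- T) (-1 - h p)) (C2) (Ngcd _ _ _ _) (_ + hpoly _ _) => e c q A.
move: (D * M)%N (M * r)%N (size S) => x y s; clear; lia.
Qed.

End GlobalEstimate.

(** * Growth of M' *)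

Lemma bin_forward_diff (x d n : nat) :
  'C(x + d, n.+1) = ('C(x, n.+1) + \sum_(i < d) 'C(x + i, n))%N.
Proof.
elim: d => [|d IH]; first by rewrite big_ord0 !addn0.
by rewrite addnS binS IH big_ord_recr /= addnA.
Qed.

Lemma bin_le_expn (a j : nat) : ('C(a, j) <= a ^ j)%N.
Proof.
apply: (@leq_trans (a ^_ j)); first by rewrite -bin_ffact leq_pmulr ?fact_gt0.
by rewrite ffact_prod -[X in (_ <= _ ^ X)%N]card_ord -prod_nat_const; apply: leq_prod => i _;
  exact: leq_subr.
Qed.

(* The truncated subtraction in [Mcoef] is exact here. *)
Lemma Mprime_second_diff n d m : (2 * d <= m)%N ->
  Mprime n d m = ('C(m + n, n))%:Z - 2 * ('C(m + n - d, n))%:Z + ('C(m + n - 2 * d, n))%:Z.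
Proof.
move=> dm; have h : ('C(m + n - 2 * d, n) <= 'C(m + n - d, n))%N by apply: leq_bin2l; lia.
rewrite /Mprime /Mcoef; lia.
Qed.

(** M' is a second difference with step d of a binomial coefficient of degree n + 2, thus a sum of
    d^2 binomial coefficients of degree n, whose upper arguments are at most m + n <= (n + 3) m. *)
Lemma Mprime_bound n d m : (0 < d)%N -> (2 * d <= m)%N ->
  0 <= Mprime n.+2 d m <= (d ^ 2 * (n.+3 ^ n * m ^ n))%N%:Z.
Proof.
move=> d0 dm; rewrite Mprime_second_diff //.
pose x := (m + n.+2 - 2 * d)%N.
have -> : (m + n.+2 = (x + d) + d)%N by rewrite /x; lia.
have -> : (x + d + d - d = x + d)%N by lia.
have -> : (x + d + d - 2 * d = x)%N by lia.
have e : ('C(x + d + d, n.+2) + 'C(x, n.+2) = 2 * 'C(x + d, n.+2) + \sum_(i < d) \sum_(j < d)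
  'C(x + i + j, n))%N.
  rewrite (bin_forward_diff (x + d)).
  rewrite (eq_bigr (fun i : 'I_d => 'C(x + i, n.+1) + \sum_(j < d) 'C(x + i + j, n))%N); last first.
    by move=> i _; rewrite addnAC bin_forward_diff.
  have := bin_forward_diff x d n.+1; rewrite big_split /=.
  by move: 'C(x + d, n.+2) 'C(x, n.+2) (\sum_(i < d) 'C(x + i, n.+1))%N
    (\sum_(i < d) \sum_(j < d) _)%N; lia.
have b : (\sum_(i < d) \sum_(j < d) 'C(x + i + j, n) <= d ^ 2 * (n.+3 ^ n * m ^ n))%N.
  apply: (@leq_trans (\sum_(i < d) \sum_(j < d) n.+3 ^ n * m ^ n)%N); last first.
    by rewrite !sum_nat_const !card_ord -mulnn mulnA.
  apply: leq_sum => i _; apply: leq_sum => j _.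
  rewrite -expnMn; apply: leq_trans (bin_le_expn _ _) _.
  have le : (x + i + j <= n.+3 * m)%N by rewrite /x; have := ltn_ord i; have := ltn_ord j; nia.
  by case: (n) le => [|n'] le //; rewrite leq_exp2r.
move: e b; move: 'C(x + d + d, n.+2) 'C(x + d, n.+2) 'C(x, n.+2) (\sum_(i < d) \sum_(j < d) _)%N
  (_ * (_ * _))%N => y1 y2 y3 y4 y5; lia.
Qed.

(** For n = 0 and n = 1 the second difference vanishes, so the negative exponents are harmless with
    C = 0. *)
Lemma Mprime_asymptotics n d : (0 < d)%N -> exists C : rat, forall m : nat, (2 * d <= m)%N ->
  `|(Mprime n d m)%:~R : rat| <= C * (m%:R : rat) ^ (n%:Z - 2).
Proof.
move=> d0; case: n => [|[|n]].
- exists 0 => m dm; rewrite Mprime_second_diff // !bin0; by rewrite mul0r.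
- exists 0 => m dm; rewrite Mprime_second_diff // !bin1 (_ : _ + _ = 0) ?normr0 ?mul0r //; lia.
exists (d ^ 2 * n.+3 ^ n)%N%:R => m dm; have /andP[ge0 le] := Mprime_bound n d0 dm.
have -> : n.+2%:Z - 2 = n%:Z by lia.
rewrite ger0_norm ?ler0z // -exprnP -natrX -natrM -mulnA.
by move: le; rewrite -(ler_int rat).
Qed.

Lemma double_bin2_le (N : nat) : (2 * 'C(N, 2) <= N ^ 2)%N.
Proof. by rewrite mul2n -mulnn (leq_trans (_ : _ <= N * N.-1)%N) ?leq_mul2l ?leq_pred ?orbT //
  bin2 halfK leq_subr. Qed.

Theorem theorem6p3 (k : closedFieldType) (K : fieldType)
    (iota : {rmorphism k -> K}) (P : choiceType) (v : P -> K -> int)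
    (genus : nat) (n d : nat) (S : seq P) (F1 F2 : {mpoly K[n]}) :
  [pchar k] =i pred0 ->
  curve_model iota v -> is_genus iota v genus ->
  uniq S ->
  mcoprime F1 F2 -> (0 < d)%N -> msize F1 = d.+1 -> msize F2 = d.+1 ->
  (exists mo, F1@_mo = 1) -> (exists mo, F2@_mo = 1) ->
  (exists C : rat, forall m : nat, (2 * d <= m)%N ->
       `|(Mprime n d m)%:~R : rat| <= C * (m%:R : rat) ^ (n%:Z - 2)) /\
  (forall (g : 'I_n -> K) (m r : nat),
     let M := Mcoef n d m in
     let M' := Mprime n d m in
     (forall i, S_unit v S (g i)) -> (2 * d <= m)%N -> (0 < r)%N ->
     nondeg_over iota F1 F2 (M * r + 1) g m ->
     let dr := (dimV iota F1 F2 (M * r))%:R : rat in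
     let dr1 := (dimV iota F1 F2 (M * (r - 1)))%:R : rat in
     let c := dr / dr1 * (1 + M%:R * (r%:R + 1)) in
     let c' := dr ^+ 2 * M%:R / (2 * dr1) in
     M%:R * (Ngcd v S (F1.@[g]) (F2.@[g]))%:~R
       <= (M'%:~R + dr / dr1 * M%:R - M%:R) * m%:R * n%:R
            * (\big[Num.max/0]_(i < n) hK v (g i))%:~R
          + c * M%:R * (hpoly v F1 + hpoly v F2)%:~R
          + c' * M%:R * (Num.max 0 (2 * genus%:Z - 2 + (size S)%:Z))%:~R).
Proof.
move=> char0 Hm Hg uS cop d0 s1 s2 one1 one2; split; first exact: Mprime_asymptotics.
move=> g m r; cbv zeta => gS dm r0 nd.
have est := integral_estimate char0 Hm Hg uS cop s1 s2 one1 one2 gS dm r0 nd.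
have q0 := Ngcd_ge0 v S F1 F2 g.
have A0 := addr_ge0 (hpoly_ge0 Hm one1) (hpoly_ge0 Hm one2).
have D1D := dimV_leq iota F2 one1 (leq_mul (leqnn (Mcoef n d m)) (leq_subr 1 r)).
have D1pos := dimV_gt0 iota F2 one1 (Mcoef n d m * (r - 1)).
have chi0 : 0 <= Num.max 0 (2 * genus%:Z - 2 + (size S)%:Z) by rewrite le_max lexx.
move: est.
move: (dimV _ _ _ (_ * r)) (dimV _ _ _ (_ * (r - 1))) D1D D1pos => D D1 D1D D1pos.
move: (Ngcd _ _ _ _) (hpoly v F1 + hpoly v F2) (Num.max 0 (2 * _ - _ + _)) (\big[_/_]_(i < n) _)
  q0 A0 chi0.
move=> q A chi H q0 A0 chi0 est.
move: (Mcoef n d m) (Mprime n d m) est => M M' est.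
(* The estimate doubled, to absorb the binomial coefficient into a square, and weakened: D1 <= D on
   the left, and 1 + M r <= 1 + M (r + 1) before the heights of F1 and F2. *)
have key : 2 * D1%:Z * M%:Z * q <= 2 * D%:Z * M%:Z * (1 + M%:Z * (r%:Z + 1)) * A
    + 2 * (D1%:Z * M' + D%:Z * M%:Z - D1%:Z * M%:Z) * (m%:Z * n%:Z * H) + (D%:Z * M%:Z) ^+ 2 * chi.
  have e1 : D1%:Z * M%:Z * q <= D%:Z * M%:Z * q by rewrite !ler_wpM2r // lez_nat.
  have e2 : 0 <= D%:Z * M%:Z * M%:Z * A by rewrite !mulr_ge0.
  have e3 : 2 * 'C(D * M, 2)%:Z * chi <= (D%:Z * M%:Z) ^+ 2 * chi.
    rewrite ler_wpM2r // -PoszM -[_ ^+ 2]/(_ * _) -PoszM -(PoszM 2) lez_nat mulnn.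
    exact: double_bin2_le.
  move: est; rewrite (_ : (M * r).+1%:Z = M%:Z * r%:Z + 1); last by rewrite -PoszM; lia.
  rewrite !PoszM => est; lia.
have D1q : (D1%:R : rat) != 0 by rewrite pnatr_eq0 -lt0n.
rewrite -subr_ge0; move: key; rewrite -subr_ge0 -(ler0z rat) => key.
(* The difference of the two sides is that of [key] divided by 2 d_{M(r-1)}, which is positive. *)
set R := (X in 0 <= X).
have -> : R = (2 * D%:Z * M%:Z * (1 + M%:Z * (r%:Z + 1)) * A
    + 2 * (D1%:Z * M' + D%:Z * M%:Z - D1%:Z * M%:Z) * (m%:Z * n%:Z * H) + (D%:Z * M%:Z) ^+ 2 * chi
    - 2 * D1%:Z * M%:Z * q)%:~R / (2 * D1%:R).
  rewrite /R !(rmorphD, rmorphB, rmorphM, rmorphXn) /=; field; exact: D1q.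
by rewrite divr_ge0 // mulr_ge0 // ler0n.
Qed.
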